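(* Let $x^*$ be a non-circular non-rectilinear $T^*$-periodic solution (for some $T^*>0$), lying on the plane $x_3=0$, of the unperturbed problem $$\frac{\mathrm d}{\mathrm dt}\bigl(\varphi(\dot x)\bigr)=V'(|x|)\frac{x}{|x|},\qquad x\in\mathbb R^3\setminus\{0\},$$ let $h=\mathcal E_0(x^*(t),\dot x^*(t))$, and assume that the manifold $$\mathcal M_2=\bigl\{e^{i\phi}\,\pi(x^*(t-\theta)) : \phi,\theta\in\mathbb R\bigr\},\qquad \pi(x_1,x_2,x_3)=(x_1,x_2),$$ of periodic solutions of the planar unperturbed problem is non-degenerate for the fixed-energy problem (with energy $h$ and with period $T^*$ chosen for all its elements). Then, for every $\sigma>0$, there exists $\varepsilon^*>0$ such that for every $\varepsilon\in(-\varepsilon^*,\varepsilon^* )$ there are a solution $(x,T)$ of the fixed-energy periodic problem $$\begin{cases}\dfrac{\mathrm d}{\mathrm dt}\bigl(\varphi(\dot x)\bigr)=V'(|x|)\dfrac{x}{|x|}+E_\varepsilon(x)+\dot x\wedge B_\varepsilon(x),\qquad x\in\mathbb R^3\setminus\{0\},\\ (x(0),\dot x(0))=(x(T),\dot x(T)),\\ \mathcal E_\varepsilon(x,\dot x)\equiv h,\end{cases}$$ and $M\in O(3)$ such that $|T-T^*|<\sigma$ and $$|x(t)-M\,x^*(t)|<\sigma,\quad\text{for every }t\in[0,T].$$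
   Context: Standing assumptions. (1) $\varphi\colon B_a(0)\to B_b(0)$ ($a,b\in(0,+\infty]$; $B_r(0)$ is the open ball of radius $r$ in $\mathbb R^d$, $d=3$ or $d=2$ according to the dimension of the equation) is a homeomorphism with $\varphi(0)=0$ and $\varphi(v)=f(|v|)\,v/|v|$ for $v\neq0$, where $f\colon[0,a)\to[0,b)$ is continuous, continuously differentiable on $(0,a)$, $f(0)=0$, $f'(s)>0$ for $s\in(0,a)$ and $\lim_{s\to a^-}f(s)=b$. (2) $V\colon(0,+\infty)\to\mathbb R$ is of class $\mathcal C^2$. (3) The perturbation is time-independent: for small $\varepsilon\in\mathbb{R}$, $E_\varepsilon,B_\varepsilon\colon\mathbb R^3\setminus\{0\}\to\mathbb R^3$ are given by $E_\varepsilon(x)=\nabla U_\varepsilon(x)$ and $B_\varepsilon(x)=\mathrm{curl}\,A_\varepsilon(x)$, where $U_\varepsilon\colon\mathbb R^3\setminus\{0\}\to\mathbb R$ and $A_\varepsilon\colon\mathbb R^3\setminus\{0\}\to\mathbb R^3$ are two times differentiable, are continuous together with these derivatives, and depend (with these derivatives) smoothly on $\varepsilon$, with $U_0\equiv0$ and $A_0\equiv0$. Energy: $\mathcal E_\varepsilon(x,v)=G(|\varphi(v)|)-V(|x|)-U_\varepsilon(x)$, where $G(s)=\int_0^sf^{-1}(\xi)\,\mathrm d\xi$, $s\in[0,b)$. A solution of the fixed-energy periodic problem is a pair $(x,T)$, where $T>0$ is unprescribed, $x$ is a periodic solution of the differential equation with $\mathcal E_\varepsilon(x(t),\dot x(t))\equiv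 h$, and $T$ is a (not necessarily minimal) period of $x$. Notation. $\wedge$ is the cross product in $\mathbb R^3$; $e^{i\phi}$ is the rotation of angle $\phi$ in $\mathbb R^2\cong\mathbb C$. A solution $x$ is circular if $|x(t)|\equiv R$ for some $R>0$, and rectilinear if $x(t)/|x(t)|$ is constant in $t$. Hamiltonian form of the unperturbed problem in dimension $d$: with $p=\varphi(\dot x)$ and $\mathcal H_0(x,p)=G(|p|)-V(|x|)$, the unperturbed equation is equivalent to $\dot x=\nabla_p\mathcal H_0$, $\dot p=-\nabla_x\mathcal H_0$, i.e. $Jz'=\nabla\mathcal H_0(z)$, $z=(x,p)\in\mathbb R^{2d}$, where $J=\begin{pmatrix}0&-I_d\\ I_d&0\end{pmatrix}$. A manifold of solutions $x$ is identified with the manifold of solutions $z=(x,\varphi(\dot x))$, and with the corresponding set of initial conditions $z(0)=(x(0),\varphi(\dot x(0)))\in\mathbb R^{2d}$. Non-degeneracy for the fixed-energy problem: a compact manifold $\mathfrak M\subset\mathcal H_0^{-1}(h)$ of (initial conditions of) non-constant periodic solutions of $Jz'=\nabla\mathcal H_0(z)$, with a smooth choice $z\mapsto T(z)$ of a period of $z$, is non-degenerate for the fixed-energy problem if, for every $z\in\mathfrak M$, the dimension of the linear space of $T(z)$-periodic functions $w$ which, for some $\gamma\in\mathbb R$, satisfy $$Jw'=\nabla^2\mathcal H_0(z(t))w+\gamma\nabla\mathcal H_0(z(t)),\qquad \langle\nabla\mathcal H_0(z(t)),w(t)\rangle\equiv0,$$ equals the dimension of $\mathfrak M$. For $\mathcal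 M_2$ this is applied with $d=2$ and $T(z)\equiv T^*$; $\mathcal M_2$ is homeomorphic to the torus $\mathbb T^2$, so it has dimension $2$. *)

(* Defs.v *)
From HB Require Import structures.
From mathcomp Require Export all_boot all_order all_algebra.
From mathcomp Require Export all_classical all_reals all_analysis.
Export Order.TTheory GRing.Theory Num.Theory.
Export numFieldNormedType.Exports.

Set Implicit Arguments.
Unset Strict Implicit.
Unset Printing Implicit Defensive.

Local Open Scope ring_scope.
Local Open Scope classical_set_scope.

(* Points of R^d are column vectors. The canonical norm of 'cV[R]_d in
   MathComp-Analysis is the max norm, so the Euclidean norm is defined here;
   the two induce the same topology and the same derivatives. *)
Section Euclidean.
Context {R : realType}.

Definition enorm d (v : 'cV[R]_d) : R := Num.sqrt (\sum_i v i 0 ^+ 2).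

Definition eball d (r : \bar R) : set 'cV[R]_d :=
  [set v | ((enorm v)%:E < r)%E].

Definition partial (W : normedModType R) d (i : 'I_d) (F : 'cV[R]_d -> W)
  (x : 'cV[R]_d) : W := 'D_(delta_mx i 0) F x.

Definition gradient d (F : 'cV[R]_d -> R) (x : 'cV[R]_d) : 'cV[R]_d :=
  \col_i partial i F x.

Definition hessian d (F : 'cV[R]_d -> R) (x : 'cV[R]_d) : 'M[R]_d :=
  \matrix_(i, j) partial i (partial j F) x.

(* In the next two definitions the indices are added modulo 3. *)
Definition cross (u v : 'cV[R]_3) : 'cV[R]_3 :=
  \col_(i < 3) (u (i + 1) 0 * v (i + 2) 0 - u (i + 2) 0 * v (i + 1) 0).

Definition curl (A : 'cV[R]_3 -> 'cV[R]_3) (x : 'cV[R]_3) : 'cV[R]_3 :=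
  \col_(i < 3) (partial (i + 1) (fun y => A y (i + 2) 0) x
                - partial (i + 2) (fun y => A y (i + 1) 0) x).

Definition proj12 (x : 'cV[R]_3) : 'cV[R]_2 := usubmx (x : 'cV[R]_(2 + 1)).

Definition rotation (phi : R) : 'M[R]_2 :=
  block_mx (cos phi)%:M (- sin phi)%:M (sin phi)%:M (cos phi)%:M
    : 'M[R]_(1 + 1).

Definition orthogonal n (M : 'M[R]_n) : Prop := M^T *m M = 1%:M.

Definition periodic_with (W : Type) (T : R) (x : R -> W) : Prop :=
  forall t, x (t + T) = x t.

End Euclidean.

Definition homeomorphism_between (X Y : topologicalType) (A : set X)
    (B : set Y) (g : X -> Y) : Prop :=
  exists g' : Y -> X,
    [/\ set_fun A B g, set_fun B A g',
        (forall x, A x -> g' (g x) = x) /\ (forall y, B y -> g (g' y) = y),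
        {within A, continuous g} & {within B, continuous g'}].

Section PhiAndV.
Context {R : realType}.

Definition phi (f : R -> R) d (v : 'cV[R]_d) : 'cV[R]_d :=
  if v == 0 then 0 else (f (enorm v) / enorm v) *: v.

Definition dom0 (r : \bar R) : set R := [set s | 0 <= s /\ (s%:E < r)%E].

(* The left limit at [a] is taken in the extended reals, because [a] and [b]
   may be infinite. *)
Record phi_assumptions (a b : \bar R) (f : R -> R) : Prop := PhiAssumptions {
  phi_a_gt0 : (0 < a)%E;
  phi_b_gt0 : (0 < b)%E;
  phi_f_maps : set_fun (dom0 a) (dom0 b) f;
  phi_f_continuous : {within dom0 a, continuous f};
  phi_f_derivable : forall s : R, 0 < s -> (s%:E < a)%E -> derivable f s 1;
  phi_f_C1 : forall s : R, 0 < s -> (s%:E < a)%E ->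
    {for s, continuous (derive1 f)};
  phi_f0 : f 0 = 0;
  phi_f_increasing : forall s : R, 0 < s -> (s%:E < a)%E -> 0 < derive1 f s;
  phi_f_lim :
    (f (fine y))%:E @[y --> within [set y | (y < a)%E] (nbhs a)] --> b;
  phi_homeo2 : homeomorphism_between (eball a) (eball b) (phi f (d := 2));
  phi_homeo3 : homeomorphism_between (eball a) (eball b) (phi f (d := 3))
}.

Definition C2_on_positive (V : R -> R) : Prop :=
  forall s : R, 0 < s ->
    [/\ derivable V s 1, derivable (derive1 V) s 1 &
        {for s, continuous (derive1n 2 V)}].

(* G(s) is the integral over [0,s] of the inverse of f : [0,a) -> [0,b). *)
Definition G (a : \bar R) (f : R -> R) (s : R) : R :=
  \int[lebesgue_measure]_(xi in `[0, s]) ('pinv_(fun=> 0) (dom0 a) f xi).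

End PhiAndV.

Section Perturbation.
Context {R : realType} {W : normedModType R}.

Definition smooth_in_eps (eps0 : R) (g : R -> 'cV[R]_3 -> W) : Prop :=
  forall k eps x, `|eps| < eps0 -> x != 0 ->
    derivable (derive1n k (fun e => g e x)) eps 1 /\
    {for (eps, x),
      continuous (fun p : R * 'cV[R]_3 => derive1n k (fun e => g e p.2) p.1)}.

(* The case k = 0 of [smooth_in_eps] contains the continuity in x of the
   function and of its derivatives. *)
Definition smooth_family_C2 (eps0 : R) (g : R -> 'cV[R]_3 -> W) : Prop :=
  [/\ (forall eps x, `|eps| < eps0 -> x != 0 ->
         differentiable (g eps) x /\
         forall i, differentiable (partial i (g eps)) x),
      smooth_in_eps eps0 g,
      (forall i, smooth_in_eps eps0 (fun eps => partial i (g eps))) &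
      (forall i j,
         smooth_in_eps eps0 (fun eps => partial i (partial j (g eps))))].

Definition vanishes_at_0 (g : R -> 'cV[R]_3 -> W) : Prop :=
  forall x, x != 0 -> g 0 x = 0.

End Perturbation.

Section Solutions.
Context {R : realType}.
Variables (a b : \bar R) (f V : R -> R).

Definition central_force d (x : 'cV[R]_d) : 'cV[R]_d :=
  (derive1 V (enorm x) / enorm x) *: x.

(* Solutions, on the whole line, of (phi(x'))' = F(x, x') with x <> 0. *)
Definition is_solution d (F : 'cV[R]_d -> 'cV[R]_d -> 'cV[R]_d)
    (x : R -> 'cV[R]_d) : Prop :=
  forall t, [/\ x t != 0, derivable x t 1, eball a (derive1 x t) &
    is_derive t 1 (fun s => phi f (derive1 x s)) (F (x t) (derive1 x t))].

Definition unperturbed_force d (x _ : 'cV[R]_d) : 'cV[R]_d := central_force x.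

Definition perturbed_force (U : 'cV[R]_3 -> R) (A : 'cV[R]_3 -> 'cV[R]_3)
    (x v : 'cV[R]_3) : 'cV[R]_3 :=
  central_force x + gradient U x + cross v (curl A x).

Definition energy d (U : 'cV[R]_d -> R) (x v : 'cV[R]_d) : R :=
  G a f (enorm (phi f v)) - V (enorm x) - U x.

Definition circular d (x : R -> 'cV[R]_d) : Prop :=
  exists2 r : R, 0 < r & forall t, enorm (x t) = r.

Definition rectilinear d (x : R -> 'cV[R]_d) : Prop :=
  exists u : 'cV[R]_d, forall t, (enorm (x t))^-1 *: x t = u.

Definition fixed_energy_periodic_solution (U : 'cV[R]_3 -> R)
    (A : 'cV[R]_3 -> 'cV[R]_3) (h : R) (x : R -> 'cV[R]_3) (T : R) : Prop :=
  [/\ 0 < T, is_solution (perturbed_force U A) x, periodic_with T x &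
      forall t, energy U (x t) (derive1 x t) = h].

Definition H0 d (z : 'cV[R]_(d + d)) : R :=
  G a f (enorm (dsubmx z)) - V (enorm (usubmx z)).

Definition phase_space d : set 'cV[R]_(d + d) :=
  [set z | usubmx z != 0 /\ eball b (dsubmx z)].

Definition initial_conditions d (S : set (R -> 'cV[R]_d)) :
    set 'cV[R]_(d + d) :=
  [set col_mx (x 0) (phi f (derive1 x 0)) | x in S].

Definition M2 (xs : R -> 'cV[R]_3) : set (R -> 'cV[R]_2) :=
  [set y | exists angle theta : R,
     y = fun t => rotation angle *m proj12 (xs (t - theta))].

End Solutions.

Section NonDegeneracy.
Context {R : realType}.

Definition J d : 'M[R]_(d + d) := block_mx 0 (- 1%:M) 1%:M 0.

Definition ham_solution d (Omega : set 'cV[R]_(d + d))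
    (H : 'cV[R]_(d + d) -> R) (z : R -> 'cV[R]_(d + d)) : Prop :=
  forall t, [/\ Omega (z t), derivable z t 1 &
                J d *m derive1 z t = gradient H (z t)].

Definition linearized_solutions d (H : 'cV[R]_(d + d) -> R) (T : R)
    (z : R -> 'cV[R]_(d + d)) : set (R -> 'cV[R]_(d + d)) :=
  [set w | periodic_with T w /\ exists gamma : R, forall t,
     [/\ derivable w t 1,
         J d *m derive1 w t = hessian H (z t) *m w t + gamma *: gradient H (z t) &
         (gradient H (z t))^T *m w t = 0]].

(* [S] is a linear space of dimension [k]: it is the span of [k] linearly
   independent functions. *)
Definition has_dimension n (S : set (R -> 'cV[R]_n)) (k : nat) : Prop :=
  exists e : 'I_k -> R -> 'cV[R]_n,
    S = range (fun (c : 'I_k -> R) t => \sum_i c i *: e i t) /\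
    forall c : 'I_k -> R,
      (forall t, \sum_i c i *: e i t = 0) -> forall i, c i = 0.

(* A [k]-dimensional topological manifold, as a subset of R^n. *)
Definition is_manifold n (M : set 'cV[R]_n) (k : nat) : Prop :=
  forall z, M z -> exists W : set 'cV[R]_n,
    [/\ open W, W z & exists (O : set 'cV[R]_k) (g : 'cV[R]_n -> 'cV[R]_k),
          open O /\ homeomorphism_between (M `&` W) O g].

(* Non-degeneracy of the [k]-dimensional manifold [M] for the constant choice
   [T] of the period. *)
Definition nondegenerate_fixed_energy d (Omega : set 'cV[R]_(d + d))
    (H : 'cV[R]_(d + d) -> R) (h : R) (M : set 'cV[R]_(d + d)) (k : nat)
    (T : R) : Prop :=
  [/\ compact M, is_manifold M k,
      (forall z0, M z0 -> H z0 = h /\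
         exists2 z, ham_solution Omega H z & z 0 = z0) &
      forall z, ham_solution Omega H z -> M (z 0) ->
        [/\ periodic_with T z, (exists t, z t != z 0) &
            has_dimension (linearized_solutions H T z) k]].

End NonDegeneracy.

(* Main.v *)
(* In the canonical momentum P = phi(x') + A_eps(x) the problem is Hamiltonian with
   H_eps(x, P) = G(|P - A_eps(x)|) - V(|x|) - U_eps(x), and H_0 is invariant under O(3).
   Let zeta be the given orbit, with period rescaled to 1 and started at a time where
   <x, x'> <> 0 (it exists because the orbit is not circular), and let the columns of B be
   the rotation and time-translation tangent vectors at zeta(0).  Up to jumps in the range
   of J B, the linearized fixed-energy problem has trivial kernel: pairing a solution with
   the tangent variations shows that it closes up, its planar part is handled by the
   nondegeneracy of M_2, and its part orthogonal to the plane is killed by the non-zero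
   angular momentum (the orbit is not rectilinear).  Hence, for small eps and every rotation
   g, a contraction gives a unique arc near g zeta, on the level H_eps = h, that solves the
   perturbed equation on [0, 1] up to a jump in the range of J B.  At a rotation maximizing
   the Hamiltonian action over the compact group O(3), the first-order condition and the
   conservation of energy force this jump to vanish, so that the arc is a periodic orbit. *)

From HB Require Import structures.
Require Import Defs.
From mathcomp Require Import ring lra.

Set Implicit Arguments.
Unset Strict Implicit.
Unset Printing Implicit Defensive.

Local Open Scope ring_scope.
Local Open Scope classical_set_scope.

(** * Derivatives and norms of vector-valued functions *)

Section MatrixNorm.
Context {R : realType}.

(** Neither the arcs nor their action are shown to be differentiable in the rotation [g]; only
    Lipschitz and second-order estimates are used. They suffice because the unperturbed problem is
    invariant: seen in the frame of [g], the arc depends on [g] through the perturbation alone, with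
    a Lipschitz constant of order [kap]. At a maximum of the action this gives |<J Xi z(0), D>| <=
    small * |D| for the jump D and each rotation generator Xi; conservation of energy gives the same
    bound with X_0 in place of Xi z(0). Since D = J B q, these numbers are the components of B^T B
    q. The Gram matrix B^T B is invertible, so |D| <= |D| / 2 and D = 0: the range of J B is chosen
    dual to the available conditions. The starting time makes the velocity independent of the
    rotation directions, because x' then has a component along x while a rotation moves x
    orthogonally to itself. Momenta are kept away from 0 because phi is only a homeomorphism there;
    the non-zero angular momentum guarantees this along the orbit. *)

Lemma near_normP (V : normedModType R) (x : V) (P : V -> Prop) :
  (\forall y \near x, P y) <-> (exists2 d : R, 0 < d & forall y, `|y - x| < d -> P y).
Proof.
split=> [/nbhs_ballP[d d0 H]|[d d0 H]]; [exists d => // y xy|apply/nbhs_ballP; exists d => // y];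
  [apply: H|]; rewrite -ball_normE /ball_/= distrC//.
exact: H.
Qed.

Lemma mxnormP m n (A : 'M[R]_(m, n)) c :
  0 <= c -> (forall i j, `|A i j| <= c) -> `|A| <= c.
Proof.
move=> c0 H; rewrite [leLHS]/Num.Def.normr/= mx_normrE.
by apply: bigmax_le => // -[i j] _; exact: H.
Qed.

Lemma mxnorm_ge m n (A : 'M[R]_(m, n)) i j : `|A i j| <= `|A|.
Proof.
rewrite [leRHS]/Num.Def.normr/= mx_normrE.
exact: (le_bigmax _ (fun ij : 'I_m * 'I_n => `|A ij.1 ij.2|) (i, j)).
Qed.

Lemma cvnormP n (v : 'cV[R]_n) c :
  0 <= c -> (forall i, `|v i 0| <= c) -> `|v| <= c.
Proof. by move=> c0 H; apply: mxnormP => // i j; rewrite ord1. Qed.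

Lemma mulmx_norm m n p (A : 'M[R]_(m, n)) (B : 'M[R]_(n, p)) :
  `|A *m B| <= n%:R * `|A| * `|B|.
Proof.
apply: mxnormP => [|i j]; first by rewrite !mulr_ge0.
rewrite mxE (le_trans (ler_norm_sum _ _ _))//.
apply: (@le_trans _ _ (\sum_(k < n) (`|A| * `|B|))).
  by apply: ler_sum => k _; rewrite normrM ler_pM// mxnorm_ge.
by rewrite sumr_const card_ord -mulrA mulr_natl.
Qed.

Lemma norm_trmx m n (A : 'M[R]_(m, n)) : `|A^T| = `|A|.
Proof.
have H p q (B : 'M[R]_(p, q)) : `|B^T| <= `|B|.
  by apply: mxnormP => // i j; rewrite mxE mxnorm_ge.
apply/eqP; rewrite eq_le; apply/andP; split; first exact: H.
by have := H _ _ A^T; rewrite trmxK.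
Qed.

Lemma is_derive_mxP m n (M : R -> 'M[R]_(m, n)) (d : 'M[R]_(m, n)) (t : R) :
  is_derive t 1 M d <-> forall i j, is_derive t 1 (fun x => M x i j) (d i j).
Proof.
split=> [[dM <-] i j|H].
  split; first by apply/derivable_mxP : i j.
  by rewrite derive_mx// mxE.
have dM : derivable M t 1 by apply/derivable_mxP => i j; case: (H i j).
split=> //; rewrite derive_mx//; apply/matrixP => i j; rewrite mxE.
by case: (H i j).
Qed.

Lemma is_derive_sum_fin (I : finType) (W : normedModType R) (h : I -> R -> W)
    (dh : I -> W) (t : R) :
  (forall i, is_derive t 1 (h i) (dh i)) ->
  is_derive t 1 (fun s => \sum_i h i s) (\sum_i dh i).
Proof.
move=> H.
elim: (index_enum I) => [|i r IH].
  under eq_fun do rewrite big_nil.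
  by rewrite big_nil; exact: is_derive_cst.
under eq_fun do rewrite big_cons.
by rewrite big_cons; exact: is_deriveD.
Qed.

Lemma is_derive_ext (W : normedModType R) (f g : R -> W) (t : R) d e :
  f =1 g -> d = e -> is_derive t 1 f d -> is_derive t 1 g e.
Proof. by move=> /funext -> ->. Qed.

Lemma is_derive_addf (W : normedModType R) (f g : R -> W) (t : R) df dg :
  is_derive t 1 f df -> is_derive t 1 g dg ->
  is_derive t 1 (fun s => f s + g s) (df + dg).
Proof. exact: is_deriveD. Qed.

Lemma is_derive_subf (W : normedModType R) (f g : R -> W) (t : R) df dg :
  is_derive t 1 f df -> is_derive t 1 g dg ->
  is_derive t 1 (fun s => f s - g s) (df - dg).
Proof. exact: is_deriveB. Qed.

Lemma is_derive_scalef (W : normedModType R) (c : R) (f : R -> W) (t : R) df :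
  is_derive t 1 f df -> is_derive t 1 (fun s => c *: f s) (c *: df).
Proof. exact: is_deriveZ. Qed.

Lemma is_derive_mulf (f g : R -> R) (t : R) df dg :
  is_derive t 1 f df -> is_derive t 1 g dg ->
  is_derive t 1 (fun s => f s * g s) (df * g t + f t * dg).
Proof.
move=> Hf Hg; apply: is_derive_ext (is_deriveM Hf Hg) => //.
by rewrite /GRing.scale/= addrC mulrC.
Qed.

Lemma is_derive_compf (W : normedModType R) (f : R -> W) (g : R -> R) (t : R) df dg :
  is_derive (g t) 1 f df -> is_derive t 1 g dg ->
  is_derive t 1 (fun s => f (g s)) (dg *: df).
Proof.
move=> [fd <-] [gd <-].
have Hf : differentiable f (g t) by apply/derivable1_diffP.
have Hg : differentiable g t by apply/derivable1_diffP.
have H : differentiable (f \o g) t by exact: differentiable_comp.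
split; first exact/derivable1_diffP.
rewrite [LHS]deriveE// diff_comp//= -!deriveE//.
by rewrite !deriveE// -linearZ /= -[X in 'd f (g t) X = _]mulr1.
Qed.

Lemma is_derive_mulmxl m n p (A : 'M[R]_(m, n)) (v : R -> 'M[R]_(n, p)) dv (t : R) :
  is_derive t 1 v dv -> is_derive t 1 (fun s => A *m v s) (A *m dv).
Proof.
move=> /is_derive_mxP H; apply/is_derive_mxP => i j.
under eq_fun do rewrite mxE; rewrite mxE.
apply: is_derive_sum_fin.
Qed.

Lemma is_derive_continuous (W : normedModType R) (f : R -> W) (t : R) d :
  is_derive t 1 f d -> {for t, continuous f}.
Proof. by move=> [/derivable1_diffP/differentiable_continuous]. Qed.

Lemma continuous_mxP m n (T : topologicalType) (M : T -> 'M[R]_(m, n)) t :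
  (forall i j, {for t, continuous (fun x => M x i j)}) -> {for t, continuous M}.
Proof.
move=> H; apply/cvgrPdist_le => e e0; near=> s.
apply: mxnormP; first exact: ltW.
move=> i j; rewrite !mxE.
have : forall ij : 'I_m * 'I_n, `|M t ij.1 ij.2 - M s ij.1 ij.2| <= e.
  near: s; apply: filter_forall => -[i' j'] /=.
  by have /cvgrPdist_le := H i' j'; apply.
by move=> /(_ (i, j)).
Unshelve. all: by end_near. Qed.

Lemma continuous_coord m n (T : topologicalType) (M : T -> 'M[R]_(m, n)) t i j :
  {for t, continuous M} -> {for t, continuous (fun x => M x i j)}.
Proof.
move=> /cvgrPdist_le H; apply/cvgrPdist_le => e e0; near=> s.
have : `|M t - M s| <= e by near: s; exact: H.
by apply: le_trans; rewrite (le_trans _ (mxnorm_ge _ i j))// !mxE.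
Unshelve. all: by end_near. Qed.

Lemma continuous_mulmxr m n p (A : R -> 'M[R]_(m, n)) (x : 'M[R]_(n, p)) t :
  {for t, continuous A} -> {for t, continuous (fun s => A s *m x)}.
Proof.
move=> AC; apply/cvgrPdist_le => e e0.
have b0 : 0 < n%:R * `|x| + 1 :> R by rewrite ltr_wpDl// mulr_ge0.
near=> s.
have H1 : `|A t - A s| <= e / (n%:R * `|x| + 1).
  by near: s; move/cvgrPdist_le : AC; apply; rewrite divr_gt0.
rewrite -mulmxBl (le_trans (mulmx_norm _ _))// mulrAC.
apply: (@le_trans _ _ ((n%:R * `|x| + 1) * `|A t - A s|)).
  by rewrite ler_wpM2r// lerDl.
by rewrite mulrC -ler_pdivlMr.
Unshelve. all: by end_near. Qed.

End MatrixNorm.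

(** * Mean value inequality and primitives on the whole line *)

Section Primitive.
Context {R : realType}.

(** [G + f] and [G - f] have non-negative derivative, hence are non-decreasing. A comparison
    function in place of a constant serves both the exponential weights of the Gronwall estimate and
    plain linear bounds. *)
Lemma dominated_increment (f G df dG : R -> R) (a b : R) : a <= b ->
  (forall t, a <= t <= b -> is_derive t 1 f (df t)) ->
  (forall t, a <= t <= b -> is_derive t 1 G (dG t)) ->
  (forall t, a <= t <= b -> `|df t| <= dG t) ->
  `|f b - f a| <= G b - G a.
Proof.
move=> ab Hf HG Hd.
have mono (h dh : R -> R) : (forall t, a <= t <= b -> is_derive t 1 h (dh t)) ->
    (forall t, a <= t <= b -> 0 <= dh t) -> h a <= h b.
  move=> Hh dh0; have [||c] := @MVT_segment _ h dh a b ab.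
  - by move=> x; rewrite in_itv/= => /andP[ax xb]; apply: Hh; rewrite !ltW.
  - apply: derivable_within_continuous => x; rewrite in_itv/= => xab.
    by have [] := Hh x xab.
  rewrite in_itv/= => cab E.
  by rewrite -subr_ge0 E mulr_ge0 ?dh0// subr_ge0.
have := mono (G - f) (fun t => dG t - df t).
have := mono (G + f) (fun t => dG t + df t).
move=> H1 H2.
have {}H1 : G a + f a <= G b + f b.
  apply: H1 => t tab; first exact: is_deriveD (HG _ tab) (Hf _ tab).
  by have := Hd t tab; rewrite ler_norml => /andP[+ _]; lra.
have {}H2 : G a - f a <= G b - f b.
  apply: H2 => t tab; first exact: is_deriveB (HG _ tab) (Hf _ tab).
  by have := Hd t tab; rewrite ler_norml => /andP[_ ]; lra.
by rewrite ler_norml; apply/andP; split; lra.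
Qed.

(** The max norm reduces the matrix case to the entries with no loss in the constant. *)
Lemma dominated_increment_mx n m (f df : R -> 'M[R]_(n, m)) (G dG : R -> R) (a b : R) :
  a <= b ->
  (forall t, a <= t <= b -> is_derive t 1 f (df t)) ->
  (forall t, a <= t <= b -> is_derive t 1 G (dG t)) ->
  (forall t, a <= t <= b -> `|df t| <= dG t) ->
  `|f b - f a| <= G b - G a.
Proof.
move=> ab Hf HG Hd.
have H i j : `|(f b - f a) i j| <= G b - G a.
  rewrite !mxE; apply: (@dominated_increment (fun t => f t i j) G (fun t => df t i j) dG) => //.
    by move=> t /Hf/is_derive_mxP.
  by move=> t /Hd; apply: le_trans; exact: mxnorm_ge.
apply: mxnormP => //.
apply: le_trans (normr_ge0 (0 - 0)) _.
apply: (@dominated_increment (cst 0) G (fun=> 0) dG a b ab) => // t.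
by move=> /Hd; rewrite normr0; apply: le_trans.
Qed.

Lemma zero_derive_const n m (f : R -> 'M[R]_(n, m)) (a b : R) :
  a <= b -> (forall t, a <= t <= b -> is_derive t 1 f 0) -> f a = f b.
Proof.
move=> ab H.
have : `|f b - f a| <= 0 - 0.
  apply: (@dominated_increment_mx n m f (fun=> 0) (cst 0) (fun=> 0) a b ab H) => //.
  by move=> t _; rewrite normr0.
by rewrite subrr normr_le0 subr_eq0 => /eqP.
Qed.

Lemma primitive_right (u : R -> R) (a : R) : continuous u ->
  exists F : R -> R, forall t : R, a < t -> is_derive t 1 F (u t).
Proof.
move=> cu.
exists (fun x => (\int[lebesgue_measure]_(t in [set` Interval (BLeft a) (BRight x)]) (u t))%R).
move=> t at_.
have [] := @continuous_FTC1 R u (BLeft a) t (t + 1).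
- by rewrite ltrDl.
- apply: continuous_compact_integrable; first exact: segment_compact.
  exact: continuous_subspaceT.
- by rewrite lte_fin.
- exact: cu.
by move=> d e; split; [exact: d|rewrite -derive1E; exact: e].
Qed.

(** [primitive_right] differentiates only to the right of its base point, so a primitive on the
    whole line is glued at 0 from one valid for t > -1 and a reflected one valid for t < 1. *)
Lemma primitive (u : R -> R) : continuous u ->
  exists2 F : R -> R, F 0 = 0 & forall t : R, is_derive t 1 F (u t).
Proof.
move=> cu.
have [F HF] := primitive_right (-1) cu.
have [|G HG] := @primitive_right (fun t => u (- t)) (-1).
  move=> t; apply: continuous_comp; last exact: cu.
  exact: opp_continuous.
have HG' (t : R) : t < 1 -> is_derive t 1 (fun s => - G (- s)) (u t).
  move=> t1; have := HG (- t); rewrite ltrN2 opprK => /(_ t1) H.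
  have -> : u t = - (- 1 * u t) by rewrite mulN1r opprK.
  have E : is_derive t 1 (-%R : R -> R) (- 1) by exact: is_deriveNid.
  have := is_derive1_comp H.
  move=> /(_ _ E) K.
  apply: is_deriveN.
  apply: is_derive_ext K => //.
  by rewrite mulN1r /GRing.scale/= mulrN1.
pose U (t : R) := if 0 <= t then F t - F 0 else - G (- t) + G 0.
exists U; first by rewrite /U lexx subrr.
(* On the overlap both pieces have derivative [u] and vanish at 0, so they coincide and the glued
   function can be differentiated near 0 by either formula. *)
have UE (t : R) : -1 < t -> t < 1 -> F t - F 0 = - G (- t) + G 0.
  move=> t1 t2.
  pose D s : 'M[R]_1 := const_mx (F s + G (- s)).
  have HD (s : R) : -1 < s -> s < 1 -> is_derive s 1 D 0.
    move=> s1 s2; apply/is_derive_mxP => i j; rewrite /D.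
    under eq_fun do rewrite mxE -[G _]opprK.
    by rewrite mxE -(subrr (u s)); apply: is_deriveB; [exact: HF|exact: HG'].
  have : D t = D 0.
    have [t0|t0] := leP t 0.
      apply: zero_derive_const => // s /andP[s1 s2]; apply: HD; first exact: lt_le_trans s1.
      by rewrite (le_lt_trans s2).
    apply/esym; apply: zero_derive_const; first exact: ltW.
    move=> s /andP[s1 s2]; apply: HD; last exact: le_lt_trans t2.
    by rewrite (lt_le_trans _ s1)//.
  by move=> /matrixP /(_ 0 0); rewrite !mxE oppr0; lra.
move=> t; have [t0|t0] := ltP t 0.
  have Ht : t < 1 by rewrite (lt_trans t0).
  have := is_deriveD (HG' _ Ht) (is_derive_cst (G 0) t 1).
  rewrite addr0 => K; apply: near_eq_is_derive K.
  apply/near_normP; exists (- t); first by rewrite oppr_gt0.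
  move=> s; rewrite ltr_norml => /andP[_ s0]; rewrite /U/= ifN// -ltNge; lra.
have Ht : -1 < t by rewrite (lt_le_trans _ t0).
have := is_deriveB (HF _ Ht) (is_derive_cst (F 0) t 1).
rewrite subr0 => K; apply: near_eq_is_derive K.
apply/near_normP; exists 1 => // s; rewrite ltr_norml => /andP[s1 _].
rewrite /U/=; case: ifPn => //; rewrite -ltNge => s0.
by rewrite [LHS]/GRing.add/= /cst/= -UE//; lra.
Qed.

Lemma primitive_cv n (u : R -> 'cV[R]_n) (u0 : 'cV[R]_n) : continuous u ->
  exists2 F : R -> 'cV[R]_n, F 0 = u0 & forall t : R, is_derive t 1 F (u t).
Proof.
move=> cu.
have cui i : continuous (fun t => u t i 0).
  by move=> t; apply: continuous_coord; exact: cu.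
have /choice[F HF] : forall i, exists F : R -> R,
    F 0 = 0 /\ forall t : R, is_derive t 1 F (u t i 0).
  by move=> i; have [F F0 FE] := primitive (cui i); exists F.
exists (fun t => u0 + \col_i F i t).
  by apply/matrixP => i j; rewrite !mxE (HF i).1 addr0 ord1.
move=> t; apply/is_derive_mxP => i j.
under eq_fun do rewrite !mxE.
rewrite ord1 -[u t i 0]add0r.
exact: is_deriveD (is_derive_cst _ _ _) ((HF i).2 t).
Qed.

End Primitive.

(** * Global Lipschitz differential equations *)

Section ODE.
Context {R : realType}.

Lemma half_pow_small (C e : R) : 0 <= C -> 0 < e -> exists k : nat, C / 2 ^+ k <= e.
Proof.
move=> C0 e0; exists (Num.bound (C / e)).
have := archi_boundP (divr_ge0 C0 (ltW e0)).
rewrite ltr_pdivrMr// => H; rewrite ler_pdivrMr ?exprn_gt0// (le_trans (ltW H))//.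
rewrite mulrC ler_pM2l// -natrX ler_nat ltnW//.
exact: ltn_expl.
Qed.

(** Twice cosh(2Kt), the weight of a Bielecki norm: the primitive of [K * cosh2 K] that vanishes at
    0 is sinh(2Kt), at most half of [cosh2 K] in absolute value. Integrating a K-Lipschitz
    right-hand side therefore halves the weighted norm on the whole line. *)
Definition cosh2 (K t : R) : R := expR (2 * K * t) + expR (- (2 * K * t)).

Lemma cosh2_ge1 (K t : R) : 1 <= cosh2 K t.
Proof.
rewrite /cosh2; have [H|H] := leP 0 (2 * K * t).
  have := expR_ge1Dx (2 * K * t); have := expR_gt0 (- (2 * K * t)); lra.
have := expR_ge1Dx (- (2 * K * t)); have := expR_gt0 (2 * K * t); lra.
Qed.

Lemma cosh2_gt0 (K t : R) : 0 < cosh2 K t.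
Proof. by rewrite (lt_le_trans ltr01)// cosh2_ge1. Qed.

Lemma is_derive_expM (c t : R) : is_derive t 1 (fun s => expR (c * s)) (c * expR (c * t)).
Proof.
have H : is_derive t 1 (fun s : R => c * s) (c * 1) by exact: is_deriveZ.
apply: is_derive_ext (is_derive_compf (is_derive_expR (c * t)) H) => //.
by rewrite mulr1.
Qed.

Lemma is_derive_sinh2 (K t : R) :
  is_derive t 1 (fun s => (expR (2 * K * s) - expR (- (2 * K * s))) / 2) (K * cosh2 K t).
Proof.
have H1 := is_derive_expM (2 * K) t; have H2 := is_derive_expM (- (2 * K)) t.
apply: is_derive_ext (is_derive_scalef 2^-1 (is_derive_subf H1 H2)) => [s|].
  by rewrite /= [LHS]mulrC mulNr.
by rewrite /cosh2 /GRing.scale/= (mulNr (2 * K) t); field.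
Qed.

Lemma cosh2_ge0 (K t : R) : 0 <= cosh2 K t.
Proof. exact/ltW/cosh2_gt0. Qed.

Lemma cosh2_continuous (K : R) : continuous (cosh2 K).
Proof.
move=> t; have H1 := is_derive_expM (2 * K) t; have H2 := is_derive_expM (- (2 * K)) t.
apply: (@is_derive_continuous _ _ _ _ (2 * K * expR (2 * K * t) + - (2 * K) * expR (- (2 * K) * t))).
apply: is_derive_ext (is_derive_addf H1 H2) => // s.
by rewrite /cosh2 mulNr.
Qed.

(** The comparison function is c sinh(2Kt) + m t. Negative times are treated by exchanging the ends
    of the interval. *)
Lemma weighted_increment n (v dv : R -> 'cV[R]_n) (K c m B : R) :
  0 < K -> 0 <= c ->
  (forall t : R, `|t| <= B -> is_derive t 1 v (dv t)) ->
  (forall t, `|t| <= B -> `|dv t| <= K * c * cosh2 K t + m) ->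
  forall t, `|t| <= B -> `|v t - v 0| <= c / 2 * cosh2 K t + m * `|t|.
Proof.
move=> K0 c0 Hv Hdv t tB.
pose S s := (expR (2 * K * s) - expR (- (2 * K * s))) / 2.
pose G s := c * S s + m * s.
have HG (s : R) : is_derive s 1 G (K * c * cosh2 K s + m).
  apply: is_derive_ext (is_derive_addf (is_derive_scalef c (is_derive_sinh2 K s)) (is_derive_scalef m (is_derive_id s 1))) => //.
  by rewrite /GRing.scale/= mulr1 mulrA (mulrC K).
have S0 : G 0 = 0.
  by rewrite /G /S !mulr0 oppr0 subrr mul0r mulr0 addr0.
have GE s : G s = c * S s + m * s by [].
have SC s : S s <= cosh2 K s / 2 /\ - S s <= cosh2 K s / 2.
  rewrite /S /cosh2; have := expR_gt0 (- (2 * K * s)); have := expR_gt0 (2 * K * s).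
  by split; lra.
have [t0|t0] := leP 0 t.
  have : `|v t - v 0| <= G t - G 0.
    apply: (@dominated_increment_mx _ _ _ v dv G (fun s => K * c * cosh2 K s + m)) => // s /andP[s0 st].
      by apply: Hv; rewrite ger0_norm// (le_trans st)// (le_trans (ler_norm _)).
    by apply: Hdv; rewrite ger0_norm// (le_trans st)// (le_trans (ler_norm _)).
  move=> /le_trans; apply; rewrite S0 subr0 GE (ger0_norm t0) lerD2r -mulrA ler_wpM2l// mulrC.
  exact: (SC t).1.
have : `|v 0 - v t| <= G 0 - G t.
  apply: (@dominated_increment_mx _ _ _ v dv G (fun s => K * c * cosh2 K s + m)) => //.
  - exact: ltW.
  - move=> s /andP[s0 st]; apply: Hv; rewrite ler0_norm// (le_trans _ tB)//.
    by rewrite (ltr0_norm t0) lerN2.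
  - move=> s /andP[s0 st]; apply: Hdv; rewrite ler0_norm// (le_trans _ tB)//.
    by rewrite (ltr0_norm t0) lerN2.
rewrite distrC => /le_trans; apply; rewrite S0 sub0r GE (ltr0_norm t0) opprD mulrN lerD2r.
rewrite -mulrN -mulrA ler_wpM2l// mulrC.
exact: (SC t).2.
Qed.

Definition gronwall_const (K B : R) : R := expR (2 * K * B) + 1.

Lemma gronwall_const_gt0 K B : 0 < gronwall_const K B.
Proof. by rewrite /gronwall_const addr_gt0// expR_gt0. Qed.

(** [N] is the maximum of |v| / [cosh2 K] on [-B, B]. Integration returns only half of it, which is
    absorbed on the left; on the interval [cosh2 K] is at most [gronwall_const K B]. *)
Lemma gronwall n (v dv : R -> 'cV[R]_n) (K m B : R) :
  0 < K -> 0 <= m -> 0 <= B ->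
  (forall t : R, `|t| <= B -> is_derive t 1 v (dv t)) ->
  (forall t, `|t| <= B -> `|dv t| <= K * `|v t| + m) ->
  forall t, `|t| <= B -> `|v t| <= 2 * gronwall_const K B * (`|v 0| + m * B).
Proof.
move=> K0 m0 B0 Hv Hdv.
have cv : {within `[- B, B], continuous (fun t => `|v t| / cosh2 K t)}.
  apply: continuous_in_subspaceT => t; rewrite inE/= in_itv/= -ler_norml => tB.
  apply: cvgM; first by apply: cvg_norm; exact: is_derive_continuous (Hv _ tB).
  apply: cvgV; first by rewrite gt_eqF// cosh2_gt0.
  exact: cosh2_continuous.
have [|s sB Hmax] := @EVT_max R _ (- B) B _ cv; first lra.
set N := `|v s| / cosh2 K s in Hmax.
have N0 : 0 <= N by rewrite divr_ge0// ltW// cosh2_gt0.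
have HN t : `|t| <= B -> `|v t| <= N * cosh2 K t.
  by move=> tB; rewrite -ler_pdivrMr ?cosh2_gt0// Hmax// in_itv/= -ler_norml.
have W t : `|t| <= B -> `|v t - v 0| <= N / 2 * cosh2 K t + m * `|t|.
  move=> tB; apply: weighted_increment Hv _ t tB => // t tB.
  apply: le_trans (Hdv t tB) _; rewrite lerD2r -mulrA.
  by rewrite ler_wpM2l ?(ltW K0)// HN.
have HNv : N <= 2 * (`|v 0| + m * B).
  have sB' : `|s| <= B by move: sB; rewrite in_itv/= -ler_norml.
  have E : `|v s| = N * cosh2 K s by rewrite /N mulfVK// gt_eqF// cosh2_gt0.
  have H1 : `|v s| <= `|v 0| + `|v s - v 0|.
    by rewrite (le_trans _ (ler_normD _ _))// addrC subrK.
  have H2 := W s sB'.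
  have H3 : m * `|s| <= m * B by rewrite ler_wpM2l.
  have H4 : N <= N * cosh2 K s by rewrite ler_peMr// cosh2_ge1.
  lra.
move=> t tB; apply: le_trans (HN t tB) _.
have V0 : 0 <= `|v 0| + m * B by rewrite addr_ge0// mulr_ge0.
have HC : cosh2 K t <= gronwall_const K B.
  rewrite /cosh2 /gronwall_const.
  move: tB; rewrite ler_norml => /andP[t1 t2].
  have e0 (x : R) : x <= 0 -> expR x <= 1 by move=> x0; rewrite -expR0 ler_expR.
  have [t0|t0] := leP 0 t.
    rewrite lerD//; first by rewrite ler_expR ler_wpM2l// mulr_ge0// ltW.
    apply: e0.
    by rewrite oppr_le0 !mulr_ge0// ltW.
  rewrite addrC lerD//; last by apply: e0; rewrite pmulr_rle0 ?mulr_gt0// ltW.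
  have K2 : 0 <= 2 * K by rewrite mulr_ge0// ltW.
  by rewrite ler_expR -mulrN ler_wpM2l// lerNl.
apply: (@le_trans _ _ (2 * (`|v 0| + m * B) * gronwall_const K B)).
  by rewrite ler_pM// ltW// cosh2_gt0.
by rewrite mulrAC.
Qed.

Lemma ode_uniqueness n (g : R -> 'cV[R]_n -> 'cV[R]_n) (K : R) (v w : R -> 'cV[R]_n) :
  0 < K -> (forall t x y, `|g t x - g t y| <= K * `|x - y|) ->
  (forall t : R, is_derive t 1 v (g t (v t))) ->
  (forall t : R, is_derive t 1 w (g t (w t))) ->
  v 0 = w 0 -> forall t, v t = w t.
Proof.
move=> K0 gK Hv Hw vw t; apply/eqP; rewrite -subr_eq0 -normr_le0.
have := @gronwall n (fun s => v s - w s) (fun t => g t (v t) - g t (w t)) K 0 `|t| K0 (lexx _) (normr_ge0 _).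
move=> /(_ _ _ t (lexx _)); rewrite /= vw subrr normr0 mul0r addr0 mulr0.
by apply => s _; rewrite addr0 gK.
Qed.

Lemma continuous_along n (g : R -> 'cV[R]_n -> 'cV[R]_n) (K : R) (v : R -> 'cV[R]_n) :
  0 < K -> (forall x, continuous (g ^~ x)) ->
  (forall t x y, `|g t x - g t y| <= K * `|x - y|) ->
  continuous v -> continuous (fun t => g t (v t)).
Proof.
move=> K0 gc gK cv t; apply/cvgrPdist_le => e e0; near=> s.
have H1 : `|g t (v t) - g s (v t)| <= e / 2.
  by near: s; have /cvgrPdist_le := gc (v t) t; apply; rewrite divr_gt0.
have H2 : `|v t - v s| <= e / 2 / K.
  by near: s; have /cvgrPdist_le := cv t; apply; rewrite !divr_gt0.
have -> : g t (v t) - g s (v s) = (g t (v t) - g s (v t)) + (g s (v t) - g s (v s)).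
  by rewrite addrA subrK.
rewrite (le_trans (ler_normD _ _))// (splitr e) lerD//.
rewrite (le_trans (gK _ _ _))// (le_trans (ler_wpM2l (ltW K0) H2))//.
by rewrite mulrC divfK ?gt_eqF.
Unshelve. all: by end_near. Qed.

(** Picard iteration converges on the whole line at once: with the weight [cosh2] each step halves
    the distance, so no local solutions have to be glued. *)
Lemma ode_existence n (g : R -> 'cV[R]_n -> 'cV[R]_n) (K C : R) (w0 : 'cV[R]_n) :
  0 < K -> (forall x, continuous (g ^~ x)) ->
  (forall t x y, `|g t x - g t y| <= K * `|x - y|) ->
  (forall t, `|g t w0| <= C) ->
  exists2 w : R -> 'cV[R]_n, w 0 = w0 & forall t : R, is_derive t 1 w (g t (w t)).
Proof.
move=> K0 gc gK gC.
have gvc (v : R -> 'cV[R]_n) : continuous v -> continuous (fun t => g t (v t)).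
  exact: continuous_along K0 gc gK.
(* The default value for a discontinuous [v] is never met, as all iterates and their limit are
   continuous. *)
have /choice[Phi HPhi] : forall v : R -> 'cV[R]_n, exists F : R -> 'cV[R]_n,
    continuous v -> F 0 = w0 /\ forall t : R, is_derive t 1 F (g t (v t)).
  move=> v; have [cv|ncv] := pselect (continuous v); last by exists v.
  by have [F F0 HF] := primitive_cv w0 (gvc _ cv); exists F.
pose w k := iter k Phi (cst w0).
have wc k : continuous (w k).
  elim: k => [|k IH]; first by move=> t; exact: cvg_cst.
  by move=> t; apply: is_derive_continuous ((HPhi _ IH).2 t).
have w00 k : w k 0 = w0 by case: k => // k; exact: (HPhi _ (wc k)).1.
have wd k (t : R) : is_derive t 1 (w k.+1) (g t (w k t)) by exact: (HPhi _ (wc k)).2.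
have C0 : 0 <= C by rewrite (le_trans _ (gC 0)).
pose c := C / K.
have c0 : 0 <= c by rewrite divr_ge0// ltW.
(* This is the contraction: derivatives at weighted distance [K * e] and a common value at 0 give
   curves at weighted distance [e / 2]. *)
have step (a b da db : R -> 'cV[R]_n) e : 0 <= e -> a 0 = b 0 ->
    (forall t : R, is_derive t 1 a (da t)) -> (forall t : R, is_derive t 1 b (db t)) ->
    (forall t, `|da t - db t| <= K * e * cosh2 K t) ->
    forall t, `|a t - b t| <= e / 2 * cosh2 K t.
  move=> e0 ab Ha Hb Hab t.
  have := @weighted_increment n (fun s => a s - b s) (fun t => da t - db t) K e 0 `|t| K0 e0.
  move=> /(_ _ _ t (lexx _)); rewrite mul0r addr0 /= ab subrr subr0; apply.
  by move=> s _; rewrite addr0.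
have wS k t : `|w k.+1 t - w k t| <= c / 2 ^+ k.+1 * cosh2 K t.
  elim: k t => [|k IH] t.
    rewrite expr1; apply: (step _ _ (fun t => g t (w 0%N t)) (fun=> 0)) => //.
    move=> s; rewrite subr0 (le_trans (gC _))// /c mulrCA divff ?gt_eqF// mulr1.
    by rewrite ler_peMr// cosh2_ge1.
  rewrite exprSr invfM mulrA.
  apply: (step _ _ (fun t => g t (w k.+1 t)) (fun t => g t (w k t))) => //.
  - by rewrite divr_ge0// exprn_ge0.
  - by rewrite !w00.
  - by move=> s; rewrite (le_trans (gK _ _ _))// -mulrA ler_pM2l// IH.
have wkj k j t : `|w (k + j)%N t - w k t| <= c / 2 ^+ k * (1 - 2 ^- j) * cosh2 K t.
  elim: j => [|j IH].
    by rewrite addn0 subrr normr0 expr0 invr1 subrr mulr0 mul0r.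
  rewrite addnS -(subrKA (w (k + j)%N t)) (le_trans (ler_normD _ _))//.
  apply: le_trans (lerD (wS _ t) IH) _.
  rewrite -mulrDl ler_wpM2r ?cosh2_ge0// -addnS exprD invfM mulrA -mulrDr.
  rewrite ler_wpM2l//; first by rewrite divr_ge0// exprn_ge0.
  rewrite exprSr invfM.
  have : 0 < (2 : R) ^- j by rewrite invr_gt0 exprn_gt0.
  by set x := _^-1; lra.
have wkj' k j t : `|w (k + j)%N t - w k t| <= c / 2 ^+ k * cosh2 K t.
  rewrite (le_trans (wkj _ _ _))// ler_wpM2r ?cosh2_ge0// ler_piMr//.
    by rewrite divr_ge0// exprn_ge0.
have wcvg t : cvgn (w ^~ t).
  apply/cauchy_cvgP/cauchy_exP => e e0.
  have [k Hk] := half_pow_small (mulr_ge0 c0 (ltW (cosh2_gt0 K t))) (divr_gt0 e0 (ltr0Sn R 1)).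
  exists (w k t); exists k => // j /= kj.
  rewrite -ball_normE /ball_/= distrC -(subnKC kj).
  rewrite (le_lt_trans (wkj' _ _ _))// mulrAC (le_lt_trans Hk)//.
  by rewrite ltr_pdivrMr// mulr_natr mulr2n ltrDl.
pose u t := limn (w ^~ t).
have uw k t : `|u t - w k t| <= c / 2 ^+ k * cosh2 K t.
  apply/ler_addgt0Pr => e e0.
  have : \forall j \near \oo, `|u t - w j t| <= e.
    by have /cvgrPdist_le := wcvg t; apply.
  move=> [N _ HN].
  have := HN (k + N)%N (leq_addl _ _); have := wkj' k N t.
  move=> H1 H2; rewrite -(subrKA (w (k + N)%N t)) (le_trans (ler_normD _ _))//.
  by rewrite addrC lerD.
have uc : continuous u.
  move=> t; apply/cvgrPdist_le => e e0.
  pose b := cosh2 K t + 1.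
  have b0 : 0 < b by rewrite /b addr_gt0// cosh2_gt0.
  have [k Hk] := half_pow_small (mulr_ge0 c0 (ltW b0)) (divr_gt0 e0 (ltr0Sn R 2)).
  near=> s.
  have H1 : `|w k t - w k s| <= e / 3.
    by near: s; have /cvgrPdist_le := wc k t; apply; rewrite divr_gt0.
  have Hb : cosh2 K s <= b.
    have : `|cosh2 K t - cosh2 K s| <= 1.
      by near: s; have /cvgrPdist_le := @cosh2_continuous K t; apply.
    by rewrite distrC ler_norml /b => /andP[_]; lra.
  have H2 (r : R) : cosh2 K r <= b -> `|u r - w k r| <= e / 3.
    move=> rb; rewrite (le_trans (uw k r))// (le_trans _ Hk)// mulrAC.
    by rewrite ler_wpM2r ?invr_ge0 ?exprn_ge0// ler_wpM2l.
  have -> : u t - u s = (u t - w k t) + (w k t - w k s) - (u s - w k s).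
    by rewrite subrKA opprB addrA subrK.
  rewrite (le_trans (ler_normB _ _))//.
  have H3 := ler_normD (u t - w k t) (w k t - w k s).
  have H4 := H2 s Hb.
  have H5 : `|u t - w k t| <= e / 3 by apply: H2; rewrite /b lerDl.
  lra.
have [P0 Pd] := HPhi _ uc.
(* The iterates converge to [u] and, by one more contraction step, also to [Phi u]; the fixed point
   then inherits the derivative of [Phi u]. *)
suff E : Phi u = u by rewrite E in P0 Pd; exists u.
apply/funext => t; apply/eqP; rewrite -subr_eq0 -normr_le0.
apply/ler_addgt0Pr => e e0; rewrite add0r.
have [k Hk] := half_pow_small (mulr_ge0 c0 (ltW (cosh2_gt0 K t))) (divr_gt0 e0 (ltr0Sn R 1)).
have H1 : `|Phi u t - w k.+1 t| <= c / 2 ^+ k / 2 * cosh2 K t.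
  apply: (step _ _ (fun t => g t (u t)) (fun t => g t (w k t))) => //.
  - by rewrite divr_ge0// exprn_ge0.
  - by rewrite P0 w00.
  - by move=> s; rewrite (le_trans (gK _ _ _))// -mulrA ler_pM2l// uw.
have H2 := uw k.+1 t.
rewrite -(subrKA (w k.+1 t)) (le_trans (ler_normD _ _))// -[X in _ + X <= _]normrN opprB.
move: Hk H1 H2; rewrite exprSr invfM !mulrA.
have -> : c * cosh2 K t / 2 ^+ k = c / 2 ^+ k * cosh2 K t by rewrite mulrAC.
set q := c / 2 ^+ k * cosh2 K t.
have -> : c / 2 ^+ k / 2 * cosh2 K t = q / 2 by rewrite mulrAC.
lra.
Unshelve. all: by end_near. Qed.

End ODE.

(** * Scalar products *)

Section Dot.
Context {R : realType}.

Definition dot n (u v : 'cV[R]_n) : R := \sum_i u i 0 * v i 0.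

Lemma dotE n (u v : 'cV[R]_n) : dot u v = (u^T *m v) 0 0.
Proof. by rewrite mxE; apply: eq_bigr => i _; rewrite mxE. Qed.

Lemma dotC n (u v : 'cV[R]_n) : dot u v = dot v u.
Proof. by apply: eq_bigr => i _; rewrite mulrC. Qed.

Lemma dotDl n (u v w : 'cV[R]_n) : dot (u + v) w = dot u w + dot v w.
Proof. by rewrite /dot -big_split; apply: eq_bigr => i _; rewrite mxE mulrDl. Qed.

Lemma dotZl n a (u v : 'cV[R]_n) : dot (a *: u) v = a * dot u v.
Proof. by rewrite /dot mulr_sumr; apply: eq_bigr => i _; rewrite mxE mulrA. Qed.

Lemma dotNl n (u v : 'cV[R]_n) : dot (- u) v = - dot u v.
Proof. by rewrite -scaleN1r dotZl mulN1r. Qed.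

Lemma dotBl n (u v w : 'cV[R]_n) : dot (u - v) w = dot u w - dot v w.
Proof. by rewrite dotDl dotNl. Qed.

Lemma dotDr n (u v w : 'cV[R]_n) : dot u (v + w) = dot u v + dot u w.
Proof. by rewrite dotC dotDl !(dotC _ u). Qed.

Lemma dotZr n a (u v : 'cV[R]_n) : dot u (a *: v) = a * dot u v.
Proof. by rewrite dotC dotZl dotC. Qed.

Lemma dotNr n (u v : 'cV[R]_n) : dot u (- v) = - dot u v.
Proof. by rewrite dotC dotNl dotC. Qed.

Lemma dotBr n (u v w : 'cV[R]_n) : dot u (v - w) = dot u v - dot u w.
Proof. by rewrite dotDr dotNr. Qed.

Lemma dot0l n (u : 'cV[R]_n) : dot 0 u = 0.
Proof. by rewrite -(scale0r 0) dotZl mul0r. Qed.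

Lemma dot0r n (u : 'cV[R]_n) : dot u 0 = 0.
Proof. by rewrite dotC dot0l. Qed.

Lemma dot_mulmxl m n (A : 'M[R]_(m, n)) u v : dot (A *m u) v = dot u (A^T *m v).
Proof. by rewrite !dotE trmx_mul mulmxA. Qed.

Lemma dot_eq0 n (u : 'cV[R]_n) : dot u u = 0 -> u = 0.
Proof.
move=> /eqP; rewrite psumr_eq0 => [/allP H|i _]; last by rewrite -expr2 sqr_ge0.
apply/matrixP => i j; rewrite ord1 mxE; apply/eqP.
by have := H i (mem_index_enum _); rewrite mulf_eq0 orbb.
Qed.

Lemma dot_ge0 n (u : 'cV[R]_n) : 0 <= dot u u.
Proof. by rewrite sumr_ge0// => i _; rewrite -expr2 sqr_ge0. Qed.

Lemma dot_gt0 n (u : 'cV[R]_n) : u != 0 -> 0 < dot u u.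
Proof. by move=> u0; rewrite lt_def dot_ge0 andbT; apply: contra_neq u0 => /dot_eq0. Qed.

Lemma dot_bound n (u v : 'cV[R]_n) : `|dot u v| <= n%:R * `|u| * `|v|.
Proof.
rewrite dotE (le_trans (mxnorm_ge _ _ _))// (le_trans (mulmx_norm _ _))//.
by rewrite norm_trmx.
Qed.

Lemma dot_delta n (u : 'cV[R]_n) i : dot u (delta_mx i 0) = u i 0.
Proof.
rewrite /dot (bigD1 i)//= mxE !eqxx mulr1 big1 ?addr0// => j ji.
by rewrite mxE (negbTE ji) mulr0.
Qed.

Lemma is_derive_dot n (u v : R -> 'cV[R]_n) du dv (t : R) :
  is_derive t 1 u du -> is_derive t 1 v dv ->
  is_derive t 1 (fun s => dot (u s) (v s)) (dot du (v t) + dot (u t) dv).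
Proof.
move=> /is_derive_mxP Hu /is_derive_mxP Hv.
rewrite /dot -big_split; apply: is_derive_sum_fin => i.
exact: is_derive_mulf.
Qed.

Lemma continuous_dot n (T : topologicalType) (u v : T -> 'cV[R]_n) t :
  {for t, continuous u} -> {for t, continuous v} ->
  {for t, continuous (fun s => dot (u s) (v s))}.
Proof.
move=> Hu Hv; rewrite /dot; elim: (index_enum _) => [|i r IH].
  by rewrite (_ : (fun s => _) = cst 0); [exact: cvg_cst|apply/funext => s; rewrite big_nil].
rewrite (_ : (fun s => _) = (fun s => u s i 0 * v s i 0 + \sum_(j <- r) u s j 0 * v s j 0)).
  2: by apply/funext => s; rewrite big_cons.
by apply: cvgD IH; apply: cvgM; exact: continuous_coord.
Qed.

Lemma is_deriveP (W : normedModType R) (f : R -> W) (t : R) df :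
  is_derive t 1 f df <->
  forall e : R, 0 < e -> exists2 d : R, 0 < d &
    forall h, `|h| < d -> `|f (t + h) - f t - h *: df| <= e * `|h|.
Proof.
have q0 (h : R) : h != 0 -> `|df - h^-1 *: (f (h *: 1 + t) - f t)| * `|h| =
    `|f (t + h) - f t - h *: df|.
  move=> h0; rewrite mulrC -normrZ scalerBr scalerA mulfV// scale1r distrC.
  by rewrite [h *: 1]mulr1 (addrC h).
split=> [[fd fE] e e0|H].
  rewrite -fE in q0 *.
  have := fd; move=> /cvgrPdist_le/(_ e e0)/nbhs_ballP[d /= d0 Hd].
  exists d => // h hd; have [->|h0] := eqVneq h 0.
    by rewrite addr0 subrr scale0r subrr !normr0 mulr0.
  rewrite -(q0 _ h0).
  rewrite ler_pM2r ?normr_gt0//; apply: Hd => //.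
  by rewrite /ball/= sub0r normrN.
have C : (fun h => h^-1 *: (f (h *: 1 + t) - f t)) @ 0^' --> df.
  apply/cvgrPdist_le => e e0; have [d d0 Hd] := H e e0.
  apply/nbhs_ballP; exists d => //= h; rewrite /ball/= sub0r normrN => hd h0.
  have hp : 0 < `|h| by rewrite normr_gt0.
  by rewrite -(ler_pM2r hp) q0// Hd.
split; last exact: cvg_lim.
by apply/cvg_ex; exists df.
Qed.

(** A chain rule for an [f] known only through a second-order estimate along [y]: the quadratic
    error is o(h) because [y] is Lipschitz at [t]. It is applied to the Hamiltonian inside a
    tube. *)
Lemma is_derive_quadratic n (y : R -> 'cV[R]_n) (dy : 'cV[R]_n) (f : R -> R) (a : 'cV[R]_n)
    (C d : R) (t : R) : 0 < d -> is_derive t 1 y dy ->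
  (forall s, `|s - t| < d -> `|f s - f t - dot a (y s - y t)| <= C * `|y s - y t| ^+ 2) ->
  is_derive t 1 f (dot a dy).
Proof.
move=> d0 Hy Hf; apply/is_deriveP => e e0.
pose K := `|dy| + 1; pose c := `|C| * K ^+ 2 + 1; pose b := n%:R * `|a| + 1.
have K0 : 0 < K by rewrite /K ltr_wpDl.
have c0 : 0 < c by rewrite /c ltr_wpDl// mulr_ge0// exprn_ge0// ltW.
have b0 : 0 < b by rewrite /b ltr_wpDl// mulr_ge0.
have [d1 d10 H1] := (is_deriveP _ _ _).1 Hy _ ltr01.
have [d2 d20 H2] := (is_deriveP _ _ _).1 Hy _ (divr_gt0 (divr_gt0 e0 (ltr0Sn R 1)) b0).
exists (Num.min (Num.min d d1) (Num.min d2 (e / 2 / c))).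
  by rewrite !lt_min d0 d10 d20 !divr_gt0.
move=> k; rewrite !lt_min => /andP[/andP[kd kd1] /andP[kd2 kc]].
have E1 := H1 k kd1; have E2 := H2 k kd2.
have yK : `|y (t + k) - y t| <= K * `|k|.
  rewrite -(subrK (k *: dy) (y (t + k) - y t)) (le_trans (ler_normD _ _))//.
  by rewrite normrZ /K mulrDl mul1r (mulrC `|dy|) addrC lerD2l -[leRHS]mul1r.
have := Hf (t + k); rewrite addrAC subrr add0r => /(_ kd) E3.
have -> : f (t + k) - f t - k *: dot a dy =
   (f (t + k) - f t - dot a (y (t + k) - y t)) + dot a (y (t + k) - y t - k *: dy).
  by rewrite (dotBr a (y (t + k) - y t)) dotZr /GRing.scale/= addrA subrK.
rewrite (le_trans (ler_normD _ _))// (splitr e) mulrDl lerD//.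
  rewrite (le_trans E3)//.
  apply: (@le_trans _ _ (c * `|k| * `|k|)).
    rewrite -mulrA -expr2; apply: (@le_trans _ _ (`|C| * (K * `|k|) ^+ 2)).
      apply: le_trans (ler_wpM2r (exprn_ge0 2 (normr_ge0 _)) (ler_norm C)) _.
      by rewrite ler_wpM2l// lerXn2r// nnegrE// mulr_ge0// ltW.
    by rewrite exprMn mulrA /c mulrDl mul1r lerDl exprn_ge0.
  by rewrite ler_wpM2r// mulrC -ler_pdivlMr// ltW.
rewrite (le_trans (dot_bound _ _))//.
apply: (@le_trans _ _ (b * (e / 2 / b * `|k|))).
  by rewrite ler_pM// ?mulr_ge0// /b lerDl.
by rewrite mulrA mulrCA divff ?gt_eqF// mulr1.
Qed.

(** The representative [s] is chosen before the function, so the same [s] serves the orbit, the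
    correction and their combination simultaneously. *)
Lemma periodic_reduce (t : R) : exists2 s : R, 0 <= s <= 1 &
  forall (W : Type) (x : R -> W), periodic_with 1 x -> x t = x s.
Proof.
exists (t - (Num.floor t)%:~R).
  by have /andP[] := floor_itv t; rewrite intrD subr_ge0 => -> /ltW; rewrite lerBlDl.
move=> W x px.
have pn (k : nat) s : x (s + k%:R) = x s.
  by elim: k => [|k IH]; rewrite ?addr0// -natr1 addrA px.
have pz (k : int) s : x (s + k%:~R) = x s.
  case: k => k; first exact: pn.
  by rewrite NegzE -[in RHS](subrK (k.+1%:R) s) pn mulrNz.
by rewrite -mulrNz pz.
Qed.

Lemma periodic_bounded (W : normedModType R) (f : R -> W) :
  continuous f -> periodic_with 1 f -> exists2 C, 0 < C & forall t, `|f t| <= C.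
Proof.
move=> cf pf.
have cn : {within `[0, 1], continuous (fun t => `|f t|)}.
  by apply: continuous_subspaceT => t; apply: cvg_norm; exact: cf.
have [c _ Hc] := @EVT_max R _ 0 1 ler01 cn.
exists (`|f c| + 1) => [|t]; first by rewrite ltr_wpDl.
have [s s01 Hs] := periodic_reduce t.
by rewrite (Hs _ f pf) (@le_trans _ _ `|f c|)// ?lerDl// Hc// in_itv.
Qed.

Definition clip n (r : R) (w : 'cV[R]_n) : 'cV[R]_n :=
  \col_i Num.max (- r) (Num.min r (w i 0)).

Lemma clip_norm n r (w : 'cV[R]_n) : 0 <= r -> `|clip r w| <= r.
Proof.
move=> r0; apply: cvnormP => // i; rewrite mxE ler_norml le_max lexx/=.
by rewrite ge_max ge_min lexx/= andbT; lra.
Qed.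

Lemma clip_id n r (w : 'cV[R]_n) : `|w| <= r -> clip r w = w.
Proof.
move=> wr; apply/matrixP => i j; rewrite mxE ord1.
have := le_trans (mxnorm_ge w i 0) wr; rewrite ler_norml => /andP[w1 w2].
by rewrite (min_idPr _)// (max_idPr _).
Qed.

Lemma clip_lipschitz n r (w v : 'cV[R]_n) : `|clip r w - clip r v| <= `|w - v|.
Proof.
apply: cvnormP => // i; rewrite !mxE.
have := mxnorm_ge (w - v) i 0; rewrite !mxE.
apply: le_trans.
rewrite /Num.max /Num.min.
repeat case: ifPn; rewrite -?leNgt => *; rewrite ?subrr ?normr0//;
 rewrite ler_norml; move: (ler_norm (w i 0 - v i 0)) (ler_norm (v i 0 - w i 0)); rewrite (distrC (v i 0)) => *; apply/andP; split; lra.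
Qed.

End Dot.

(** * Reduction to the symmetry group *)

(** Completeness is joined to the norm on matrices, for the fixed point argument in [shoot_zero]. *)
HB.instance Definition _ (R : realType) (m n : nat) := Complete.on 'M[R]_(m, n).

Ltac nonneg := repeat first
  [ assumption | exact: normr_ge0 | exact: ler01 | exact: ler0n
  | apply: addr_ge0 | apply: mulr_ge0 | apply: ltW; assumption ].

Section Reduction.
Context {R : realType} (N m : nat).
Variables (Jm : 'M[R]_N) (X : R -> 'cV[R]_N -> 'cV[R]_N) (H : R -> 'cV[R]_N -> R).
Variables (z : R -> 'cV[R]_N) (Ts h : R) (GG : set 'M[R]_N).
Variables (Am : R -> 'M[R]_N) (B : 'M[R]_(N, m)) (Lam CH : R).
(** A single [Lam] bounds the dimension, the period, the orbit, its linearization and the group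
    action, so that the later constants need not track them separately. *)
Hypothesis Lam1 : 1 <= Lam.
Hypothesis Ts0 : 0 < Ts.
Hypothesis TsLam : Ts <= Lam.
Hypothesis NLam : N%:R <= Lam.
Hypothesis CH0 : 0 < CH.
Hypothesis JT : Jm^T = - Jm.
Hypothesis JJ : Jm *m Jm = - 1%:M.
Hypothesis zd : forall t : R, is_derive t 1 z (Ts *: X 0 (z t)).
Hypothesis zp : periodic_with 1 z.
Hypothesis AmC : continuous Am.
Hypothesis bA : forall t (v : 'cV[R]_N), `|Am t *m v| <= Lam * `|v|.
Hypothesis bX : forall t, `|X 0 (z t)| <= Lam.
Hypothesis bz : forall t, `|z t| <= Lam.
Hypothesis bJ : forall v : 'cV[R]_N, `|Jm *m v| <= Lam * `|v|.
Hypothesis bB : forall v : 'cV[R]_N, `|Jm *m B *m B^T *m v| <= Lam * `|v|.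
Hypothesis gorth : forall g, GG g -> g^T *m g = 1%:M.
Hypothesis bg : forall g (v : 'cV[R]_N), GG g -> `|g *m v| <= Lam * `|v|.
Hypothesis bgT : forall g (v : 'cV[R]_N), GG g -> `|g^T *m v| <= Lam * `|v|.
Hypothesis gJ : forall g, GG g -> Jm *m g = g *m Jm.
Hypothesis gX : forall g v, GG g -> X 0 (g *m v) = g *m X 0 v.
Hypothesis gH : forall g v, GG g -> H 0 (g *m v) = H 0 v.
Hypothesis nondeg : forall (v : R -> 'cV[R]_N) (a : R),
  (forall t : R, is_derive t 1 v (Ts *: (Am t *m v t) + a *: X 0 (z t))) ->
  v 1 - v 0 = Jm *m B *m B^T *m v 0 -> dot (Jm *m X 0 (z 0)) (v 0) = 0 ->
  v 0 = 0 /\ a = 0.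
Hypothesis GGc : compact GG.
Hypothesis GG1 : GG 1%:M.

(** [kap] measures closeness in C^1 (to the linearization along the orbit, and of [X eps] to [X 0]),
    [del] closeness in C^0, and [r] the radius. The hypothesis [tubes] chooses them in the order
    [kap], [r], [del], [eps], which leaves room to choose the radius of the contraction after [r]
    and before [del]. The factor 2 in the radii leaves space for a small rotation or a small time
    shift on top of a correction of size [r]. *)
Definition tube (eps kap del r : R) : Prop :=
  [/\ [/\ 0 < r <= 1, 0 < kap <= 1 & 0 <= del <= kap],
      (forall t w w', `|w| <= 2 * r -> `|w'| <= 2 * r ->
        `|X 0 (z t + w) - X 0 (z t + w') - Am t *m (w - w')| <= kap * `|w - w'|),
      (forall t g y y', GG g -> `|y - g *m z t| <= 2 * Lam * r ->
        `|y' - g *m z t| <= 2 * Lam * r ->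
        `|(X eps y - X 0 y) - (X eps y' - X 0 y')| <= kap * `|y - y'| /\
        `|X eps y - X 0 y| <= del),
      (forall e t g y y', e = eps \/ e = 0 ->
        GG g -> `|y - g *m z t| <= 2 * Lam * r ->
        `|y' - g *m z t| <= 2 * Lam * r ->
        `|H e y' - H e y - dot (Jm *m X e y) (y' - y)| <= CH * `|y' - y| ^+ 2) &
      (forall g, GG g -> `|H eps (g *m z 0) - h| <= del)].

Definition rotated_field eps (g : 'M[R]_N) (y : 'cV[R]_N) := g^T *m X eps (g *m y).

Definition tau (u : 'cV[R]_(N + 1)) : R := dsubmx u 0 0.

(* The unknown [u] collects the initial value of [w] and the increment [tau u] of the
   period; the orbit sought is [g *m (z + w)], and [clip] makes the equation for [w]
   globally Lipschitz. *)
Definition shooting_field eps r g u t (w : 'cV[R]_N) :=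
  (Ts + tau u) *: rotated_field eps g (z t + clip r w) - Ts *: X 0 (z t).

Definition is_sol eps r g u (w : R -> 'cV[R]_N) :=
  w 0 = usubmx u /\ forall t : R, is_derive t 1 w (shooting_field eps r g u t (w t)).

Lemma Lam0 : 0 < Lam. Proof. exact: lt_le_trans ltr01 Lam1. Qed.
Let Lam0' : 0 <= Lam. Proof. exact: ltW Lam0. Qed.

Lemma tau_norm u : `|tau u| <= `|u|.
Proof. by rewrite /tau mxE; exact: mxnorm_ge. Qed.

Lemma usubmx_norm (u : 'cV[R]_(N + 1)) : `|usubmx u| <= `|u|.
Proof. by apply: cvnormP => // i; rewrite mxE; exact: mxnorm_ge. Qed.

Lemma mulmx_normL (A : 'M[R]_N) (v : 'cV[R]_N) : `|A *m v| <= Lam * `|A| * `|v|.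
Proof.
by rewrite (le_trans (mulmx_norm _ _))// -!mulrA ler_wpM2r// mulr_ge0.
Qed.

Lemma dot_norm (u v : 'cV[R]_N) : `|dot u v| <= Lam * `|u| * `|v|.
Proof.
by rewrite (le_trans (dot_bound _ _))// -!mulrA ler_wpM2r// mulr_ge0.
Qed.

Lemma mulmx_telescope (p q : 'M[R]_N) (x y : 'cV[R]_N) :
  p *m x - q *m y = (p - q) *m x + q *m (x - y).
Proof. by rewrite mulmxBl mulmxBr addrA subrK. Qed.

(** * Uniform estimates inside a fixed tube *)

Section Tube.
Variables (eps kap del r : R).
Hypothesis Ht : tube eps kap del r.

Let r0 : 0 < r. Proof. by case: Ht => -[/andP[]]. Qed.
Let r1 : r <= 1. Proof. by case: Ht => -[/andP[]]. Qed.
Let k0 : 0 < kap. Proof. by case: Ht => -[_ /andP[]]. Qed.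
Let k0' : 0 <= kap. Proof. exact: ltW. Qed.
Let k1 : kap <= 1. Proof. by case: Ht => -[_ /andP[]]. Qed.
Let d0 : 0 <= del. Proof. by case: Ht => -[_ _ /andP[]]. Qed.
Let dk : del <= kap. Proof. by case: Ht => -[_ _ /andP[]]. Qed.

Notation D := (fun y => X eps y - X 0 y).
Notation Y := (rotated_field eps).

Lemma rotated_fieldE g y : GG g -> Y g y = X 0 y + g^T *m D (g *m y).
Proof.
move=> Gg; rewrite /rotated_field mulmxBr gX// mulmxA gorth// mul1mx.
by rewrite addrC subrK.
Qed.

Lemma in_tube g t (w : 'cV[R]_N) : GG g -> `|w| <= 2 * r ->
  `|g *m (z t + w) - g *m z t| <= 2 * Lam * r.
Proof.
move=> Gg wr; rewrite -mulmxBr addrAC subrr add0r (le_trans (bg _ Gg))//.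
by rewrite -mulrA mulrCA ler_wpM2l.
Qed.

Lemma X0_lip t w w' : `|w| <= 2 * r -> `|w'| <= 2 * r ->
  `|X 0 (z t + w) - X 0 (z t + w')| <= (Lam + 1) * `|w - w'|.
Proof.
move=> wr wr'; case: Ht => _ /(_ t w w' wr wr') H1 _ _ _.
rewrite -(subrK (Am t *m (w - w')) (X 0 _ - _)) (le_trans (ler_normD _ _))//.
rewrite mulrDl addrC lerD// (le_trans H1)// ler_wpM2r//.
Qed.

Lemma Y_lin g t w w' : GG g -> `|w| <= 2 * r -> `|w'| <= 2 * r ->
  `|Y g (z t + w) - Y g (z t + w') - Am t *m (w - w')| <=
  (1 + Lam * Lam) * kap * `|w - w'|.
Proof.
move=> Gg wr wr'; case: Ht => _ /(_ t w w' wr wr') H1 H2 _ _.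
have [H3 _] := H2 t g _ _ Gg (in_tube t Gg wr) (in_tube t Gg wr').
rewrite !rotated_fieldE//.
set a := X 0 (z t + w) in H1 *; set b := X 0 (z t + w') in H1 *.
rewrite opprD addrACA -mulmxBr (addrAC (a - b)).
rewrite (le_trans (ler_normD _ _))// mulrDl mul1r mulrDl lerD//.
rewrite (le_trans (bgT _ Gg))// -!mulrA ler_wpM2l// (le_trans H3)//.
rewrite -mulmxBr opprD addrACA subrr add0r (le_trans (ler_wpM2l _ (bg _ Gg)))// ?(ltW k0)//.
by rewrite mulrCA.
Qed.

Lemma Y_close g t w : GG g -> `|w| <= 2 * r ->
  `|Y g (z t + w) - X 0 (z t + w)| <= Lam * del.
Proof.
move=> Gg wr; case: Ht => _ _ H2 _ _.
have [_ H3] := H2 t g _ _ Gg (in_tube t Gg wr) (in_tube t Gg wr).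
rewrite rotated_fieldE// addrAC subrr add0r (le_trans (bgT _ Gg))//.
by rewrite ler_wpM2l.
Qed.

Definition LY := 2 * Lam + 2 * (Lam * Lam).

Lemma LY_ge1 : 1 <= LY.
Proof. by rewrite /LY; have := mulr_ge0 Lam0' Lam0'; move: Lam1; lra. Qed.

Lemma Y_lip g t w w' : GG g -> `|w| <= 2 * r -> `|w'| <= 2 * r ->
  `|Y g (z t + w) - Y g (z t + w')| <= LY * `|w - w'|.
Proof.
move=> Gg wr wr'.
rewrite -(subrK (Am t *m (w - w')) (Y g _ - _)) (le_trans (ler_normD _ _))//.
have H1 := Y_lin t Gg wr wr'; have H2 := bA t (w - w').
rewrite (le_trans (lerD H1 H2))// -mulrDl ler_wpM2r//.
have : (1 + Lam * Lam) * kap <= (1 + Lam * Lam) * 1.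
  by rewrite ler_wpM2l// addr_ge0// mulr_ge0.
by rewrite /LY mulr1; have := mulr_ge0 Lam0' Lam0'; move: Lam1; lra.
Qed.

Definition BY := 4 * Lam + 4 * (Lam * Lam).

Lemma Y_bound g t w : GG g -> `|w| <= 2 * r -> `|Y g (z t + w)| <= BY + LY.
Proof.
move=> Gg wr.
have wr0 : `|0 : 'cV[R]_N| <= 2 * r by rewrite normr0 mulr_ge0// ltW.
have H1 := Y_lip t Gg wr wr0; have H2 := Y_close t Gg wr0.
rewrite subr0 addr0 in H1 H2.
have H3 : LY * `|w| <= LY * 2.
  rewrite ler_wpM2l//; first by rewrite (le_trans ler01)// LY_ge1.
  by rewrite (le_trans wr)// -[leRHS]mulr1 ler_wpM2l.
have H4 : Lam * del <= Lam * 1 by rewrite ler_wpM2l// (le_trans dk).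
have H5 : `|Y g (z t + w)| <= `|Y g (z t + w) - Y g (z t)| + (`|Y g (z t) - X 0 (z t)| + `|X 0 (z t)|).
  rewrite -{1}(subrK (Y g (z t)) (Y g (z t + w))) (le_trans (ler_normD _ _))// lerD2l.
  by rewrite -{1}(subrK (X 0 (z t)) (Y g (z t))) (le_trans (ler_normD _ _)).
have := bX t; move: H1 H2 H3 H4 H5; rewrite /BY /LY.
by have := mulr_ge0 Lam0' Lam0'; move: Lam1; lra.
Qed.

(** Points carried by [g2] stay in the tube around [g1] times the orbit, so one tube estimate
    compares two nearby rotations. *)
Lemma g_close g1 g2 t w : GG g1 -> GG g2 -> Lam * `|g1 - g2| <= r -> `|w| <= r ->
  `|g2 *m (z t + w) - g1 *m z t| <= 2 * Lam * r.
Proof.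
move=> G1 G2 gr wr.
have -> : g2 *m (z t + w) - g1 *m z t = (g2 - g1) *m z t + g2 *m w.
  by rewrite mulmxDr mulmxBl addrAC.
rewrite (le_trans (ler_normD _ _))//.
have H1 := mulmx_normL (g2 - g1) (z t); have H2 := bg w G2.
have H3 : Lam * `|w| <= Lam * r by rewrite ler_wpM2l.
have H4 : Lam * `|g2 - g1| * `|z t| <= r * Lam by rewrite ler_pM// ?mulr_ge0// distrC.
by lra.
Qed.

Definition LG := 3 * (Lam * Lam * Lam).

Lemma LG_ge0 : 0 <= LG. Proof. by rewrite !mulr_ge0. Qed.

(** By equivariance of [X 0], the pulled-back field minus [X 0] is the conjugate by [g] of the
    perturbation [X eps - X 0], which is small with Lipschitz constant [kap]. This is the source of
    the factor [kap] in every later dependence on the rotation. *)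
Lemma Y_rot g1 g2 t w1 w2 : GG g1 -> GG g2 -> Lam * `|g1 - g2| <= r ->
  `|w1| <= r -> `|w2| <= r ->
  `|(Y g1 (z t + w1) - X 0 (z t + w1)) - (Y g2 (z t + w2) - X 0 (z t + w2))| <=
  LG * kap * (`|g1 - g2| + `|w1 - w2|).
Proof.
move=> G1 G2 gr wr1 wr2; case: Ht => _ _ HD _ _.
have wr1' : `|w1| <= 2 * r by rewrite (le_trans wr1)// ler_peMl// ?ltW// ltr1n.
have [H1 H2] := HD t g1 _ _ G1 (in_tube t G1 wr1') (g_close t G1 G2 gr wr2).
rewrite !rotated_fieldE// [X in `|X - _|]addrAC [X in `|_ - X|]addrAC !subrr !add0r.
set a := g1 *m (z t + w1) in H1 H2 *; set b := g2 *m (z t + w2) in H1 *.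
have -> : g1^T *m D a - g2^T *m D b = (g1 - g2)^T *m D a + g2^T *m (D a - D b).
  rewrite mulmx_telescope (_ : (g1 - g2)^T = g1^T - g2^T)//.
  by apply/matrixP => i j; rewrite !mxE.
rewrite (le_trans (ler_normD _ _))//.
have H3 := mulmx_normL (g1 - g2)^T (D a); rewrite norm_trmx in H3.
have H4 := le_trans (bgT (D a - D b) G2) (ler_wpM2l Lam0' H1).
have E : a - b = (g1 - g2) *m (z t + w1) + g2 *m (w1 - w2).
  by rewrite /a /b mulmx_telescope opprD addrACA subrr add0r.
have H5 : `|a - b| <= Lam * `|g1 - g2| * (2 * Lam) + Lam * `|w1 - w2|.
  rewrite E (le_trans (ler_normD _ _))// lerD// ?bg//.
  rewrite (le_trans (mulmx_normL _ _))// ler_wpM2l ?mulr_ge0//.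
  rewrite (le_trans (ler_normD _ _))//; have := bz t; move: wr1 r1 Lam1; lra.
set G := `|g1 - g2| in H3 H5 *; set W := `|w1 - w2| in H5 *.
have G0 : 0 <= G by exact: normr_ge0.
have W0 : 0 <= W by exact: normr_ge0.
have H6 : Lam * (kap * `|a - b|) <= Lam * (kap * (Lam * G * (2 * Lam) + Lam * W)).
  by rewrite ler_wpM2l// ler_wpM2l// ltW.
have H7 : Lam * G * `|D a| <= Lam * G * kap.
  by rewrite ler_wpM2l// ?mulr_ge0// (le_trans H2).
have L2 : Lam <= Lam * Lam by rewrite ler_peMr.
have L3 : Lam * Lam <= Lam * Lam * Lam by rewrite ler_peMr// mulr_ge0.
have H8 : Lam * G * kap <= Lam * Lam * Lam * G * kap.
  by rewrite ler_wpM2r// ler_wpM2r// (le_trans L2).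
have H9 : Lam * Lam * W * kap <= 3 * (Lam * Lam * Lam) * W * kap.
  rewrite ler_wpM2r// ler_wpM2r//; move: L3 L2 Lam0'; lra.
apply: le_trans (lerD H3 H4) _; move: H6 H7 H8 H9; rewrite /LG; lra.
Qed.

Lemma Y_rot_lip g1 g2 t w1 w2 : GG g1 -> GG g2 -> Lam * `|g1 - g2| <= r ->
  `|w1| <= r -> `|w2| <= r ->
  `|Y g1 (z t + w1) - Y g2 (z t + w2)| <=
  (LG + Lam + 1) * `|w1 - w2| + LG * kap * `|g1 - g2|.
Proof.
move=> G1 G2 gr wr1 wr2.
have H1 := Y_rot t G1 G2 gr wr1 wr2.
have r2 : r <= 2 * r by rewrite ler_peMl// ?ltW// ltr1n.
have H2 := X0_lip t (le_trans wr1 r2) (le_trans wr2 r2).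
have -> : Y g1 (z t + w1) - Y g2 (z t + w2) =
   (Y g1 (z t + w1) - X 0 (z t + w1) - (Y g2 (z t + w2) - X 0 (z t + w2))) +
   (X 0 (z t + w1) - X 0 (z t + w2)).
  by rewrite opprB addrAC (addrA (_ - _)) subrK addrA subrK.
rewrite (le_trans (ler_normD _ _))// (le_trans (lerD H1 H2))//.
have : LG * kap * `|w1 - w2| <= LG * `|w1 - w2|.
  by rewrite ler_wpM2r// ler_piMr// LG_ge0.
by lra.
Qed.

Lemma continuous_X0z : continuous (fun t => X 0 (z t)).
Proof.
move=> t; apply/cvgrPdist_le => e e0.
have zc : {for t, continuous z} by apply: is_derive_continuous (zd t).
have L1 : 0 < Lam + 1 by rewrite ltr_wpDl.
near=> s.
have H1 : `|z t - z s| <= r by near: s; move/cvgrPdist_le : zc; apply.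
have H2 : `|z t - z s| <= e / (Lam + 1).
  by near: s; move/cvgrPdist_le : zc; apply; rewrite divr_gt0.
have H3 : `|z s - z t| <= 2 * r by rewrite distrC (le_trans H1)// ler_peMl// ?ltW// ltr1n.
have H4 : `|0 : 'cV[R]_N| <= 2 * r by rewrite normr0 mulr_ge0// ltW.
have := X0_lip t H4 H3; rewrite addr0 sub0r normrN (addrC (z t)) subrK => /le_trans; apply.
by rewrite mulrC -ler_pdivlMr// distrC.
Unshelve. all: by end_near. Qed.

Lemma continuous_Yz g c : GG g -> `|c| <= r -> continuous (fun t => Y g (z t + c)).
Proof.
move=> Gg cr t; apply/cvgrPdist_le => e e0.
have zc : {for t, continuous z} by apply: is_derive_continuous (zd t).
have L1 : 0 < LY by exact: lt_le_trans LY_ge1.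
near=> s.
have H1 : `|z t - z s| <= r by near: s; move/cvgrPdist_le : zc; apply.
have H2 : `|z t - z s| <= e / LY.
  by near: s; move/cvgrPdist_le : zc; apply; rewrite divr_gt0.
have H3 : `|z s - z t + c| <= 2 * r.
  by rewrite (le_trans (ler_normD _ _))// distrC mulr_natl mulr2n lerD.
have H4 : `|c| <= 2 * r by rewrite (le_trans cr)// ler_peMl// ?ltW// ltr1n.
have := Y_lip t Gg H4 H3; rewrite addrA (addrC (z t)) subrK => /le_trans; apply.
by rewrite opprD addrCA subrr addr0 opprB mulrC -ler_pdivlMr.
Unshelve. all: by end_near. Qed.

Lemma shooting_lip g u t x y : GG g ->
  `|shooting_field eps r g u t x - shooting_field eps r g u t y| <=
  (`|Ts + tau u| * LY + 1) * `|x - y|.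
Proof.
move=> Gg; rewrite /shooting_field opprB addrA subrK -scalerBr normrZ mulrDl mul1r.
have H1 (v : 'cV[R]_N) : `|clip r v| <= 2 * r.
  by rewrite (le_trans (clip_norm _ (ltW r0)))// ler_peMl// ?ltW// ltr1n.
have := Y_lip t Gg (H1 x) (H1 y) => H2.
have H3 : LY * `|clip r x - clip r y| <= LY * `|x - y|.
  by rewrite ler_wpM2l ?clip_lipschitz// (le_trans ler01)// LY_ge1.
apply: (@le_trans _ _ (`|Ts + tau u| * LY * `|x - y|)); last by rewrite lerDl.
by rewrite -mulrA ler_wpM2l// (le_trans H2).
Qed.

Lemma continuous_shooting_field g u x : GG g ->
  continuous (fun t => shooting_field eps r g u t x).
Proof.
move=> Gg t; apply: cvgB; (apply: cvgZ; first exact: cvg_cst).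
  by apply: continuous_Yz => //; rewrite clip_norm// ltW.
exact: continuous_X0z.
Qed.

Lemma sol_exists g u : GG g -> exists w, is_sol eps r g u w.
Proof.
move=> Gg.
have cr (v : 'cV[R]_N) : `|clip r v| <= r by rewrite clip_norm// ltW.
have [||||w w0 Hw] := @ode_existence _ _ (shooting_field eps r g u) (`|Ts + tau u| * LY + 1)
    (`|Ts + tau u| * (BY + LY) + `|Ts| * Lam) (usubmx u).
- by rewrite ltr_wpDl// mulr_ge0// (le_trans ler01)// LY_ge1.
- by move=> x; exact: continuous_shooting_field.
- by move=> t x y; exact: shooting_lip.
- move=> t; rewrite (le_trans (ler_normB _ _))// lerD// normrZ ler_wpM2l//.
  by rewrite Y_bound// (le_trans (cr _))// ler_peMl// ?ltW// ltr1n.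
by exists w.
Qed.

Lemma sol_periodic g u w : GG g -> is_sol eps r g u w -> w 1 = w 0 -> periodic_with 1 w.
Proof.
move=> Gg [w0 Hw] w10 t.
apply: (@ode_uniqueness _ _ (shooting_field eps r g u) (`|Ts + tau u| * LY + 1) (fun t => w (t + 1)) w).
- by rewrite ltr_wpDl// mulr_ge0// (le_trans ler01)// LY_ge1.
- by move=> s x y; exact: shooting_lip.
- move=> s; have D1 := is_derive_addf (is_derive_id s (1 : R)) (is_derive_cst (1 : R) s (1 : R)).
  apply: is_derive_ext (is_derive_compf (Hw _) D1) => //.
  by rewrite addr0 scale1r /shooting_field zp.
- by rewrite add0r.
Qed.

(** One growth rate that dominates those met in [sol_small], [sol_lip] and [sol_lin], so that the
    three Gronwall estimates share the factor [Gc]. *)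
Definition Kc := 2 * Lam * (LG + LY + Lam + 1).
Definition Gc := 2 * gronwall_const Kc 1.

Lemma LY_ge0 : 0 <= LY.
Proof. by rewrite (le_trans ler01)// LY_ge1. Qed.

Lemma BY_ge0 : 0 <= BY.
Proof. by rewrite /BY addr_ge0// !mulr_ge0. Qed.

Lemma Kc_gt0 : 0 < Kc.
Proof.
rewrite /Kc; apply: mulr_gt0; first by rewrite mulr_gt0// Lam0.
by have := LG_ge0; have := LY_ge0; move: Lam0'; lra.
Qed.

Lemma Gc_gt0 : 0 < Gc.
Proof. by rewrite mulr_gt0// gronwall_const_gt0. Qed.

Lemma period_bound u rho : `|u| <= rho -> rho <= 1 -> `|Ts + tau u| <= 2 * Lam.
Proof.
move=> ur r1'; rewrite (le_trans (ler_normD _ _))// (ger0_norm (ltW Ts0)).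
by have := tau_norm u; move: TsLam Lam1; lra.
Qed.

Definition C1 := Gc * (1 + 2 * Lam * Lam + Lam).

Lemma C1_gt0 : 0 < C1.
Proof. by rewrite mulr_gt0 ?Gc_gt0// addr_gt0// ?Lam0// addr_gt0// ?mulr_gt0// Lam0. Qed.

(** At w = 0 the field reduces to the perturbation along the orbit, of size [del], and to the change
    of period times [X 0]; Gronwall propagates this defect and the initial value. *)
Lemma sol_small g u w rho : GG g -> is_sol eps r g u w -> `|u| <= rho -> del <= rho ->
  rho <= 1 -> forall t, `|t| <= 1 -> `|w t| <= C1 * rho.
Proof.
move=> Gg [w0 Hw] ur dr rho1.
have rho0 : 0 <= rho by rewrite (le_trans _ ur).
have mE : 0 <= (2 * Lam * Lam + Lam) * rho.
  by rewrite mulr_ge0// addr_ge0// mulr_ge0// mulr_ge0.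
have HT := period_bound ur rho1.
have Hd t : `|t| <= 1 -> `|shooting_field eps r g u t (w t)| <=
    Kc * `|w t| + (2 * Lam * Lam + Lam) * rho.
  move=> _.
  have cr : `|clip r (w t)| <= 2 * r.
    by rewrite (le_trans (clip_norm _ (ltW r0)))// ler_peMl// ?ltW// ltr1n.
  have wr0 : `|0 : 'cV[R]_N| <= 2 * r by rewrite normr0 mulr_ge0// ltW.
  have H1 := Y_lip t Gg cr wr0; have H2 := Y_close t Gg wr0.
  rewrite subr0 addr0 in H1 H2.
  have -> : shooting_field eps r g u t (w t) =
    (Ts + tau u) *: (Y g (z t + clip r (w t)) - Y g (z t) + (Y g (z t) - X 0 (z t))) +
    tau u *: X 0 (z t).
    by rewrite subrKA /shooting_field; apply/matrixP => i j; rewrite !mxE; ring.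
  have H3 : `|clip r (w t)| <= `|w t|.
    have := clip_lipschitz r (w t) 0; rewrite subr0.
    by rewrite (clip_id (w := 0)) ?normr0 ?subr0// ltW.
  have H4 : `|Y g (z t + clip r (w t)) - Y g (z t) + (Y g (z t) - X 0 (z t))| <=
      LY * `|w t| + Lam * rho.
    rewrite (le_trans (ler_normD _ _))// lerD//.
      by rewrite (le_trans H1)// ler_wpM2l// (le_trans ler01)// LY_ge1.
    by rewrite (le_trans H2)// ler_wpM2l.
  have H5 : `|tau u *: X 0 (z t)| <= Lam * rho.
    by rewrite normrZ mulrC ler_pM// (le_trans (tau_norm _)).
  have H6 : `|(Ts + tau u) *: (Y g (z t + clip r (w t)) - Y g (z t) + (Y g (z t) - X 0 (z t)))|
     <= 2 * Lam * (LY * `|w t| + Lam * rho).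
    by rewrite normrZ ler_pM.
  rewrite (le_trans (ler_normD _ _))// (le_trans (lerD H6 H5))//.
  have : 0 <= 2 * Lam * (LG + Lam + 1) * `|w t|.
    by rewrite !mulr_ge0// !addr_ge0// LG_ge0.
  by rewrite /Kc; lra.
have Hg := @gronwall _ _ w _ _ _ _ Kc_gt0 mE ler01 (fun t _ => Hw t) Hd.
move=> t t1; apply: le_trans (Hg t t1) _.
rewrite mulr1 -/Gc /C1 -[leRHS]mulrA ler_pM2l ?Gc_gt0// w0.
have := usubmx_norm u; lra.
Qed.

Definition C2 := Gc * (1 + BY + LY + 2 * Lam * LG).

Lemma C2_gt0 : 0 < C2.
Proof.
have := BY_ge0; have := LY_ge0; have := LG_ge0 => *.
by rewrite mulr_gt0 ?Gc_gt0// -!addrA ltr_pwDl//; nonneg.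
Qed.

Lemma tauB u v : tau (u - v) = tau u - tau v.
Proof. by rewrite /tau !mxE. Qed.

(** As soon as [C1 * rho <= r], the truncation is inactive for times in [-1, 1], and the solution
    there solves the untruncated equation. *)
Lemma clip_sol g u w rho t : GG g -> is_sol eps r g u w -> `|u| <= rho -> del <= rho ->
  rho <= 1 -> C1 * rho <= r -> `|t| <= 1 -> `|w t| <= r /\ clip r (w t) = w t.
Proof.
move=> Gg Hw ur dr rho1 Cr t1.
have wr : `|w t| <= r by rewrite (le_trans _ Cr)// (sol_small Gg Hw ur dr).
by split=> //; exact: clip_id.
Qed.

Lemma sol_lip g1 g2 u1 u2 w1 w2 rho : GG g1 -> GG g2 ->
  is_sol eps r g1 u1 w1 -> is_sol eps r g2 u2 w2 ->
  `|u1| <= rho -> `|u2| <= rho -> del <= rho -> rho <= 1 -> C1 * rho <= r ->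
  Lam * `|g1 - g2| <= r ->
  forall t, `|t| <= 1 -> `|w1 t - w2 t| <= C2 * (`|u1 - u2| + kap * `|g1 - g2|).
Proof.
move=> G1 G2 S1 S2 ur1 ur2 dr rho1 Cr gr.
set du := `|u1 - u2|; set dg := `|g1 - g2| in gr *.
have du0 : 0 <= du by exact: normr_ge0.
have dg0 : 0 <= dg by exact: normr_ge0.
have mE : 0 <= (BY + LY) * du + 2 * Lam * LG * kap * dg.
  by have := BY_ge0; have := LY_ge0; have := LG_ge0 => *; nonneg.
have HT := period_bound ur1 rho1.
have Hd t : `|t| <= 1 ->
    `|shooting_field eps r g1 u1 t (w1 t) - shooting_field eps r g2 u2 t (w2 t)| <=
    Kc * `|w1 t - w2 t| + ((BY + LY) * du + 2 * Lam * LG * kap * dg).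
  move=> t1.
  have [wr1 cw1] := clip_sol G1 S1 ur1 dr rho1 Cr t1.
  have [wr2 cw2] := clip_sol G2 S2 ur2 dr rho1 Cr t1.
  have H1 := Y_rot_lip t G1 G2 gr wr1 wr2.
  have H2 : `|Y g2 (z t + w2 t)| <= BY + LY.
    by apply: Y_bound => //; rewrite (le_trans wr2)// ler_peMl// ?ltW// ltr1n.
  have -> : shooting_field eps r g1 u1 t (w1 t) - shooting_field eps r g2 u2 t (w2 t) =
    (Ts + tau u1) *: (Y g1 (z t + w1 t) - Y g2 (z t + w2 t)) + tau (u1 - u2) *: Y g2 (z t + w2 t).
    by rewrite /shooting_field cw1 cw2 tauB; apply/matrixP => i j; rewrite !mxE; ring.
  rewrite (le_trans (ler_normD _ _))// !normrZ.
  have H3 : `|tau (u1 - u2)| * `|Y g2 (z t + w2 t)| <= du * (BY + LY).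
    by rewrite ler_pM// tau_norm.
  have H4 : `|Ts + tau u1| * `|Y g1 (z t + w1 t) - Y g2 (z t + w2 t)| <=
    2 * Lam * ((LG + Lam + 1) * `|w1 t - w2 t| + LG * kap * dg) by rewrite ler_pM.
  have : 0 <= 2 * Lam * LY * `|w1 t - w2 t| by rewrite !mulr_ge0// LY_ge0.
  move: H3 H4; rewrite /Kc; lra.
have Hg := @gronwall _ _ (fun t => w1 t - w2 t) _ _ _ _ Kc_gt0 mE ler01
  (fun t _ => is_derive_subf (S1.2 t) (S2.2 t)) Hd.
move=> t t1; apply: le_trans (Hg t t1) _.
rewrite mulr1 -/Gc /C2 -[leRHS]mulrA ler_pM2l ?Gc_gt0// S1.1 S2.1.
have H1 : `|usubmx u1 - usubmx u2| <= du.
  by rewrite (_ : _ - _ = usubmx (u1 - u2)) ?usubmx_norm// linearB.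
have := BY_ge0; have := LY_ge0; have := LG_ge0 => a1 a2 a3.
have H2 : 0 <= 2 * Lam * LG * du by nonneg.
have H3 : 0 <= (1 + BY + LY) * (kap * dg) by nonneg.
lra.
Qed.

(** * Linearized shooting and the solution of the augmented problem *)

Definition is_linear_sol u (v : R -> 'cV[R]_N) :=
  v 0 = usubmx u /\
  forall t : R, is_derive t 1 v (Ts *: (Am t *m v t) + tau u *: X 0 (z t)).

Definition C3 := Gc * (2 * Lam * (1 + Lam * Lam) * C2 + Lam * C2 + LY * C1 + Lam).

Lemma C3_gt0 : 0 < C3.
Proof.
have := LY_ge0; have := ltW C2_gt0; have := ltW C1_gt0 => *.
by rewrite mulr_gt0 ?Gc_gt0// ltr_wpDl ?Lam0//; nonneg.
Qed.

(** Strict differentiability of the flow in [u], uniform in [g] and [eps]: the derivative is that of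
    the unperturbed flow along [z], with [kap] paying for the field and [rho] for the size of the
    two solutions. *)
Lemma sol_lin g u1 u2 w1 w2 v rho : GG g ->
  is_sol eps r g u1 w1 -> is_sol eps r g u2 w2 -> is_linear_sol (u1 - u2) v ->
  `|u1| <= rho -> `|u2| <= rho -> del <= rho -> rho <= 1 -> C1 * rho <= r ->
  forall t, `|t| <= 1 -> `|w1 t - w2 t - v t| <= C3 * (kap + rho) * `|u1 - u2|.
Proof.
move=> G1 S1 S2 Sv ur1 ur2 dr rho1 Cr.
have gr : Lam * `|g - g| <= r by rewrite subrr normr0 mulr0 ltW.
have Hl := sol_lip G1 G1 S1 S2 ur1 ur2 dr rho1 Cr gr.
rewrite subrr normr0 mulr0 addr0 in Hl.
have rho0 : 0 <= rho by rewrite (le_trans _ ur1).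
set du := `|u1 - u2| in Hl *.
have du0 : 0 <= du by exact: normr_ge0.
have C20 := ltW C2_gt0. have C10 := ltW C1_gt0.
set M := (2 * Lam * (1 + Lam * Lam) * kap * C2 + Lam * C2 * rho + LY * C1 * rho + Lam * rho) * du.
have mE : 0 <= M.
  by have := LY_ge0 => *; nonneg.
have HT := period_bound ur1 rho1.
have Hd t : `|t| <= 1 ->
    `|shooting_field eps r g u1 t (w1 t) - shooting_field eps r g u2 t (w2 t) -
      (Ts *: (Am t *m v t) + tau (u1 - u2) *: X 0 (z t))| <= Kc * `|w1 t - w2 t - v t| + M.
  move=> t1.
  have [wr1 cw1] := clip_sol G1 S1 ur1 dr rho1 Cr t1.
  have [wr2 cw2] := clip_sol G1 S2 ur2 dr rho1 Cr t1.
  have r2 : r <= 2 * r by rewrite ler_peMl// ?ltW// ltr1n.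
  have wr0 : `|0 : 'cV[R]_N| <= 2 * r by rewrite normr0 mulr_ge0// ltW.
  have H1 := Y_lin t G1 (le_trans wr1 r2) (le_trans wr2 r2).
  have H2 := Y_lip t G1 (le_trans wr2 r2) wr0.
  have H3 := Y_close t G1 wr0.
  rewrite subr0 addr0 in H2 H3.
  set w := w1 t - w2 t in H1 *.
  set Y1 := Y g (z t + w1 t) in H1 *; set Y2 := Y g (z t + w2 t) in H1 H2 *.
  (* The first summand is linear in the unknown error and feeds Gronwall; the others are the failure
     of linearity, the change of period acting on [w], and the variation of the field that
     multiplies the difference of periods. *)
  have -> : shooting_field eps r g u1 t (w1 t) - shooting_field eps r g u2 t (w2 t) -
      (Ts *: (Am t *m v t) + tau (u1 - u2) *: X 0 (z t)) =
    Ts *: (Am t *m (w - v t)) + ((Ts + tau u1) *: (Y1 - Y2 - Am t *m w) + tau u1 *: (Am t *m w) +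
     tau (u1 - u2) *: ((Y2 - Y g (z t)) + (Y g (z t) - X 0 (z t)))).
    rewrite /shooting_field cw1 cw2 -/Y1 -/Y2 tauB subrKA mulmxBr.
    by apply/matrixP => i j; rewrite !mxE; ring.
  have Hw := Hl t t1; rewrite -/w in Hw.
  have H4 : `|(Ts + tau u1) *: (Y1 - Y2 - Am t *m w)| <=
     2 * Lam * ((1 + Lam * Lam) * kap * (C2 * du)).
    by rewrite normrZ ler_pM// (le_trans H1)// ler_wpM2l//; nonneg.
  have H5 : `|tau u1 *: (Am t *m w)| <= rho * (Lam * (C2 * du)).
    rewrite normrZ ler_pM// ?(le_trans (tau_norm _))// (le_trans (bA _ _))// ler_wpM2l//.
  have w2s := sol_small G1 S2 ur2 dr rho1 t1.
  have H6 : `|tau (u1 - u2) *: ((Y2 - Y g (z t)) + (Y g (z t) - X 0 (z t)))| <=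
     du * (LY * (C1 * rho) + Lam * rho).
    rewrite normrZ ler_pM// ?tau_norm// (le_trans (ler_normD _ _))// lerD//.
      by rewrite (le_trans H2)// ler_wpM2l// LY_ge0.
    by rewrite (le_trans H3)// ler_wpM2l.
  have H7 : `|Ts *: (Am t *m (w - v t))| <= Lam * (Lam * `|w - v t|).
    by rewrite normrZ ler_pM// ger0_norm// ltW.
  have H8 : Lam * Lam * `|w - v t| <= Kc * `|w - v t|.
    rewrite ler_wpM2r// /Kc; have := LG_ge0; have := LY_ge0 => a1 a2.
    have a3 : 0 <= Lam * (LG + LY) by rewrite mulr_ge0// addr_ge0.
    by have := mulr_ge0 Lam0' Lam0'; move: a3 Lam0'; lra.
  rewrite (le_trans (ler_normD _ _))// lerD//.
    by rewrite (le_trans H7)// mulrA.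
  rewrite (le_trans (ler_normD _ _))// (le_trans (lerD (ler_normD _ _) H6))//.
  by move: H4 H5; rewrite /M; lra.
have Hg := @gronwall _ _ (fun t => w1 t - w2 t - v t) _ _ _ _ Kc_gt0 mE ler01
  (fun t _ => is_derive_subf (is_derive_subf (S1.2 t) (S2.2 t)) (Sv.2 t)) Hd.
move=> t t1; apply: le_trans (Hg t t1) _.
rewrite mulr1 -/Gc /C3 -[leRHS]mulrA -[leRHS]mulrA ler_pM2l ?Gc_gt0// S1.1 S2.1 Sv.1.
rewrite (_ : usubmx u1 - usubmx u2 - _ = 0); last by rewrite linearB/= subrr.
rewrite normr0 add0r /M [leRHS]mulrA ler_wpM2r//.
have a0 := LY_ge0.
have a1 : 0 <= 2 * Lam * (1 + Lam * Lam) * C2 * rho by nonneg.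
have a2 : 0 <= (Lam * C2 + LY * C1 + Lam) * kap by nonneg.
lra.
Qed.

Lemma linear_sol_exists u : exists v, is_linear_sol u v.
Proof.
have [||||v v0 Hv] := @ode_existence _ _ (fun t w => Ts *: (Am t *m w) + tau u *: X 0 (z t))
    (Ts * Lam + 1) (Ts * (Lam * `|usubmx u|) + `|tau u| * Lam) (usubmx u).
- by rewrite ltr_wpDl// mulr_ge0// ltW.
- move=> x t; have Cx := continuous_mulmxr (x := x) (@AmC t).
  by apply: cvgD; (apply: cvgZ; first exact: cvg_cst); [exact: Cx|exact: continuous_X0z].
- move=> t x y; rewrite opprD addrACA subrr addr0 -scalerBr -mulmxBr normrZ gtr0_norm//.
  rewrite mulrDl mul1r -mulrA ler_wpDr// ler_pM2l//.
- move=> t; rewrite (le_trans (ler_normD _ _))// !normrZ gtr0_norm// lerD// ler_wpM2l//.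
  exact: ltW.
by exists v.
Qed.

(** Derivative of [shoot] at the unperturbed orbit. Writing it with constant matrices acting on
    [v 1] and [v 0] makes linearity in [v] immediate. *)
Definition linear_shoot (v : R -> 'cV[R]_N) : 'cV[R]_(N + 1) :=
  col_mx 1%:M 0 *m v 1 +
  col_mx (- 1%:M - Jm *m B *m B^T) ((Jm *m X 0 (z 0))^T) *m v 0.

Lemma linear_shootE v : linear_shoot v =
  col_mx (v 1 - v 0 - Jm *m B *m B^T *m v 0) (dot (Jm *m X 0 (z 0)) (v 0))%:M.
Proof.
rewrite /linear_shoot !mul_col_mx add_col_mx mul1mx mul0mx add0r; congr col_mx.
  by rewrite mulmxBl mulNmx mul1mx addrA.
by rewrite dotE [LHS]mx11_scalar.
Qed.

Lemma linear_shoot_sum (I : finType) (c : I -> R) (v : I -> R -> 'cV[R]_N) :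
  linear_shoot (fun t => \sum_i c i *: v i t) = \sum_i c i *: linear_shoot (v i).
Proof.
rewrite /linear_shoot !mulmx_sumr -big_split; apply: eq_bigr => i _.
by rewrite /= -!scalemxAr -scalerDr.
Qed.

Lemma linear_sol_unique u v w : is_linear_sol u v -> is_linear_sol u w -> v = w.
Proof.
move=> [v0 Hv] [w0 Hw]; apply/funext.
apply: (@ode_uniqueness _ _ (fun t w => Ts *: (Am t *m w) + tau u *: X 0 (z t)) (Ts * Lam + 1)) => //.
- by rewrite ltr_wpDl// mulr_ge0// ltW.
- move=> t x y; rewrite opprD addrACA subrr addr0 -scalerBr -mulmxBr normrZ gtr0_norm//.
  rewrite mulrDl mul1r -mulrA ler_wpDr// ler_pM2l//.
- by rewrite v0 w0.
Qed.

(** The unknowns are N initial coordinates and the period, the equations are N components of the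
    jump and the energy. The system is square, so the trivial kernel provided by [nondeg] already
    makes the matrix invertible. *)
Lemma shooting_matrix : exists2 L : 'M[R]_(N + 1), L \in unitmx &
  forall u v, is_linear_sol u v -> L *m u = linear_shoot v.
Proof.
have /choice[vs Hvs] : forall j : 'I_(N + 1), exists v, is_linear_sol (delta_mx j 0) v.
  by move=> j; exact: linear_sol_exists.
pose L : 'M[R]_(N + 1) := \matrix_(i, j) linear_shoot (vs j) i 0.
have LE u v : is_linear_sol u v -> L *m u = linear_shoot v.
  move=> Sv.
  have <- : (fun t => \sum_j u j 0 *: vs j t) = v.
    apply: linear_sol_unique Sv; split.
      apply/matrixP => i k; rewrite summxE mxE ord1.
      under eq_bigr do rewrite mxE (Hvs _).1 !mxE eqxx andbT.
      rewrite (bigD1 (lshift 1 i))//= eqxx mulr1 big1 ?addr0// => j ji.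
      by rewrite eq_sym (negbTE ji) mulr0.
    move=> t.
    have := @is_derive_sum_fin R _ _ (fun j t => u j 0 *: vs j t)
      (fun j => u j 0 *: (Ts *: (Am t *m vs j t) + tau (delta_mx j 0) *: X 0 (z t))) t.
    move=> Hd; apply: is_derive_ext (Hd _) => // [|j]; last first.
      exact: is_derive_scalef ((Hvs j).2 t).
    under eq_bigr do rewrite scalerDr; rewrite big_split/=; congr (_ + _).
      rewrite mulmx_sumr scaler_sumr; apply: eq_bigr => j _.
      by rewrite -scalemxAr !scalerA mulrC.
    under eq_bigr do rewrite scalerA; rewrite -scaler_suml; congr (_ *: _).
    rewrite /tau; under eq_bigr do rewrite !mxE eqxx andbT.
    rewrite mxE (bigD1 (rshift N 0))//= eqxx mulr1 big1 ?addr0// => j ji.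
    by rewrite eq_sym (negbTE ji) mulr0.
  rewrite linear_shoot_sum; apply/matrixP => i k; rewrite ord1 mxE summxE.
  by apply: eq_bigr => j _; rewrite !mxE mulrC.
exists L => //; rewrite -unitmx_tr -row_free_unit; apply: inj_row_free => v Hv.
have {}Hv : L *m v^T = 0 by rewrite -[L]trmxK -trmx_mul Hv trmx0.
have [w Sw] := linear_sol_exists v^T.
have := LE _ _ Sw; rewrite Hv linear_shootE => /esym E.
have E1 : w 1 - w 0 - Jm *m B *m B^T *m w 0 = 0.
  by have := congr1 usubmx E; rewrite col_mxKu linear0.
have E2 : dot (Jm *m X 0 (z 0)) (w 0) = 0.
  have := congr1 dsubmx E; rewrite col_mxKd linear0 => /matrixP /(_ 0 0).
  by rewrite !mxE eqxx mulr1n.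
have [w00 tu0] := nondeg Sw.2 (subr0_eq E1) E2.
rewrite Sw.1 in w00.
rewrite -[v]trmxK -[v^T]vsubmxK w00 -[RHS]trmx0; congr _^T.
rewrite -[RHS](vsubmxK (0 : 'cV[R]_(N + 1))) !linear0; congr col_mx.
by rewrite [LHS]mx11_scalar -/(tau _) tu0 raddf0.
Qed.

(* The jump [w 1 - w 0] is only asked to equal [Jm *m B *m B^T *m w 0]: this correction is
   what makes the linearization injective, and it is shown to vanish in [closes]. *)
Definition shoot g (w : R -> 'cV[R]_N) : 'cV[R]_(N + 1) :=
  col_mx (w 1 - w 0 - Jm *m B *m B^T *m w 0) (H eps (g *m (z 0 + w 0)) - h)%:M.

Lemma col_mx_norm p q (a : 'cV[R]_p) (b : 'cV[R]_q) c :
  `|a| <= c -> `|b| <= c -> `|col_mx a b| <= c.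
Proof.
move=> ac bc; apply: cvnormP => [|i]; first exact: le_trans ac.
by rewrite mxE; case: splitP => j _; rewrite (le_trans (mxnorm_ge _ _ _)).
Qed.

Lemma scalar_mx11_norm (a : R) : `|a%:M : 'cV[R]_1| <= `|a|.
Proof. by apply: cvnormP => // i; rewrite !ord1 mxE eqxx mulr1n. Qed.

Lemma gTJ g : GG g -> g^T *m Jm = Jm *m g^T.
Proof.
move=> Gg; have gg : g *m g^T = 1%:M by apply: mulmx1C; exact: gorth.
by rewrite -[LHS]mulmx1 -gg mulmxA -(mulmxA _ Jm) gJ// !mulmxA gorth// mul1mx.
Qed.

Lemma dot_rotated g y v : GG g ->
  dot (Jm *m X eps (g *m y)) (g *m v) = dot (Jm *m Y g y) v.
Proof. by move=> Gg; rewrite dotC dot_mulmxl dotC mulmxA gTJ// mulmxA. Qed.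

Definition CE := 2 * CH * (Lam * Lam) + Lam * Lam * (LY + Lam).

Lemma energy_lin g rho a b : GG g -> `|a| <= rho -> `|b| <= rho -> del <= rho ->
  rho <= 2 * r ->
  `|H eps (g *m (z 0 + a)) - H eps (g *m (z 0 + b)) - dot (Jm *m X 0 (z 0)) (a - b)|
   <= CE * rho * `|a - b|.
Proof.
move=> Gg ar br dr rr; case: Ht => _ _ _ HH _.
have ar' := le_trans ar rr; have br' := le_trans br rr.
have rho0 : 0 <= rho by exact: le_trans ar.
have [H1] := HH eps 0 g _ _ (or_introl erefl) Gg (in_tube 0 Gg br') (in_tube 0 Gg ar').
have wr0 : `|0 : 'cV[R]_N| <= 2 * r by rewrite normr0; nonneg.
have H2 := Y_lip 0 Gg br' wr0; have H3 := Y_close 0 Gg wr0.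
rewrite subr0 addr0 in H2 H3.
move: H1; rewrite -mulmxBr opprD addrACA subrr add0r dot_rotated// => H1.
set v := a - b in H1 *.
have vr : `|v| <= 2 * rho by rewrite (le_trans (ler_normB _ _))//; move: ar br; lra.
rewrite -(subrK (dot (Jm *m Y g (z 0 + b)) v) (H eps _ - _)) -addrA -dotBl -mulmxBr.
rewrite (le_trans (ler_normD _ _))//.
have H4 : `|dot (Jm *m (Y g (z 0 + b) - X 0 (z 0))) v| <= Lam * (Lam * ((LY + Lam) * rho)) * `|v|.
  rewrite (le_trans (dot_norm _ _))// ler_wpM2r// ler_wpM2l// (le_trans (bJ _))// ler_wpM2l//.
  rewrite -(subrKA (Y g (z 0))) (le_trans (ler_normD _ _))// mulrDl lerD//.
    by rewrite (le_trans H2)// ler_wpM2l// LY_ge0.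
  by rewrite (le_trans H3)// ler_wpM2l.
have H5 : `|g *m v| ^+ 2 <= Lam * Lam * (2 * rho) * `|v|.
  rewrite expr2 (le_trans (ler_pM _ _ (bg _ Gg) (bg _ Gg)))// mulrACA.
  by rewrite -(mulrA _ (2 * rho)) ler_wpM2l// ?ler_wpM2r//; nonneg.
have H6 : CH * `|g *m v| ^+ 2 <= CH * (Lam * Lam * (2 * rho) * `|v|) by rewrite ler_pM2l.
rewrite (le_trans (lerD H1 H4))//; move: H6; rewrite /CE; lra.
Qed.

Lemma CE_ge0 : 0 <= CE.
Proof. by have := LY_ge0 => *; rewrite /CE; nonneg. Qed.

Definition C5 := C3 + CE.

Lemma shoot_lin (L : 'M[R]_(N + 1)) g u1 u2 w1 w2 rho :
  (forall u v, is_linear_sol u v -> L *m u = linear_shoot v) -> GG g ->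
  is_sol eps r g u1 w1 -> is_sol eps r g u2 w2 ->
  `|u1| <= rho -> `|u2| <= rho -> del <= rho -> rho <= r -> C1 * rho <= r ->
  `|shoot g w1 - shoot g w2 - L *m (u1 - u2)| <= C5 * (kap + rho) * `|u1 - u2|.
Proof.
move=> LE Gg S1 S2 ur1 ur2 dr rhor Cr.
have rho0 : 0 <= rho by exact: le_trans ur1.
have rho1 : rho <= 1 by exact: le_trans r1.
have [v Sv] := linear_sol_exists (u1 - u2).
rewrite (LE _ _ Sv) linear_shootE /shoot !opp_col_mx !add_col_mx.
have C30 := ltW C3_gt0. have CE0 := CE_ge0.
have v0 : v 0 = w1 0 - w2 0 by rewrite Sv.1 S1.1 S2.1 linearB.
apply: col_mx_norm.
  have := sol_lin Gg S1 S2 Sv ur1 ur2 dr rho1 Cr (t := 1); rewrite normr1 => /(_ (lexx _)).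
  have -> : w1 1 - w1 0 - Jm *m B *m B^T *m w1 0 -
   (w2 1 - w2 0 - Jm *m B *m B^T *m w2 0) - (v 1 - v 0 - Jm *m B *m B^T *m v 0) =
     w1 1 - w2 1 - v 1.
    rewrite v0 (mulmxBr _ (w1 0)); apply/matrixP => i j; rewrite !mxE; ring.
  move=> /le_trans; apply; rewrite ler_wpM2r// ler_wpM2r//; first by nonneg.
  by rewrite /C5 lerDl.
have -> : (H eps (g *m (z 0 + w1 0)) - h)%:M + (- (H eps (g *m (z 0 + w2 0)) - h)%:M) +
   (- (dot (Jm *m X 0 (z 0)) (v 0))%:M) = (H eps (g *m (z 0 + w1 0)) - H eps (g *m (z 0 + w2 0)) -
    dot (Jm *m X 0 (z 0)) (w1 0 - w2 0))%:M :> 'cV[R]_1.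
  by rewrite v0; apply/matrixP => i j; rewrite !ord1 !mxE eqxx !mulr1n; ring.
rewrite (le_trans (scalar_mx11_norm _))//.
have rho2 : rho <= 2 * r by rewrite (le_trans rhor)// ler_peMl// ?ltW// ltr1n.
have w1r : `|w1 0| <= rho by rewrite S1.1 (le_trans (usubmx_norm _)).
have w2r : `|w2 0| <= rho by rewrite S2.1 (le_trans (usubmx_norm _)).
rewrite (le_trans (energy_lin Gg w1r w2r dr rho2))//.
have -> : w1 0 - w2 0 = usubmx (u1 - u2) by rewrite S1.1 S2.1 linearB.
have H1 : CE * rho * `|usubmx (u1 - u2)| <= CE * rho * `|u1 - u2|.
  by rewrite ler_wpM2l ?usubmx_norm//; nonneg.
rewrite (le_trans H1)// ler_wpM2r// /C5.
have : 0 <= CE * kap + C3 * (kap + rho) by nonneg.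
lra.
Qed.

(** A simplified Newton iteration, with the derivative frozen at [L]: it contracts by 1/2 on the
    ball of radius [rho], and the residual at u = 0 is small enough for the ball to be preserved. *)
Lemma shoot_zero (L : 'M[R]_(N + 1)) Li rho : L \in unitmx ->
  (forall u v, is_linear_sol u v -> L *m u = linear_shoot v) ->
  0 < Li -> (forall x : 'cV[R]_(N + 1), `|invmx L *m x| <= Li * `|x|) ->
  0 < rho -> del <= rho -> rho <= r -> C1 * rho <= r ->
  Li * (C5 * (kap + rho)) <= 2^-1 -> Li * ((C1 + 1) * del) <= rho / 2 ->
  forall g, GG g -> exists u w, [/\ `|u| <= rho, is_sol eps r g u w & shoot g w = 0].
Proof.
move=> Lu LE Li0 HLi rho0 dr rhor Cr Hk Hd g Gg.
have /choice[W HW] : forall u, exists w, is_sol eps r g u w by move=> u; exact: sol_exists.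
pose P u := u - invmx L *m shoot g (W u).
have PB u1 u2 : `|u1| <= rho -> `|u2| <= rho -> `|P u1 - P u2| <= 2^-1 * `|u1 - u2|.
  move=> ur1 ur2.
  have -> : P u1 - P u2 = - (invmx L *m (shoot g (W u1) - shoot g (W u2) - L *m (u1 - u2))).
    rewrite mulmxBr mulKmx// mulmxBr /P; apply/matrixP => i j; rewrite !mxE; ring.
  rewrite normrN (le_trans (HLi _))//.
  have H1 := shoot_lin LE Gg (HW u1) (HW u2) ur1 ur2 dr rhor Cr.
  rewrite (le_trans (ler_wpM2l (ltW Li0) H1))// mulrA ler_wpM2r//.
have z0 : `|0 : 'cV[R]_(N + 1)| <= 0 by rewrite normr0.
have w0 : W 0 0 = 0 by rewrite (HW 0).1 linear0.
(* For u = 0 the arc starts on the unperturbed orbit, so the jump and the energy defect come from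
   the perturbation only; [sol_small] is used with radius [del]. *)
have S0 : `|shoot g (W 0)| <= (C1 + 1) * del.
  have rho1 : del <= 1 by exact: le_trans k1.
  have zd0 : `|0 : 'cV[R]_(N + 1)| <= del by rewrite normr0.
  have := sol_small Gg (HW 0) zd0 (lexx _) rho1 (t := 1); rewrite normr1 => /(_ (lexx _)) H1.
  case: Ht => _ _ _ _ /(_ g Gg) H2; have C10 := ltW C1_gt0.
  rewrite /shoot w0 mulmx0 addr0 !subr0; apply: col_mx_norm.
    by rewrite (le_trans H1)// ler_wpM2r// lerDl.
  by rewrite (le_trans (scalar_mx11_norm _))// (le_trans H2)// mulrDl mul1r lerDr; nonneg.
pose U : set 'cV[R]_(N + 1) := [set u | `|u| <= rho].
have PU : set_fun U U P.
  move=> u /= ur; rewrite /U/=.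
  have H0 : `|P 0| <= rho / 2.
    rewrite /P sub0r normrN (le_trans (HLi _))//.
    exact: le_trans (ler_wpM2l (ltW Li0) S0) Hd.
  have H1 : `|P u - P 0| <= rho / 2.
    have := PB u 0 ur; rewrite normr0 subr0 => /(_ (ltW rho0)) /le_trans; apply.
    by rewrite mulrC ler_pM2r// invr_gt0.
  rewrite -(subrK (P 0) (P u)) (le_trans (ler_normD _ _))// (splitr rho).
  exact: lerD.
pose PF : {fun U >-> U} := mkfun_fun PU.
have q0 : 0 <= (2^-1 : R) by rewrite invr_ge0.
have PC : is_contraction PF.
  exists (NngNum q0); split; first by rewrite /= invf_lt1// ltr1n.
  by move=> [x y] [/= xU yU]; exact: PB.
have UC : closed U.
  have -> : U = (fun x => `|x|) @^-1` [set x : R | x <= rho] by [].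
  apply: closed_comp; last exact: closed_le.
  by move=> x _; exact: norm_continuous.
have [|u ur /= uE] := @banach_fixed_point R _ U PF PC UC.
  by exists 0; rewrite /U/= normr0 ltW.
exists u, (W u); split => //.
have : invmx L *m shoot g (W u) = 0.
  have : P u = u by rewrite {2}uE.
  by rewrite /P => /eqP; rewrite subr_eq addrC -subr_eq subrr => /eqP <-.
by move=> E; rewrite -(mulKVmx Lu (shoot g (W u))) E mulmx0.
Qed.

Definition C7 := C2 + (2 * CH * (Lam * (Lam + 1)) * (Lam * (Lam + 1)) +
  Lam * Lam * (Lam * (Lam + 1))).

Lemma C7_gt0 : 0 < C7.
Proof. by rewrite ltr_pwDl ?C2_gt0//; nonneg. Qed.

(** For the energy component, [H 0] takes equal values at both points, so its Taylor estimate makes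
    <J X_0, v> quadratic in [v]; passing from [X 0] to [X eps] costs [kap]. The assumption
    [|g1 - g2| <= kap] turns the squares into [kap * |g1 - g2|]. *)
Lemma shoot_rot g1 g2 u w1 w2 rho : GG g1 -> GG g2 ->
  is_sol eps r g1 u w1 -> is_sol eps r g2 u w2 ->
  `|u| <= rho -> del <= rho -> rho <= r -> C1 * rho <= r ->
  Lam * `|g1 - g2| <= r -> `|g1 - g2| <= kap ->
  `|shoot g1 w1 - shoot g2 w2| <= C7 * (kap * `|g1 - g2|).
Proof.
move=> G1 G2 S1 S2 ur dr rhor Cr gr gk.
have rho0 : 0 <= rho by exact: le_trans ur.
have rho1 : rho <= 1 by exact: le_trans r1.
have C20 := ltW C2_gt0.
rewrite /shoot opp_col_mx add_col_mx S1.1 S2.1.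
set zeta := usubmx u.
have zr : `|zeta| <= r by rewrite (le_trans (usubmx_norm _))// (le_trans ur).
have zr2 : `|zeta| <= 2 * r by rewrite (le_trans zr)// ler_peMl// ?ltW// ltr1n.
apply: col_mx_norm.
  have := sol_lip G1 G2 S1 S2 ur ur dr rho1 Cr gr (t := 1).
  rewrite normr1 subrr normr0 add0r => /(_ (lexx _)) H1.
  rewrite (_ : _ - _ = w1 1 - w2 1); last by apply/matrixP => i j; rewrite !mxE; ring.
  by rewrite (le_trans H1)// ler_wpM2r ?lerDl; nonneg.
set y := z 0 + zeta.
have -> : (H eps (g1 *m y) - h)%:M + - (H eps (g2 *m y) - h)%:M =
    (H eps (g1 *m y) - H eps (g2 *m y))%:M :> 'cV[R]_1.
  by apply/matrixP => i j; rewrite !ord1 !mxE eqxx !mulr1n; ring.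
rewrite (le_trans (scalar_mx11_norm _))//.
have gr' : Lam * `|g2 - g1| <= r by rewrite distrC.
case: Ht => _ _ HD HH _.
have I2 := in_tube 0 G2 zr2; have I1 := g_close 0 G2 G1 gr' zr.
have E1 := HH eps 0 g2 _ _ (or_introl erefl) G2 I2 I1.
have E2 := HH 0 0 g2 _ _ (or_intror erefl) G2 I2 I1.
have [_ E3] := HD 0 g2 _ _ G2 I2 I2.
rewrite !gH// subrr -/y -mulmxBl in E1 E2 E3 *.
set v := (g1 - g2) *m y in E1 E2 *; set dg := `|g1 - g2| in gk *.
have dg0 : 0 <= dg by exact: normr_ge0.
have vE : `|v| <= Lam * (Lam + 1) * dg.
  rewrite (le_trans (mulmx_normL _ _))// mulrAC ler_wpM2r// ler_wpM2l//.
  by rewrite (le_trans (ler_normD _ _))// lerD// (le_trans zr).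
have E4 : `|dot (Jm *m (X eps (g2 *m y) - X 0 (g2 *m y))) v| <= Lam * (Lam * kap) * `|v|.
  rewrite (le_trans (dot_norm _ _))// ler_wpM2r// ler_wpM2l// (le_trans (bJ _))//.
  by rewrite ler_wpM2l// (le_trans E3).
rewrite mulmxBr dotBl in E4.
set A := H eps _ - _ in E1 *; set P := dot _ v in E1 E4; set Q := dot _ v in E2 E4.
have E5 : `|A| <= `|A - P| + `|P - Q| + `|0 - Q|.
  rewrite [X in `|X| <= _](_ : A = (A - P) + (P - Q) - (0 - Q)); last by ring.
  by rewrite (le_trans (ler_normB _ _))// lerD2r ler_normD.
have E6 : CH * `|v| ^+ 2 <= CH * (Lam * (Lam + 1) * (Lam * (Lam + 1)) * (kap * dg)).
  rewrite ler_wpM2l ?(ltW CH0)// expr2 (le_trans (ler_pM _ _ vE vE))// mulrACA.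
  by rewrite ler_wpM2l ?ler_wpM2r; nonneg.
have E7 : Lam * (Lam * kap) * `|v| <= Lam * (Lam * kap) * (Lam * (Lam + 1) * dg).
  by rewrite ler_wpM2l; nonneg.
have E8 : 0 <= C2 * (kap * dg) by nonneg.
rewrite (le_trans E5)//; move: E1 E2 E4 E6 E7 E8; rewrite /C7; lra.
Qed.

(** * Dependence of the arcs on the rotation, and the action *)

Section Orbits.
Variables (L : 'M[R]_(N + 1)) (Li rho : R).
Hypothesis Lu : L \in unitmx.
Hypothesis LE : forall u v, is_linear_sol u v -> L *m u = linear_shoot v.
Hypothesis Li0 : 0 < Li.
Hypothesis HLi : forall x : 'cV[R]_(N + 1), `|invmx L *m x| <= Li * `|x|.
Hypothesis rho0 : 0 < rho.
Hypothesis dr : del <= rho.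
Hypothesis rhor : rho <= r.
Hypothesis Cr : C1 * rho <= r.
Hypothesis Hk : Li * (C5 * (kap + rho)) <= 2^-1.

Let rho1 : rho <= 1. Proof. exact: le_trans r1. Qed.

Definition is_zero g u w := [/\ `|u| <= rho, is_sol eps r g u w & shoot g w = 0].

Definition C8 := 2 * (Li * C7).

Lemma C8_ge0 : 0 <= C8.
Proof. by have := C7_gt0 => *; rewrite /C8; nonneg. Qed.

(** The first zero is compared with the solution [w] that has rotation [g1] but the parameters of
    the second zero; [Hk] absorbs half of the resulting difference. With [g1 = g2] the bound is
    uniqueness, and in general it is the substitute for differentiability in [g]. *)
Lemma zero_rot g1 g2 u1 u2 w1 w2 : GG g1 -> GG g2 -> is_zero g1 u1 w1 -> is_zero g2 u2 w2 ->
  Lam * `|g1 - g2| <= r -> `|g1 - g2| <= kap -> `|u1 - u2| <= C8 * (kap * `|g1 - g2|).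
Proof.
move=> G1 G2 [ur1 S1 Z1] [ur2 S2 Z2] gr gk.
have [w S12] := sol_exists u2 G1.
have H1 := shoot_lin LE G1 S1 S12 ur1 ur2 dr rhor Cr.
have H2 := shoot_rot G1 G2 S12 S2 ur2 dr rhor Cr gr gk.
rewrite Z1 sub0r in H1; rewrite Z2 subr0 in H2.
have H3 : `|L *m (u1 - u2)| <= C5 * (kap + rho) * `|u1 - u2| + C7 * (kap * `|g1 - g2|).
  rewrite (_ : L *m (u1 - u2) = - (- shoot g1 w - L *m (u1 - u2)) - shoot g1 w).
    by rewrite (le_trans (ler_normB _ _))// normrN lerD.
  by rewrite opprB opprK addrK.
have H4 := HLi (L *m (u1 - u2)); rewrite mulKmx// in H4.
have H5 := ler_wpM2l (ltW Li0) H3.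
have H6 : Li * (C5 * (kap + rho)) * `|u1 - u2| <= 2^-1 * `|u1 - u2| by rewrite ler_wpM2r.
move: H4 H5 H6; rewrite /C8; lra.
Qed.

Definition C9 := C2 * (C8 + 1).

Lemma C9_ge0 : 0 <= C9.
Proof. by have := C2_gt0; have := C8_ge0 => *; rewrite /C9; nonneg. Qed.

Lemma zero_sol_rot g1 g2 u1 u2 w1 w2 t : GG g1 -> GG g2 ->
  is_zero g1 u1 w1 -> is_zero g2 u2 w2 ->
  Lam * `|g1 - g2| <= r -> `|g1 - g2| <= kap -> `|t| <= 1 ->
  `|w1 t - w2 t| <= C9 * (kap * `|g1 - g2|).
Proof.
move=> G1 G2 Z1 Z2 gr gk t1.
have H1 := zero_rot G1 G2 Z1 Z2 gr gk.
case: Z1 Z2 => [ur1 S1 _] [ur2 S2 _].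
rewrite (le_trans (sol_lip G1 G2 S1 S2 ur1 ur2 dr rho1 Cr gr t1))//.
rewrite /C9 -mulrA ler_wpM2l ?(ltW C2_gt0)// mulrDl mul1r lerD//.
Qed.

Definition orb (g : 'M[R]_N) (w : R -> 'cV[R]_N) t := g *m (z t + w t).

Lemma zero_clip g u w t : GG g -> is_zero g u w -> `|t| <= 1 ->
  `|w t| <= r /\ clip r (w t) = w t.
Proof. by move=> Gg [ur S _] t1; exact: clip_sol S ur dr rho1 Cr t1. Qed.

Lemma ggT g : GG g -> g *m g^T = 1%:M.
Proof. by move=> Gg; apply: mulmx1C; exact: gorth. Qed.

Lemma orb_derive_clip g u w (t : R) : is_sol eps r g u w ->
  is_derive t 1 (orb g w) (g *m (Ts *: X 0 (z t) + shooting_field eps r g u t (w t))).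
Proof. by move=> S; apply: is_derive_mulmxl; exact: is_derive_addf (zd t) (S.2 t). Qed.

Lemma orb_fieldE g u w t : GG g -> clip r (w t) = w t ->
  g *m (Ts *: X 0 (z t) + shooting_field eps r g u t (w t)) = (Ts + tau u) *: X eps (orb g w t).
Proof.
move=> Gg cw; rewrite /shooting_field cw addrC subrK /rotated_field -scalemxAr mulmxA.
by rewrite ggT// mul1mx.
Qed.

Lemma orb_derive g u w (t : R) : GG g -> is_zero g u w -> `|t| <= 1 ->
  is_derive t 1 (orb g w) ((Ts + tau u) *: X eps (orb g w t)).
Proof.
move=> Gg Z t1; have [_ cw] := zero_clip Gg Z t1; case: Z => [_ S _].
by rewrite -(orb_fieldE u Gg cw); exact: orb_derive_clip.
Qed.

Lemma dotJ_sym (u v : 'cV[R]_N) : dot (Jm *m u) v = - dot (Jm *m v) u.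
Proof. by rewrite dot_mulmxl JT mulNmx dotNr dotC. Qed.

Lemma dotJJ (u v : 'cV[R]_N) : dot (Jm *m u) (Jm *m v) = dot u v.
Proof. by rewrite dot_mulmxl mulmxA JT mulNmx JJ opprK mul1mx. Qed.

Lemma dotJ_self (u : 'cV[R]_N) : dot (Jm *m u) u = 0.
Proof. by have := dotJ_sym u u; lra. Qed.

(** The identity <J X, X> = 0 annihilates the derivative of the energy along the arc, which exists
    by [is_derive_quadratic]. Times are restricted to [0, 1], where the truncation is inactive. *)
Lemma orb_energy g u w t : GG g -> is_zero g u w -> 0 <= t <= 1 -> H eps (orb g w t) = h.
Proof.
move=> Gg Z /andP[t0 t1].
have H0 : H eps (orb g w 0) = h.
  case: Z => [_ _]; rewrite /shoot => /(congr1 dsubmx); rewrite col_mxKd linear0.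
  by move=> /matrixP /(_ 0 0); rewrite !mxE eqxx mulr1n => /eqP; rewrite subr_eq0 => /eqP.
have D s : 0 <= s <= t -> is_derive (s : R) 1 (fun x => H eps (orb g w x)) 0.
  move=> /andP[s0 st]; have s1 : `|s| <= 1 by rewrite ger0_norm// (le_trans st).
  have [wr cw] := zero_clip Gg Z s1.
  have od := orb_derive Gg Z s1.
  have := is_derive_continuous od; move=> /cvgrPdist_le /(_ (Lam * r)).
  rewrite mulr_gt0 ?Lam0// => /(_ isT) /near_normP[d d0' Hd].
  have -> : 0 = dot (Jm *m X eps (orb g w s)) ((Ts + tau u) *: X eps (orb g w s)).
    by rewrite dotZr dotJ_self mulr0.
  have I0 : `|orb g w s - g *m z s| <= Lam * r.
    by rewrite -mulmxBr addrAC subrr add0r (le_trans (bg _ Gg))// ler_wpM2l.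
  apply: (@is_derive_quadratic _ _ (orb g w) _ _ _ CH d) => // x xs.
  case: Ht => _ _ _ HH _; apply: (HH eps s g) => //; first by left.
    by rewrite (le_trans I0)// -mulrA ler_peMl// ?ler1n//; nonneg.
  rewrite -(subrKA (orb g w s)) (le_trans (ler_normD _ _))// -mulrA mulr_natl mulr2n.
  by rewrite lerD// distrC Hd.
pose F x : 'M[R]_1 := (H eps (orb g w x))%:M.
have : F 0 = F t.
  apply: zero_derive_const => // s st; apply/is_derive_mxP => i j.
  rewrite !ord1 mxE; apply: is_derive_ext (D s st) => // x.
  by rewrite /F mxE eqxx mulr1n.
by move=> /matrixP /(_ 0 0); rewrite !mxE eqxx !mulr1n -H0.
Qed.

Definition is_action g u w (a : R -> R) :=
  a 0 = 0 /\ forall t : R, `|t| <= 1 ->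
    is_derive t 1 a (dot (Jm *m ((Ts + tau u) *: X eps (orb g w t))) (orb g w t)).

(** [primitive] asks for a globally continuous integrand, so the velocity of the truncated equation
    is integrated; it agrees with the true one for times in [-1, 1]. *)
Lemma action_exists g u w : GG g -> is_zero g u w -> exists a, is_action g u w a.
Proof.
move=> Gg Z; have [_ S _] := Z.
pose dy t := g *m (Ts *: X 0 (z t) + shooting_field eps r g u t (w t)).
have cw : continuous w by move=> t; exact: is_derive_continuous (S.2 t).
have cf : continuous (fun t => shooting_field eps r g u t (w t)).
  apply: (continuous_along (K := `|Ts + tau u| * LY + 1)) => //.
  - by rewrite ltr_wpDl// mulr_ge0// LY_ge0.
  - by move=> x; exact: continuous_shooting_field.
  - by move=> t x y; exact: shooting_lip.
have cmul (A : 'M[R]_N) (v : R -> 'cV[R]_N) : continuous v -> continuous (fun t => A *m v t).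
  move=> cv t; apply: continuous_mxP => i j.
  have -> : (fun x => (A *m v x) i j) = (fun x => dot (row i A)^T (v x)).
    by apply/funext => x; rewrite dotE trmxK -row_mul !mxE ord1.
  by apply: continuous_dot; [exact: cvg_cst|exact: cv].
have cdy : continuous dy.
  apply: cmul => t; apply: cvgD; last exact: cf.
  by apply: cvgZ; [exact: cvg_cst|exact: continuous_X0z].
have co : continuous (orb g w).
  by move=> t; exact: is_derive_continuous (orb_derive_clip t S).
have [a a0 Ha] := @primitive R (fun t => dot (Jm *m dy t) (orb g w t))
  (fun t => continuous_dot (cmul Jm dy cdy t) (co t)).
exists a; split=> // t t1; have [_ cwt] := zero_clip Gg Z t1.
by rewrite -(orb_fieldE u Gg cwt); exact: Ha.
Qed.

(** For an arc y the integral of <J y', y> has boundary terms in its first variation. Adding <J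
    y(0), y(1)> turns them into the pairing of J (v(0) + v(1)) with the jump y(1) - y(0), and
    changes nothing on closed arcs. *)
Definition action_value g (w : R -> 'cV[R]_N) (a : R -> R) :=
  (a 1 + dot (Jm *m orb g w 0) (orb g w 1)) / 2.

Lemma orb_diff g1 g2 u1 u2 w1 w2 t : GG g1 -> GG g2 ->
  is_zero g1 u1 w1 -> is_zero g2 u2 w2 ->
  Lam * `|g1 - g2| <= r -> `|g1 - g2| <= kap -> `|t| <= 1 ->
  `|orb g1 w1 t - orb g2 w2 t| <= (2 * (Lam * Lam) + Lam * C9) * `|g1 - g2|.
Proof.
move=> G1 G2 Z1 Z2 gr gk t1.
have H1 := zero_sol_rot G1 G2 Z1 Z2 gr gk t1.
have [wr1 _] := zero_clip G1 Z1 t1.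
have -> : orb g1 w1 t - orb g2 w2 t = (g1 - g2) *m (z t + w1 t) + g2 *m (w1 t - w2 t).
  by rewrite /orb mulmx_telescope opprD addrACA subrr add0r.
rewrite (le_trans (ler_normD _ _))// mulrDl lerD//.
  rewrite (le_trans (mulmx_normL _ _))// mulrAC -mulrA mulrCA mulrA ler_wpM2r//.
  rewrite [leRHS]mulrA ler_wpM2r// (le_trans (ler_normD _ _))//.
  by have := bz t; move: wr1 r1 Lam1; lra.
rewrite (le_trans (bg _ G2))// -mulrA ler_wpM2l// (le_trans H1)// ler_wpM2l ?C9_ge0//.
by rewrite ler_piMl.
Qed.

Lemma orb_field_diff g1 g2 u1 u2 w1 w2 t : GG g1 -> GG g2 ->
  is_zero g1 u1 w1 -> is_zero g2 u2 w2 ->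
  Lam * `|g1 - g2| <= r -> `|g1 - g2| <= kap -> `|t| <= 1 ->
  `|(Ts + tau u1) *: X eps (orb g1 w1 t) - (Ts + tau u2) *: X eps (orb g2 w2 t)| <=
   (C8 * (Lam * (BY + LY)) + 2 * Lam * (Lam * (BY + LY) + Lam * ((LG + Lam + 1) * C9 + LG)))
   * `|g1 - g2|.
Proof.
move=> G1 G2 Z1 Z2 gr gk t1.
have H1 := zero_sol_rot G1 G2 Z1 Z2 gr gk t1.
have H2 := zero_rot G1 G2 Z1 Z2 gr gk.
have [wr1 _] := zero_clip G1 Z1 t1; have [wr2 _] := zero_clip G2 Z2 t1.
have a1 := LG_ge0; have a2 := LY_ge0; have a3 := BY_ge0; have a4 := C8_ge0; have a5 := C9_ge0.
have H3 := Y_rot_lip t G1 G2 gr wr1 wr2.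
have HT : `|Ts + tau u2| <= 2 * Lam by case: Z2 => [ur2 _ _]; exact: period_bound ur2 rho1.
have XE g w : GG g -> X eps (orb g w t) = g *m Y g (z t + w t).
  by move=> Gg; rewrite /rotated_field mulmxA ggT// mul1mx.
set Y1 := Y g1 (z t + w1 t) in H3; set Y2 := Y g2 (z t + w2 t) in H3.
have HY1 : `|Y1| <= BY + LY.
  by apply: Y_bound => //; rewrite (le_trans wr1)// ler_peMl// ?ltW// ltr1n.
set dg := `|g1 - g2| in gk H1 H2 H3 *.
have dg0 : 0 <= dg by exact: normr_ge0.
have kd : kap * dg <= dg by rewrite ler_piMl.
have -> : (Ts + tau u1) *: X eps (orb g1 w1 t) - (Ts + tau u2) *: X eps (orb g2 w2 t) =
   tau (u1 - u2) *: (g1 *m Y1) + (Ts + tau u2) *: ((g1 - g2) *m Y1 + g2 *m (Y1 - Y2)).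
  rewrite !XE// -/Y1 -/Y2 -mulmx_telescope tauB.
  move: (g1 *m Y1) (g2 *m Y2) (tau u1) (tau u2) => p1 p2 t1' t2'.
  by apply/matrixP => i j; rewrite !mxE; ring.
rewrite (le_trans (ler_normD _ _))// mulrDl lerD//.
  rewrite normrZ mulrAC ler_pM//.
    by rewrite (le_trans (tau_norm _))// (le_trans H2)// ler_wpM2l.
  by rewrite (le_trans (bg _ G1))// ler_wpM2l.
rewrite normrZ -[leRHS]mulrA ler_pM// (le_trans (ler_normD _ _))// mulrDl lerD//.
  by rewrite (le_trans (mulmx_normL _ _))// mulrAC ler_wpM2r// ler_wpM2l.
rewrite (le_trans (bg _ G2))// -mulrA ler_wpM2l// (le_trans H3)// [leRHS]mulrDl lerD//.
  rewrite -mulrA ler_wpM2l//; first by nonneg.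
  by rewrite (le_trans H1)// ler_wpM2l.
by rewrite -mulrA ler_wpM2l.
Qed.

(* The action is differentiable along the family of zeros with a differential that only
   sees the jump [w 1 - w 0], because the arcs are critical for fixed endpoints. *)
Lemma action_compare : exists2 C, 0 <= C & forall g1 g2 u1 u2 w1 w2 a1 a2,
  GG g1 -> GG g2 -> is_zero g1 u1 w1 -> is_zero g2 u2 w2 ->
  is_action g1 u1 w1 a1 -> is_action g2 u2 w2 a2 ->
  Lam * `|g1 - g2| <= r -> `|g1 - g2| <= kap ->
  `|action_value g1 w1 a1 - action_value g2 w2 a2 -
    dot (Jm *m ((orb g1 w1 0 - orb g2 w2 0) + (orb g1 w1 1 - orb g2 w2 1)))
        (orb g2 w2 1 - orb g2 w2 0) / 2| <= C * `|g1 - g2| ^+ 2.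
Proof.
pose Cv := 2 * (Lam * Lam) + Lam * C9.
pose Cf := C8 * (Lam * (BY + LY)) + 2 * Lam * (Lam * (BY + LY) + Lam * ((LG + Lam + 1) * C9 + LG)).
have b1 := LG_ge0; have b2 := LY_ge0; have b3 := BY_ge0; have b4 := C8_ge0; have b5 := C9_ge0.
have Cv0 : 0 <= Cv by rewrite /Cv; nonneg.
have Cf0 : 0 <= Cf by rewrite /Cf; nonneg.
exists (4 * Lam * CH * Cv ^+ 2 + Lam * (Lam * Cf) * Cv + Lam * (Lam * Cv) * Cv).
  by rewrite expr2; have := ltW CH0 => *; nonneg.
move=> g1 g2 u1 u2 w1 w2 a1 a2 G1 G2 Z1 Z2 A1 A2 gr gk.
set dg := `|g1 - g2|.
have dg0 : 0 <= dg by exact: normr_ge0.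
pose y1 := orb g1 w1; pose y2 := orb g2 w2; pose v t := y1 t - y2 t.
pose f1 t := (Ts + tau u1) *: X eps (y1 t); pose f2 t := (Ts + tau u2) *: X eps (y2 t).
have vE t : `|t| <= 1 -> `|v t| <= Cv * dg by move=> t1; exact: orb_diff Z1 Z2 gr gk t1.
have fE t : `|t| <= 1 -> `|f1 t - f2 t| <= Cf * dg.
  by move=> t1; exact: orb_field_diff Z1 Z2 gr gk t1.
have D1 t : `|t| <= 1 -> is_derive (t : R) 1 y1 (f1 t) by move=> t1; exact: orb_derive Z1 t1.
have D2 t : `|t| <= 1 -> is_derive (t : R) 1 y2 (f2 t) by move=> t1; exact: orb_derive Z2 t1.
(* Subtracting this product integrates by parts: the derivative of [v] then occurs in the derivative
   of [q] only in a term of second order. *)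
pose q t := a1 t - a2 t - dot (Jm *m v t) (y2 t).
have qd t : 0 <= t <= 1 -> is_derive (t : R) 1 q (2 * dot (Jm *m f2 t) (v t) + dot (Jm *m (f1 t - f2 t)) (v t)).
  move=> /andP[t0 t1']; have t1 : `|t| <= 1 by rewrite ger0_norm.
  have Dv := is_derive_mulmxl Jm (is_derive_subf (D1 t t1) (D2 t t1)).
  apply: is_derive_ext (is_derive_subf (is_derive_subf (A1.2 t t1) (A2.2 t t1))
    (is_derive_dot Dv (D2 t t1))) => //.
  rewrite -/(y1 t) -/(y2 t) -/(f1 t) -/(f2 t) -/(v t).
  have -> : dot (Jm *m v t) (f2 t) = - dot (Jm *m f2 t) (v t) by rewrite dotJ_sym.
  have -> : y1 t = y2 t + v t by rewrite addrC subrK.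
  by rewrite !mulmxBr !dotBl !dotDr; ring.
have qB t : 0 <= t <= 1 -> `|2 * dot (Jm *m f2 t) (v t) + dot (Jm *m (f1 t - f2 t)) (v t)| <=
    (4 * Lam * CH * Cv ^+ 2 + Lam * (Lam * Cf) * Cv) * dg ^+ 2.
  move=> t01; have /andP[t0 t1'] := t01; have t1 : `|t| <= 1 by rewrite ger0_norm.
  have HT : `|Ts + tau u2| <= 2 * Lam by case: Z2 => [ur2 _ _]; exact: period_bound ur2 rho1.
  have [wr1 _] := zero_clip G1 Z1 t1; have [wr2 _] := zero_clip G2 Z2 t1.
  have wr2' : `|w2 t| <= 2 * r by rewrite (le_trans wr2)// ler_peMl// ?ltW// ltr1n.
  have gr' : Lam * `|g2 - g1| <= r by rewrite distrC.
  have I2 := in_tube t G2 wr2'; have I1 := g_close t G2 G1 gr' wr1.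
  (* Both arcs lie on the level [h], so the Taylor estimate leaves a first-order term of second
     order in [dg]. Hence the unprescribed period does not contribute to the first variation. *)
  have E1 : `|dot (Jm *m X eps (y2 t)) (v t)| <= CH * `|v t| ^+ 2.
    case: Ht => _ _ _ HH _.
    have := HH eps t g2 _ _ (or_introl erefl) G2 I2 I1.
    rewrite -/(orb g1 w1 t) -/(orb g2 w2 t) (orb_energy G1 Z1 t01) (orb_energy G2 Z2 t01).
    by rewrite subrr sub0r normrN.
  have E2 : `|v t| ^+ 2 <= Cv ^+ 2 * dg ^+ 2.
    by rewrite -exprMn lerXn2r// ?nnegrE// ?vE//; nonneg.
  have E3 : CH * `|v t| ^+ 2 <= CH * (Cv ^+ 2 * dg ^+ 2) by rewrite ler_pM2l.
  have E4 : `|dot (Jm *m f2 t) (v t)| <= 2 * Lam * (CH * (Cv ^+ 2 * dg ^+ 2)).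
    by rewrite /f2 -scalemxAr dotZl normrM ler_pM// (le_trans E1).
  have E5 : `|dot (Jm *m (f1 t - f2 t)) (v t)| <= Lam * (Lam * (Cf * dg)) * (Cv * dg).
    rewrite (le_trans (dot_norm _ _))// ler_pM ?vE//; first by nonneg.
    by rewrite ler_wpM2l// (le_trans (bJ _))// ler_wpM2l// fE.
  rewrite (le_trans (ler_normD _ _))// normrM ger0_norm//; move: E4 E5; lra.
have qI : `|q 1 - q 0| <= (4 * Lam * CH * Cv ^+ 2 + Lam * (Lam * Cf) * Cv) * dg ^+ 2.
  set M := _ * dg ^+ 2.
  have -> : M = M * 1 - M * 0 by rewrite mulr0 subr0 mulr1.
  apply: (@dominated_increment R q (fun t => M * t) (fun t => 2 * dot (Jm *m f2 t) (v t) + dot (Jm *m (f1 t - f2 t)) (v t)) (fun=> M)) => //.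
  move=> t _; have := is_derive_scalef M (is_derive_id t (1 : R)).
  by rewrite [M *: 1]mulr1.
have v01 : `|dot (Jm *m v 0) (v 1)| <= Lam * (Lam * Cv) * Cv * dg ^+ 2.
  have H0 : `|v 0| <= Cv * dg by apply: vE; rewrite normr0.
  have H1 : `|v 1| <= Cv * dg by apply: vE; rewrite normr1.
  apply: (@le_trans _ _ (Lam * (Lam * (Cv * dg)) * (Cv * dg))).
    rewrite (le_trans (dot_norm _ _))// ler_pM//; first by nonneg.
    by rewrite ler_wpM2l// (le_trans (bJ _))// ler_wpM2l.
  by rewrite le_eqVlt; apply/orP; left; apply/eqP; ring.
have -> : action_value g1 w1 a1 - action_value g2 w2 a2 -
    dot (Jm *m ((orb g1 w1 0 - orb g2 w2 0) + (orb g1 w1 1 - orb g2 w2 1)))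
        (orb g2 w2 1 - orb g2 w2 0) / 2 = ((q 1 - q 0) + dot (Jm *m v 0) (v 1)) / 2.
  rewrite /action_value /q A1.1 A2.1 -/(y1 0) -/(y2 0) -/(y1 1) -/(y2 1) -/(v 0) -/(v 1).
  have -> : y1 0 = y2 0 + v 0 by rewrite addrC subrK.
  have -> : y1 1 = y2 1 + v 1 by rewrite addrC subrK.
  move: (v 0) (v 1) (y2 0) (y2 1) => p0 p1 q0 q1.
  by rewrite !mulmxDr !dotDl !dotBr !dotDr (dotJ_sym q0 p1); field.
rewrite normrM [`|2^-1|]ger0_norm ?invr_ge0//.
have := ler_normD (q 1 - q 0) (dot (Jm *m v 0) (v 1)).
have : 0 <= `|q 1 - q 0 + dot (Jm *m v 0) (v 1)| by exact: normr_ge0.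
move: qI v01; lra.
Qed.

Hypothesis Hd : Li * ((C1 + 1) * del) <= rho / 2.

Lemma zJ (a b : 'cV[R]_N) g : GG g -> dot (Jm *m (g *m a)) (g *m b) = dot (Jm *m a) b.
Proof.
by move=> Gg; rewrite mulmxA gJ// -mulmxA dot_mulmxl mulmxA gorth// mul1mx.
Qed.

Definition generator (Xi : 'M[R]_N) (Rc : R -> 'M[R]_N) (Ce : R) :=
  [/\ 0 <= Ce, (forall g s, GG g -> GG (g *m Rc s)) &
      (forall s, `|s| <= 1 -> `|Rc s - 1%:M - s *: Xi| <= Ce * s ^+ 2)].

(** [action_compare] makes the action locally Lipschitz in [g], hence continuous on the compact set
    [GG], where it attains its maximum. *)
Lemma maximal_action : exists (us : 'M[R]_N -> 'cV[R]_(N + 1)) (ws : 'M[R]_N -> R -> 'cV[R]_N)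
    (acs : 'M[R]_N -> R -> R) (g0 : 'M[R]_N),
  [/\ (forall g, GG g -> is_zero g (us g) (ws g) /\ is_action g (us g) (ws g) (acs g)),
      GG g0 &
      forall g, GG g -> action_value g (ws g) (acs g) <= action_value g0 (ws g0) (acs g0)].
Proof.
have /choice[F HF] : forall g, exists p : 'cV[R]_(N + 1) * (R -> 'cV[R]_N) * (R -> R),
    GG g -> is_zero g p.1.1 p.1.2 /\ is_action g p.1.1 p.1.2 p.2.
  (* Outside [GG] an arbitrary triple serves as default; it is never inspected. *)
  move=> g; have [Gg|nG] := pselect (GG g); last by exists (0, z, fun=> 0).
  have [u [w [ur S Z]]] := shoot_zero Lu LE Li0 HLi rho0 dr rhor Cr Hk Hd Gg.
  have Zg : is_zero g u w by split.
  have [a Ha] := action_exists Gg Zg.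
  by exists (u, w, a).
have [C C0 HC] := action_compare.
pose val g := action_value g (F g).1.2 (F g).2.
have cval : {within GG, continuous val}.
  apply/subspace_continuousP => g0 G0; apply/cvgrPdist_le => e e0.
  have [Z0 A0] := HF _ G0.
  pose Dl := orb g0 (F g0).1.2 1 - orb g0 (F g0).1.2 0.
  pose Cv := 2 * (Lam * Lam) + Lam * C9.
  have Cv0 : 0 <= Cv by have := C9_ge0 => *; rewrite /Cv; nonneg.
  pose K := C + Lam * (Lam * (2 * Cv)) * `|Dl| / 2 + 1.
  have K0 : 0 < K by rewrite /K ltr_wpDl//; nonneg; rewrite invr_ge0.
  have Nb d : 0 < d -> \forall g \near g0, `|g - g0| <= d.
    by move=> d0'; apply/near_normP; exists d => // y /ltW.
  near=> g.
  have dgr : Lam * `|g - g0| <= r.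
    rewrite mulrC -ler_pdivlMr ?Lam0//; near: g; apply: cvg_within; apply: Nb.
    by rewrite divr_gt0// Lam0.
  have dgk : `|g - g0| <= kap by near: g; apply: cvg_within; exact: Nb.
  have dge : `|g - g0| <= e / K.
    by near: g; apply: cvg_within; apply: Nb; rewrite divr_gt0.
  have Gg : GG g by near: g; exact: withinT.
  have [Z1 A1] := HF _ Gg.
  have := HC _ _ _ _ _ _ _ _ Gg G0 Z1 Z0 A1 A0 dgr dgk.
  rewrite -/(val g) -/(val g0) -/Dl; set dg := `|g - g0| in dgr dgk dge *.
  set v0 := orb g _ 0 - _; set v1 := orb g _ 1 - _.
  have H0 : `|v0| <= Cv * dg by apply: orb_diff Z1 Z0 dgr dgk _ => //; rewrite normr0.
  have H1 : `|v1| <= Cv * dg by apply: orb_diff Z1 Z0 dgr dgk _ => //; rewrite normr1.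
  have dg0 : 0 <= dg by exact: normr_ge0.
  have H2 : `|dot (Jm *m (v0 + v1)) Dl| <= Lam * (Lam * (2 * Cv * dg)) * `|Dl|.
    rewrite (le_trans (dot_norm _ _))// ler_wpM2r// ler_wpM2l// (le_trans (bJ _))//.
    rewrite ler_wpM2l// (le_trans (ler_normD _ _))//; move: H0 H1; lra.
  move=> H3.
  have H4 : C * dg ^+ 2 <= C * dg.
    by rewrite ler_wpM2l// expr2 ler_piMl// (le_trans dgk).
  rewrite distrC.
  have H5 : `|val g - val g0| <= K * dg.
    rewrite -(subrK (dot (Jm *m (v0 + v1)) Dl / 2) (val g - val g0)).
    rewrite (le_trans (ler_normD _ _))// normrM [`|2^-1|]ger0_norm ?invr_ge0//.
    by move: H2 H3 H4; rewrite /K; lra.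
  by rewrite (le_trans H5)// mulrC -ler_pdivlMr.
have [|g0 + Hg0] := @compact_EVT_max _ R val GG _ GGc cval; first by exists 1%:M.
rewrite inE => G0.
exists (fun g => (F g).1.1), (fun g => (F g).1.2), (fun g => (F g).2), g0; split => //.
by move=> g Gg; apply: Hg0; rewrite inE.
Unshelve. all: by end_near. Qed.

(** The inequality is used at s and at -s, divided by s, with s so small that the quadratic term is
    below any given [e]. *)
Lemma small_slope (p c C s0 : R) : 0 < s0 -> 0 <= C ->
  (forall s, `|s| <= s0 -> 2 * (s * p) <= 2 * (`|s| * c) + C * s ^+ 2) -> `|p| <= c.
Proof.
move=> s00 C0 Hs; apply/ler_addgt0Pr => e e0.
pose s := Num.min s0 (e / (C + 1)).
have C10 : 0 < C + 1 by rewrite ltr_wpDl.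
have sp : 0 < s by rewrite lt_min s00 divr_gt0.
have Cs : C * s <= e.
  have : (C + 1) * s <= e by rewrite mulrC -ler_pdivlMr// ge_min lexx orbT.
  by move: sp; lra.
have ss0 : `|s| <= s0 by rewrite gtr0_norm// ge_min lexx.
have H1 := Hs s ss0; have := Hs (- s); rewrite normrN sqrrN => /(_ ss0).
rewrite (gtr0_norm sp) in H1 *; rewrite expr2 => H2.
rewrite ler_norml; apply/andP; split; rewrite -(ler_pM2l sp); move: H1 H2; rewrite expr2;
  have := ler_wpM2l (ltW sp) Cs; have := mulr_gt0 sp e0; lra.
Qed.

Definition Cgen (Xi : 'M[R]_N) (Ce : R) :=
  Lam * (Lam * (Lam * `|Xi| * C1 + C9 * (Lam * Lam * (`|Xi| + Ce)))).

(** Multiplying the maximizer by [Rc s] changes the action to first order by s <J Xi z(0), D>, where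
    D is the jump. The errors are of order |s| (kap + rho) |D|, since the correction [w] is O(rho)
    and varies with the rotation by O(kap |s|). Maximality for both signs of s bounds the slope. *)
Lemma critical_rotation Xi Rc Ce us ws acs g0 : generator Xi Rc Ce ->
  (forall g, GG g -> is_zero g (us g) (ws g) /\ is_action g (us g) (ws g) (acs g)) ->
  GG g0 ->
  (forall g, GG g -> action_value g (ws g) (acs g) <= action_value g0 (ws g0) (acs g0)) ->
  `|dot (Jm *m (Xi *m z 0)) (ws g0 1 - ws g0 0)| <=
     Cgen Xi Ce * (kap + rho) * `|ws g0 1 - ws g0 0|.
Proof.
move=> [Ce0 GR HR] HF G0 Hmax.
set w := ws g0; set D := w 1 - w 0; set p := dot _ D.
have [C C0 HC] := action_compare.
have [Z0 A0] := HF _ G0.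
have C10 := ltW C1_gt0; have C90 := C9_ge0.
pose Cs := Lam * Lam * (`|Xi| + Ce).
have Cs0 : 0 <= Cs by rewrite /Cs; nonneg.
pose s0 := Num.min 1 (Num.min (kap / (Cs + 1)) (r / (Lam * (Cs + 1)))).
have Cs1 : 0 < Cs + 1 by rewrite ltr_wpDl.
have s00 : 0 < s0 by rewrite !lt_min ltr01 !divr_gt0// mulr_gt0// Lam0.
pose c := Cgen Xi Ce * (kap + rho) * `|D|.
pose C' := 2 * C * Cs ^+ 2 + Lam * (Lam * (2 * (Lam * Ce * (Lam + 1)))) * `|D|.
have C'0 : 0 <= C' by rewrite /C' expr2; nonneg.
apply: (small_slope s00 C'0) => s; rewrite !le_min => /andP[s1 /andP[sk sr]].
have z1 : z 1 = z 0 by rewrite -[1]add0r zp.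
pose g := g0 *m Rc s.
have Gg : GG g by exact: GR.
have [Z1 A1] := HF _ Gg.
set E := Rc s - 1%:M - s *: Xi.
have Eb : `|E| <= Ce * s ^+ 2 by exact: HR.
have s2 : s ^+ 2 <= `|s| by rewrite -real_normK ?num_real// expr2 ler_piMl.
have RE : Rc s - 1%:M = s *: Xi + E by rewrite /E [RHS]addrC subrK.
have RcE : Rc s = 1%:M + (s *: Xi + E) by rewrite -RE addrCA subrr addr0.
have Rb : `|Rc s - 1%:M| <= (`|Xi| + Ce) * `|s|.
  rewrite RE (le_trans (ler_normD _ _))// mulrDl normrZ mulrC lerD// (le_trans Eb)//.
  by rewrite ler_wpM2l.
have g0b : `|g0| <= Lam.
  apply: mxnormP => // i j.
  have -> : g0 i j = (g0 *m delta_mx j 0 : 'cV[R]_N) i 0.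
    rewrite mxE (bigD1 j)//= mxE !eqxx mulr1 big1 ?addr0// => k kj.
    by rewrite mxE (negbTE kj) mulr0.
  rewrite (le_trans (mxnorm_ge _ _ _))// (le_trans (bg _ G0))// ler_piMr//.
  by apply: cvnormP => // k; rewrite mxE eqxx andbT; case: eqP; rewrite ?normr1 ?normr0.
have dgE : `|g - g0| <= Cs * `|s|.
  rewrite -[X in `|_ - X|]mulmx1 -mulmxBr (le_trans (mulmx_norm _ _))// /Cs -!mulrA.
  by rewrite ler_pM// ?mulr_ge0// ler_pM.
have dgk : `|g - g0| <= kap.
  rewrite (le_trans dgE)//; move: sk; rewrite ler_pdivlMr//.
  by have := normr_ge0 s; lra.
have dgr : Lam * `|g - g0| <= r.
  rewrite (le_trans (ler_wpM2l Lam0' dgE))//; move: sr; rewrite ler_pdivlMr ?mulr_gt0 ?Lam0//.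
  have : 0 <= Lam * `|s| by nonneg.
  lra.
have := HC _ _ _ _ _ _ _ _ Gg G0 Z1 Z0 A1 A0 dgr dgk.
set dg := `|g - g0| in dgE dgk dgr *.
have dg0 : 0 <= dg by exact: normr_ge0.
have -> : orb g0 (ws g0) 1 - orb g0 (ws g0) 0 = g0 *m D.
  by rewrite /orb -mulmxBr z1 opprD addrACA subrr add0r.
(* All that differs from the leading variation 2 s Xi z(0): the generator acting on the corrections,
   the quadratic remainder of [Rc], and the change of the corrections with the rotation. *)
pose ro := s *: (Xi *m (ws g 0 + ws g 1)) + (E *m (z 0 + ws g 0) + E *m (z 0 + ws g 1)) +
  ((ws g 0 - w 0) + (ws g 1 - w 1)).
have -> : orb g (ws g) 0 - orb g0 (ws g0) 0 + (orb g (ws g) 1 - orb g0 (ws g0) 1) =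
    g0 *m (2 *: (s *: (Xi *m z 0)) + ro).
  have orbE t : orb g (ws g) t - orb g0 (ws g0) t =
      g0 *m (s *: (Xi *m (z t + ws g t)) + E *m (z t + ws g t) + (ws g t - w t)).
    rewrite /orb /g -mulmxA -mulmxBr; congr (_ *m _).
    rewrite RcE mulmxDl mul1mx mulmxDl -scalemxAl -/w.
    move: (Xi *m _) (E *m _) => x y; apply/matrixP => i j; rewrite !mxE; ring.
  rewrite !orbE -mulmxDr z1 /ro; congr (_ *m _).
  rewrite !(mulmxDr Xi).
  move: (Xi *m z 0) (Xi *m ws g 0) (Xi *m ws g 1) (E *m (z 0 + ws g 0)) (E *m (z 0 + ws g 1)) => x1 x2 x3 x4 x5.
  by apply/matrixP => i j; rewrite !mxE; ring.
rewrite zJ// mulmxDr dotDl -!scalemxAr !dotZl -/p => HC1.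
have w0r : `|ws g 0| <= C1 * rho.
  by case: Z1 => [ur1 S1 _]; apply: (sol_small Gg S1 ur1 dr rho1); rewrite normr0.
have w1r : `|ws g 1| <= C1 * rho.
  by case: Z1 => [ur1 S1 _]; apply: (sol_small Gg S1 ur1 dr rho1); rewrite normr1.
have ww0 : `|ws g 0 - w 0| <= C9 * (kap * dg).
  by apply: (zero_sol_rot Gg G0 Z1 Z0 dgr dgk); rewrite normr0.
have ww1 : `|ws g 1 - w 1| <= C9 * (kap * dg).
  by apply: (zero_sol_rot Gg G0 Z1 Z0 dgr dgk); rewrite normr1.
have zw t : `|ws g t| <= C1 * rho -> `|E *m (z 0 + ws g t)| <= Lam * (Ce * s ^+ 2) * (Lam + 1).
  move=> wr; rewrite (le_trans (mulmx_normL _ _))// ler_pM//; first by nonneg.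
    by rewrite ler_wpM2l.
  by rewrite (le_trans (ler_normD _ _))// lerD// (le_trans wr)// (le_trans Cr).
have Xw : `|Xi *m (ws g 0 + ws g 1)| <= Lam * `|Xi| * (2 * (C1 * rho)).
  rewrite (le_trans (mulmx_normL _ _))// ler_wpM2l//; first by nonneg.
  by rewrite (le_trans (ler_normD _ _))//; move: w0r w1r; lra.
have rob : `|ro| <= `|s| * (Lam * `|Xi| * (2 * (C1 * rho))) +
    2 * (Lam * (Ce * s ^+ 2) * (Lam + 1)) + 2 * (C9 * (kap * (Cs * `|s|))).
  rewrite /ro (le_trans (ler_normD _ _))// lerD//.
    rewrite (le_trans (ler_normD _ _))// lerD//; first by rewrite normrZ ler_wpM2l.
    by rewrite (le_trans (ler_normD _ _))//; move: (zw _ w0r) (zw _ w1r); lra.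
  have dgs : C9 * (kap * dg) <= C9 * (kap * (Cs * `|s|)) by rewrite ler_wpM2l// ler_wpM2l.
  by rewrite (le_trans (ler_normD _ _))//; move: ww0 ww1 dgs; lra.
have dro : `|dot (Jm *m ro) D| <= Lam * (Lam * (`|s| * (Lam * `|Xi| * (2 * (C1 * rho))) +
    2 * (Lam * (Ce * s ^+ 2) * (Lam + 1)) + 2 * (C9 * (kap * (Cs * `|s|))))) * `|D|.
  by rewrite (le_trans (dot_norm _ _))// ler_wpM2r// ler_wpM2l// (le_trans (bJ _))// ler_wpM2l.
have dg2 : C * dg ^+ 2 <= C * (Cs ^+ 2 * s ^+ 2).
  rewrite ler_wpM2l// -[s ^+ 2]real_normK ?num_real// -exprMn lerXn2r// nnegrE//.
  by nonneg.
have := Hmax g Gg; rewrite -/w => Hm.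
move: HC1; rewrite ler_norml => /andP[HC1 _].
move: dro; rewrite ler_norml => /andP[dro _].
have k1' : 0 <= Lam * (Lam * (Lam * `|Xi| * C1)) * kap * `|s| * `|D| by nonneg.
have k2' : 0 <= Lam * (Lam * (C9 * Cs)) * rho * `|s| * `|D|.
  by have := ltW rho0 => *; nonneg.
rewrite /C' /Cgen -/Cs.
move: HC1 dro dg2 Hm k1' k2'; lra.
Qed.

(** Since z(1) = z(0), both ends of the arc are corrections of the same point and lie on the same
    energy level, so the linear part of the energy nearly vanishes on the jump. *)
Lemma critical_energy g u w : GG g -> is_zero g u w ->
  `|dot (Jm *m X 0 (z 0)) (w 1 - w 0)| <= CE * (C1 + 1) * (kap + rho) * `|w 1 - w 0|.
Proof.
move=> Gg Z; have [ur S _] := Z.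
have C10 := ltW C1_gt0; have CE0 := CE_ge0.
have z1 : z 1 = z 0 by rewrite -[1]add0r zp.
have w0r : `|w 0| <= (C1 + 1) * rho.
  rewrite mulrDl mul1r ler_wpDr ?(ltW rho0)//.
  by apply: (sol_small Gg S ur dr rho1); rewrite normr0.
have w1r : `|w 1| <= (C1 + 1) * rho.
  rewrite mulrDl mul1r ler_wpDr ?(ltW rho0)//.
  by apply: (sol_small Gg S ur dr rho1); rewrite normr1.
have dr' : del <= (C1 + 1) * rho.
  by rewrite mulrDl mul1r ler_wpDl//; have := ltW rho0 => *; nonneg.
have rr : (C1 + 1) * rho <= 2 * r by rewrite mulrDl mul1r mulr_natl mulr2n lerD.
have := energy_lin Gg w1r w0r dr' rr.
have E0 : H eps (g *m (z 0 + w 0)) = h.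
  by have := orb_energy (t := 0) Gg Z; rewrite /orb => -> //; rewrite lexx ler01.
have E1 : H eps (g *m (z 0 + w 1)) = h.
  by have := orb_energy (t := 1) Gg Z; rewrite /orb z1 => -> //; rewrite lexx ler01.
rewrite E0 E1 subrr sub0r normrN => /le_trans; apply.
rewrite ler_wpM2r// -mulrA ler_wpM2l// ler_wpM2l//; first by nonneg.
by rewrite lerDr.
Qed.

(** The jump is J B q and J preserves scalar products, so the assumed pairings are the components of
    B^T B q. Inverting the Gram matrix gives |D| <= |D| / 2. *)
Lemma closes Cmax g u w : B^T *m B \in unitmx -> GG g -> is_zero g u w ->
  0 <= Cmax ->
  (forall j, `|dot (Jm *m col j B) (w 1 - w 0)| <= Cmax * (kap + rho) * `|w 1 - w 0|) ->
  m%:R * `|Jm *m B *m invmx (B^T *m B)| * (Cmax * (kap + rho)) <= 2^-1 ->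
  w 1 = w 0.
Proof.
move=> BU Gg [ur S Z] Cm0 Hj HK.
pose q := B^T *m w 0.
have DE : w 1 - w 0 = Jm *m B *m q.
  move: Z => /(congr1 usubmx); rewrite /shoot col_mxKu linear0 => /subr0_eq ->.
  by rewrite /q !mulmxA.
set D := w 1 - w 0 in DE Hj *.
have kr0 : 0 <= kap + rho by rewrite addr_ge0// ltW.
have qE : `|B^T *m B *m q| <= Cmax * (kap + rho) * `|D|.
  apply: cvnormP => [|j]; first by nonneg.
  have -> : (B^T *m B *m q) j 0 = dot (Jm *m col j B) D.
    by rewrite DE -(mulmxA Jm) dotJJ dotE tr_col -row_mul -(mulmxA B^T) [RHS]mxE.
  exact: Hj.
have : `|D| <= 2^-1 * `|D|.
  have {1}-> : D = Jm *m B *m invmx (B^T *m B) *m (B^T *m B *m q).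
    by rewrite DE -!mulmxA (mulmxA (B^T)) mulKmx.
  rewrite (le_trans (mulmx_norm _ _))//.
  apply: (@le_trans _ _ (m%:R * `|Jm *m B *m invmx (B^T *m B)| * (Cmax * (kap + rho) * `|D|))).
    by rewrite ler_wpM2l// mulr_ge0.
  by rewrite mulrA ler_wpM2r.
move=> HD; apply/eqP; rewrite -subr_eq0 -/D -normr_le0; lra.
Qed.

End Orbits.

End Tube.

(** * Choice of the constants and the abstract persistence theorem *)

Hypothesis BU : B^T *m B \in unitmx.
Hypothesis colB : forall j, col j B = X 0 (z 0) \/
  exists Xi Rc Ce, generator Xi Rc Ce /\ col j B = Xi *m z 0.
Hypothesis tubes : forall kap, 0 < kap <= 1 -> exists2 r, 0 < r &
  forall del, 0 < del <= kap -> exists2 e, 0 < e &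
  forall eps, `|eps| < e -> tube eps kap del r.

Theorem persistence (sigma : R) : 0 < sigma -> exists2 e, 0 < e &
  forall eps, `|eps| < e -> exists T y g,
  [/\ GG g, `|T - Ts| < sigma, periodic_with 1 y &
   forall t : R, [/\ is_derive t 1 y (T *: X eps (y t)), H eps (y t) = h &
    `|y t - g *m z t| < sigma]].
Proof.
move=> sig0.
(* The linearized problem does not involve the perturbation, so [L] is obtained with eps = 0 and kap
   = 1, before the true [kap], which depends on its inverse, is chosen. *)
have [L Lu LE] : exists2 L : 'M[R]_(N + 1), L \in unitmx &
  forall u v, is_linear_sol u v -> L *m u = linear_shoot v.
  have [|r r0] := tubes (kap := 1); first by rewrite ltr01 lexx.
  move=> /(_ 1); rewrite ltr01 lexx => /(_ isT)[e e0 /(_ 0)]; rewrite normr0 => /(_ e0) Ht.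
  exact: shooting_matrix Ht.
pose Li := (N + 1)%:R * `|invmx L| + 1.
have Li0 : 0 < Li by rewrite /Li ltr_wpDl// mulr_ge0.
have HLi (x : 'cV[R]_(N + 1)) : `|invmx L *m x| <= Li * `|x|.
  by rewrite (le_trans (mulmx_norm _ _))// ler_wpM2r// /Li lerDl.
have L0 := Lam0; have L0' := ltW L0; have CH0' := ltW CH0.
have G0 : 0 < Gc by rewrite mulr_gt0// gronwall_const_gt0.
have G0' := ltW G0.
have C10 : 0 < C1 by rewrite mulr_gt0// addr_gt0// addr_gt0// !mulr_gt0.
have C50 : 0 <= C5 by rewrite /C5 /C3 /CE /C1 /C2 /BY /LY /LG; nonneg.
have CE0 : 0 <= CE by rewrite /CE /LY; nonneg.
have C90 : 0 <= C9 Li by rewrite /C9 /C8 /C7 /C2 /BY /LY /LG; nonneg.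
have /choice[cc Hcc] : forall j : 'I_m, exists c, 0 <= c /\
    ((col j B = X 0 (z 0) /\ c = CE * (C1 + 1)) \/
    (exists Xi Rc Ce, [/\ generator Xi Rc Ce, col j B = Xi *m z 0 & c = Cgen Li Xi Ce])).
  move=> j; case: (colB j) => [Bj|[Xi [Rc [Ce [Hg Bj]]]]].
    exists (CE * (C1 + 1)); split; last by left.
    by have := ltW C10 => *; nonneg.
  exists (Cgen Li Xi Ce); split; last by right; exists Xi, Rc, Ce.
  by case: Hg => Ce0 _ _; rewrite /Cgen; have := ltW C10 => *; nonneg.
pose Cmax := \sum_j cc j.
have Cmax0 : 0 <= Cmax by apply: sumr_ge0 => j _; exact: (Hcc j).1.
have ccC j : cc j <= Cmax.
  by rewrite /Cmax (bigD1 j)//= lerDl sumr_ge0// => k _; exact: (Hcc k).1.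
pose KB := m%:R * `|Jm *m B *m invmx (B^T *m B)|.
have KB0 : 0 <= KB by rewrite mulr_ge0.
(* With [kap = K^-1] and [rho <= kap] one has kap + rho <= 2 / K; the factor 4 then brings both
   [Li * C5] and [KB * Cmax], times kap + rho, below 1/2. *)
pose K := 4 * (Li * C5 + KB * Cmax + 1).
have LC : 0 <= Li * C5 by rewrite mulr_ge0// ltW//.
have KC : 0 <= KB * Cmax by rewrite mulr_ge0.
have K1 : 1 <= K by rewrite /K; lra.
have K0 : 0 < K by lra.
pose kap := K^-1.
have kap0 : 0 < kap by rewrite invr_gt0.
have kap1 : kap <= 1 by rewrite invf_le1.
have [|r r0 Hr] := tubes (kap := kap); first by rewrite kap0.
(* The four bounds serve, in order, the smallness of kap + rho, the radius of the tube, the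
   inactivity of the truncation, and the required closeness of the period and the orbit. *)
pose rho := Num.min (Num.min kap r) (Num.min (r / C1) (sigma / (2 * (Lam * C1 + 1)))).
have LC1 : 0 < 2 * (Lam * C1 + 1) by rewrite mulr_gt0// ltr_wpDl// mulr_ge0// ltW.
have rho0 : 0 < rho by rewrite !lt_min kap0 r0 !divr_gt0.
have rhok : rho <= kap by rewrite !ge_min lexx.
have rhor : rho <= r by rewrite !ge_min lexx orbT.
have Cr : C1 * rho <= r by rewrite mulrC -ler_pdivlMr// !ge_min lexx !orbT.
have rhos : 2 * (Lam * C1 + 1) * rho <= sigma.
  by rewrite mulrC -ler_pdivlMr// !ge_min lexx !orbT.
(* The second bound makes the initial Newton correction at most rho / 2. *)
pose del := Num.min rho (rho / (2 * (Li * (C1 + 1)))).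
have LC2 : 0 < 2 * (Li * (C1 + 1)) by rewrite !mulr_gt0// addr_gt0.
have del0 : 0 < del by rewrite lt_min rho0 divr_gt0.
have dr : del <= rho by rewrite ge_min lexx.
have Hd : Li * ((C1 + 1) * del) <= rho / 2.
  have : 2 * (Li * (C1 + 1)) * del <= rho by rewrite mulrC -ler_pdivlMr// ge_min lexx orbT.
  by lra.
have [|e e0 He] := Hr del; first by rewrite del0 (le_trans dr).
have kK : kap + rho <= 2 / K by rewrite mulr_natl mulr2n lerD.
have Hsmall x : 0 <= x -> 4 * x <= K -> x * (kap + rho) <= 2^-1.
  move=> x0 xK; rewrite (le_trans (ler_wpM2l x0 kK))// mulrA ler_pdivrMr//; lra.
have Hk : Li * (C5 * (kap + rho)) <= 2^-1 by rewrite mulrA Hsmall// /K; lra.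
have HB : KB * (Cmax * (kap + rho)) <= 2^-1 by rewrite mulrA Hsmall// /K; lra.
exists e => // eps /He Ht.
have [us [ws [acs [g [HF Gg Hmax]]]]] := maximal_action Ht Lu LE Li0 HLi rho0 dr rhor Cr Hk Hd.
have [Z _] := HF g Gg; set w := ws g in Z *; set u := us g in Z *.
have [ur S _] := Z.
have w10 : w 1 = w 0.
  apply: (closes Ht rho0 BU Gg Z Cmax0) => // j.
  have kr0 : 0 <= kap + rho by rewrite addr_ge0// ltW.
  have mono : cc j * (kap + rho) * `|w 1 - w 0| <= Cmax * (kap + rho) * `|w 1 - w 0|.
    by rewrite ler_wpM2r// ler_wpM2r.
  case: (Hcc j) => _ [[-> cE]|[Xi [Rc [Ce [Hg -> cE]]]]]; rewrite (le_trans _ mono)// cE.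
    by have E := critical_energy Ht rho0 dr rhor Cr Gg Z; exact: E.
  by have E := critical_rotation Ht Lu LE Li0 HLi rho0 dr rhor Cr Hk Hg HF Gg Hmax; exact: E.
have wp := sol_periodic Ht Gg S w10.
have oP : periodic_with 1 (orb g w) by move=> t; rewrite /orb zp wp.
have rho1 : rho <= 1 by rewrite (le_trans rhok).
have LCr : 0 < Lam * C1 * rho by apply: mulr_gt0 => //; exact: mulr_gt0.
exists (Ts + tau u), (orb g w), g; split => //.
  rewrite addrAC subrr add0r (le_lt_trans (tau_norm _))// (le_lt_trans ur)//.
  by apply: lt_le_trans rhos; move: LCr rho0; lra.
(* The arc is controlled on [0, 1] only; periodicity of [z] and [w] carries the equation, the energy
   and the closeness to all times. *)
move=> t; have [s s01 Hs] := periodic_reduce t.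
have s1 : `|s| <= 1 by have /andP[s0 s1] := s01; rewrite ger0_norm.
have [_ cw] := zero_clip Ht dr rhor Cr Gg Z s1.
split.
- rewrite -(orb_fieldE eps (r := r) u Gg) ?(Hs _ _ wp)//.
  by have := orb_derive_clip t S; rewrite (Hs _ _ wp).
- by rewrite (Hs _ _ oP); have E := orb_energy Ht dr rhor Cr Gg Z s01; exact: E.
- rewrite -mulmxBr addrAC subrr add0r (Hs _ _ wp) (le_lt_trans (bg _ Gg))//.
  have H1 := sol_small Ht Gg S ur dr rho1 s1.
  apply: le_lt_trans (ler_wpM2l L0' H1) _.
  by apply: lt_le_trans rhos; move: LCr rho0; lra.
Qed.

End Reduction.

(** * The radial functions f, G and V *)

Section RadialFunctions.
Context {R : realType}.

Definition C1_at (k kd : R -> R) (s0 : R) :=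
  (\forall s \near s0, is_derive (s : R) 1 k (kd s)) /\ {for s0, continuous kd}.

(** By the mean value theorem the increment equals [kd c * (s - s')] with [c] between the two
    points, and [kd c] is close to [kd s0] by continuity. *)
Lemma C1_at_strict k kd s0 : C1_at k kd s0 -> forall e, 0 < e ->
  exists2 d, 0 < d & forall s s', `|s - s0| < d -> `|s' - s0| < d ->
    `|k s - k s' - kd s0 * (s - s')| <= e * `|s - s'|.
Proof.
move=> [/near_normP[d1 d10 H1] /cvgrPdist_le H2] e e0.
have /near_normP[d2 d20 H3] := H2 e e0.
exists (Num.min d1 d2); first by rewrite lt_min d10.
suff wl (s s' : R) : s' <= s -> `|s - s0| < Num.min d1 d2 -> `|s' - s0| < Num.min d1 d2 ->
    `|k s - k s' - kd s0 * (s - s')| <= e * `|s - s'|.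
  move=> s s' sd sd'; have [/wl|/ltW /wl] := leP s' s; first exact.
  move=> /(_ sd' sd); rewrite (distrC s' s).
  rewrite (_ : k s' - k s - kd s0 * (s' - s) = - (k s - k s' - kd s0 * (s - s'))) ?normrN//.
  by ring.
move=> ss; rewrite !lt_min => /andP[a1 a2] /andP[b1 b2].
have bd (x d : R) : s' <= x <= s -> `|s - s0| < d -> `|s' - s0| < d -> `|x - s0| < d.
  by move=> /andP[x1 x2]; rewrite !ltr_norml => /andP[? ?] /andP[? ?]; apply/andP; split; lra.
have D x : x \in `]s', s[%R -> is_derive (x : R) 1 k (kd x).
  by rewrite in_itv/= => /andP[/ltW x1 /ltW x2]; apply/H1/bd; rewrite ?x1.
have C : {within `[s', s], continuous k}.
  apply: derivable_within_continuous => x; rewrite in_itv/= => x12.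
  by have [] := H1 x (bd _ _ x12 a1 b1).
have [c cI ->] := MVT_segment ss D C.
rewrite -mulrBl normrM ler_wpM2r// distrC; apply: H3; apply: bd a2 b2.
by move: cI; rewrite in_itv.
Qed.

Lemma near_pos_lt (beta : \bar R) (r : R) : 0 < r -> (r%:E < beta)%E ->
  \forall s \near r, 0 < s /\ (s%:E < beta)%E.
Proof.
move=> r0; case: beta => [c||]//.
- rewrite lte_fin => rc; apply/near_normP; exists (Num.min r (c - r)).
    by rewrite lt_min r0 subr_gt0.
  move=> s; rewrite lt_min !ltr_norml => /andP[/andP[? ?] /andP[? ?]].
  by rewrite lte_fin; split; lra.
- move=> _; apply/near_normP; exists r => // s; rewrite ltr_norml => /andP[? ?].
  by rewrite ltry; split=> //; lra.
Qed.

(** Taken as a function of the squared norm, so that a radial field is k(<p, p>) p, with an inner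
    function that is polynomial in p. *)
Definition radial_coef (phi : R -> R) (s : R) := phi (Num.sqrt s) / Num.sqrt s.

Definition radial_coef_deriv (phi dphi : R -> R) (s : R) :=
  dphi (Num.sqrt s) / (2 * s) - phi (Num.sqrt s) / (2 * s * Num.sqrt s).

Lemma C1_radial_coef phi dphi s0 : 0 < s0 -> C1_at phi dphi (Num.sqrt s0) ->
  C1_at (radial_coef phi) (radial_coef_deriv phi dphi) s0.
Proof.
move=> s00 [Hd Hc].
have sc := @sqrt_continuous R.
have Hd' : \forall s \near s0, is_derive (Num.sqrt s : R) 1 phi (dphi (Num.sqrt s)).
  exact: (sc s0 _ Hd).
have Hp : \forall s \near s0, 0 < s.
  by have := @near_pos_lt +oo%E s0 s00 (ltry _); apply: filterS => s [].
split.
  near=> s.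
  have sp : 0 < s by near: s.
  have Ds : is_derive (Num.sqrt s : R) 1 phi (dphi (Num.sqrt s)) by near: s.
  have r0 : 0 < Num.sqrt s by rewrite sqrtr_gt0.
  have E : s = Num.sqrt s * Num.sqrt s by rewrite -expr2 sqr_sqrtr// ltW.
  have S1 := is_derive1_sqrt sp.
  have S2 := is_derive_compf Ds S1.
  have rn0 : Num.sqrt s != 0 by rewrite gt_eqF.
  have S3 : is_derive s 1 (fun t => (Num.sqrt t)^-1) (- (Num.sqrt s) ^- 2 *: (2 * Num.sqrt s)^-1).
    exact: is_deriveV.
  apply: is_derive_ext (is_derive_mulf S2 S3) => //.
  rewrite /radial_coef_deriv /GRing.scale/=.
  by move: (Num.sqrt s) rn0 E => q q0 ->; field.
rewrite /radial_coef_deriv.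
have rn0 : Num.sqrt s0 != 0 by rewrite gt_eqF// sqrtr_gt0.
have s0n : s0 != 0 by rewrite gt_eqF.
have c2 : {for s0, continuous (fun s : R => 2 * s)}.
  by apply: cvgM; [exact: cvg_cst|exact: cvg_id].
apply: cvgB.
  apply: cvgM; first exact: (continuous_comp (sc s0) Hc).
  by apply: cvgV => //; rewrite mulf_neq0// pnatr_eq0.
have pc : {for Num.sqrt s0, continuous phi}.
  exact: is_derive_continuous (nbhs_singleton Hd).
apply: cvgM; first exact: (continuous_comp (sc s0) pc).
apply: cvgV; first by rewrite !mulf_neq0// pnatr_eq0.
by apply: cvgM => //; exact: sc.
Unshelve. all: by end_near. Qed.

Lemma enormE n (v : 'cV[R]_n) : enorm v = Num.sqrt (dot v v).
Proof. by rewrite /enorm /dot; congr Num.sqrt; apply: eq_bigr => i _; rewrite expr2. Qed.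

Lemma enorm_ge0 n (v : 'cV[R]_n) : 0 <= enorm v.
Proof. exact: sqrtr_ge0. Qed.

Lemma enorm_gt0 n (v : 'cV[R]_n) : v != 0 -> 0 < enorm v.
Proof. by move=> v0; rewrite enormE sqrtr_gt0 dot_gt0. Qed.

Lemma enorm_eq0 n (v : 'cV[R]_n) : (enorm v == 0) = (v == 0).
Proof.
apply/idP/idP => [|/eqP->]; last by rewrite enormE dot0l sqrtr0.
by apply: contraTT => /enorm_gt0; rewrite lt_def => /andP[].
Qed.

Lemma enormZ n c (v : 'cV[R]_n) : enorm (c *: v) = `|c| * enorm v.
Proof. by rewrite !enormE dotZl dotZr mulrA -expr2 sqrtrM ?sqr_ge0// sqrtr_sqr. Qed.

Lemma enorm_delta n (i : 'I_n) : enorm (delta_mx i 0 : 'cV[R]_n) = 1.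
Proof. by rewrite enormE dot_delta mxE !eqxx sqrtr1. Qed.

Lemma enorm_mxnorm n (v : 'cV[R]_n) : enorm v <= (n%:R + 1) * `|v|.
Proof.
rewrite enormE -[leRHS]ger0_norm ?mulr_ge0 ?addr_ge0// -sqrtr_sqr ler_sqrt ?sqr_ge0//.
rewrite (le_trans (ler_norm _))// (le_trans (dot_bound _ _))// exprMn -mulrA -expr2.
have n0 : 0 <= n%:R :> R by [].
rewrite ler_wpM2r ?sqr_ge0//; move: (n%:R) n0 => q q0; nra.
Qed.

Variables (a b : \bar R) (f : R -> R).
Hypothesis hphi : phi_assumptions a b f.

Notation g := ('pinv_(fun=> 0) (dom0 a) f).

Lemma f_ge0 r : dom0 a r -> 0 <= f r.
Proof. by move=> /(phi_f_maps hphi) []. Qed.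

Lemma phi_delta d (r : R) (i : 'I_d) : dom0 a r ->
  phi f (r *: delta_mx i 0 : 'cV[R]_d) = f r *: delta_mx i 0.
Proof.
move=> [r0 ra]; rewrite /phi scaler_eq0.
have -> : (delta_mx i 0 : 'cV[R]_d) == 0 = false.
  by rewrite -enorm_eq0 enorm_delta oner_eq0.
rewrite orbF enormZ enorm_delta mulr1 ger0_norm//.
have [->|rn0] := eqVneq r 0; first by rewrite (phi_f0 hphi) scale0r.
by rewrite scalerA divfK.
Qed.

Lemma enorm_phi d (v : 'cV[R]_d) : eball a v -> enorm (phi f v) = f (enorm v).
Proof.
move=> va; rewrite /phi; case: eqP => [->|/eqP v0].
  by rewrite !enormE dot0l sqrtr0 (phi_f0 hphi).
rewrite enormZ ger0_norm ?divfK ?enorm_eq0//.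
by rewrite divr_ge0 ?enorm_ge0// f_ge0//; split => //; exact: enorm_ge0.
Qed.

(** The planar homeomorphism [phi f], restricted to a coordinate ray, is [f]; injectivity, and in
    the next lemma surjectivity, are read off from it. *)
Lemma f_inj : {in dom0 a &, injective f}.
Proof.
move=> r r'; rewrite !inE => ra ra' E.
have [g' [_ _ [K _] _ _]] := phi_homeo2 hphi.
have H x : dom0 a x -> eball a (x *: delta_mx 0 0 : 'cV[R]_2).
  by move=> [x0 xa]; rewrite /eball/= enormZ enorm_delta mulr1 ger0_norm.
have := K _ (H _ ra); rewrite phi_delta// E -(phi_delta (d := 2))// K; last exact: H.
by move=> /matrixP /(_ 0 0); rewrite !mxE !eqxx !mulr1.
Qed.

Lemma f_surj s : dom0 b s -> (f @` dom0 a) s.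
Proof.
move=> [s0 sb]; have [g' [_ gm [_ K] _ _]] := phi_homeo2 hphi.
have sB : eball b (s *: delta_mx 0 0 : 'cV[R]_2).
  by rewrite /eball/= enormZ enorm_delta mulr1 ger0_norm.
exists (enorm (g' (s *: delta_mx 0 0))); last first.
  by rewrite -enorm_phi ?K// ?enormZ ?enorm_delta ?mulr1 ?ger0_norm//; exact: gm.
by split; [exact: enorm_ge0|exact: gm].
Qed.

Lemma ginvK s : dom0 b s -> f (g s) = s.
Proof. by move=> sb; apply: pinvK; rewrite inE; exact: f_surj. Qed.

Lemma finvK r : dom0 a r -> g (f r) = r.
Proof. by move=> ra; apply: pinvKV; [exact: f_inj|rewrite inE]. Qed.

Lemma ginv_dom s : dom0 b s -> dom0 a (g s).
Proof. by move=> /f_surj[r ra <-]; rewrite finvK. Qed.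

Lemma ginv_gt0 s : 0 < s -> (s%:E < b)%E -> 0 < g s /\ ((g s)%:E < a)%E.
Proof.
move=> s0 sb; have sd : dom0 b s by split=> //; exact: ltW.
have [g0 ga] := ginv_dom sd; split=> //.
rewrite lt_def g0 andbT; apply: contraTneq s0 => g00.
by rewrite -(ginvK sd) g00 (phi_f0 hphi) ltxx.
Qed.

Definition dginv (s : R) : R := (derive1 f (g s))^-1.

Lemma is_derive_ginv (s : R) : 0 < s -> (s%:E < b)%E -> is_derive s 1 g (dginv s).
Proof.
move=> s0 sb; have [g0 ga] := ginv_gt0 s0 sb.
have E : f (g s) = s by apply: ginvK; split=> //; exact: ltW.
rewrite -[X in is_derive X]E; apply: is_derive_inverse.
- by apply: filterS (near_pos_lt g0 ga) => r [r0 ra]; apply: finvK; split=> //; exact: ltW.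
- apply: filterS (near_pos_lt g0 ga) => r [r0 ra].
  exact/differentiable_continuous/derivable1_diffP/(phi_f_derivable hphi).
- by rewrite derive1E; apply/derivableP/(phi_f_derivable hphi).
- by rewrite gt_eqF// (phi_f_increasing hphi).
Qed.

Lemma C1_ginv s : 0 < s -> (s%:E < b)%E -> C1_at g dginv s.
Proof.
move=> s0 sb; split.
  by apply: filterS (near_pos_lt s0 sb) => r [r0 rb]; exact: is_derive_ginv.
have [g0 ga] := ginv_gt0 s0 sb.
apply: cvgV; first by rewrite gt_eqF// (phi_f_increasing hphi).
apply: continuous_comp; first exact: is_derive_continuous (is_derive_ginv s0 sb).
exact: (phi_f_C1 hphi).
Qed.

Lemma is_derive_G (s : R) : 0 < s -> (s%:E < b)%E -> is_derive s 1 (G a f) (g s).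
Proof.
move=> s0 sb; have /near_normP[d d0 Hd] := near_pos_lt s0 sb.
pose u := s + d / 2.
have su : s < u by rewrite ltrDl divr_gt0.
have [u0 ub] : 0 < u /\ (u%:E < b)%E.
  by apply: Hd; rewrite /u addrAC subrr add0r gtr0_norm ?divr_gt0// ltr_pdivrMr// mulr_natr mulr2n ltrDl.
have [g0 ga] := ginv_gt0 u0 ub.
have ud : dom0 b u by split=> //; exact: ltW.
have sub : `[0, g u] `<=` dom0 a.
  move=> x /=; rewrite in_itv/= => /andP[x0 xg]; split=> //.
  by rewrite (le_lt_trans _ ga)// lee_fin.
(* Continuity of the inverse up to the end point 0, where no derivative of [f] is assumed, comes
   from its being the inverse of a continuous function on a segment. *)
have gc : {within `[0, u], continuous g}.
  rewrite -[X in `[X, _]](phi_f0 hphi) -[X in `[_, X]](ginvK ud).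
  apply: segment_can_le_continuous; first exact: ltW.
    exact: continuous_subspaceW sub (phi_f_continuous hphi).
  by move=> x xi; apply: finvK; apply: sub.
have [] := @continuous_FTC1 R g (BLeft 0) s u su.
- by apply: continuous_compact_integrable => //; exact: segment_compact.
- by rewrite lte_fin.
- exact: is_derive_continuous (is_derive_ginv s0 sb).
by move=> dG eG; split; [exact: dG|rewrite -derive1E; exact: eG].
Qed.

Definition kpsi := radial_coef g.
Definition dkpsi := radial_coef_deriv g dginv.

(** The inverse of [phi f], and the gradient of G(|p|) for p non-zero; at p = 0 it is 0 whatever the
    coefficient is. *)
Definition psi d (p : 'cV[R]_d) : 'cV[R]_d := kpsi (dot p p) *: p.

Lemma enorm_psi d (p : 'cV[R]_d) : p != 0 -> eball b p -> enorm (psi p) = g (enorm p).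
Proof.
move=> p0 pb; have [g0 ga] := ginv_gt0 (enorm_gt0 p0) pb.
rewrite /psi enormZ /kpsi /radial_coef -enormE ger0_norm ?divfK ?enorm_eq0//.
by rewrite divr_ge0 ?enorm_ge0// ltW.
Qed.

Lemma psi0 d : psi (0 : 'cV[R]_d) = 0.
Proof. by rewrite /psi scaler0. Qed.

Lemma psi_ball d (p : 'cV[R]_d) : eball b p -> eball a (psi p).
Proof.
move=> pb; have [->|p0] := eqVneq p 0.
  by rewrite psi0 /eball/= enormE dot0l sqrtr0; exact: phi_a_gt0 hphi.
by rewrite /eball/= enorm_psi//; have [] := ginv_gt0 (enorm_gt0 p0) pb.
Qed.

Lemma phi_psi d (p : 'cV[R]_d) : eball b p -> phi f (psi p) = p.
Proof.
move=> pb; have [->|p0] := eqVneq p 0; first by rewrite psi0 /phi eqxx.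
have [g0 ga] := ginv_gt0 (enorm_gt0 p0) pb.
have dp : dom0 b (enorm p) by split=> //; exact: enorm_ge0.
rewrite /phi -enorm_eq0 enorm_psi// gt_eqF// ginvK// /psi /kpsi /radial_coef -enormE scalerA.
rewrite mulrA divfK ?gt_eqF// divff ?scale1r// enorm_eq0//.
Qed.

Lemma psi_phi d (v : 'cV[R]_d) : eball a v -> psi (phi f v) = v.
Proof.
move=> va; have [->|v0] := eqVneq v 0; first by rewrite /phi eqxx psi0.
have dv : dom0 a (enorm v) by split=> //; exact: enorm_ge0.
rewrite /psi /kpsi /radial_coef -enormE enorm_phi// finvK// /phi (negbTE v0) scalerA.
have fn0 : f (enorm v) != 0.
  apply: contra_neq v0 => E; apply/eqP; rewrite -enorm_eq0.
  have d0 : dom0 a 0 by split=> //; exact: phi_a_gt0 hphi.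
  by apply/eqP/f_inj; rewrite ?inE// E (phi_f0 hphi).
by rewrite mulrA divfK// divff ?scale1r// enorm_eq0.
Qed.

Lemma phi_ball d (v : 'cV[R]_d) : eball a v -> eball b (phi f v).
Proof.
move=> va; rewrite /eball/= enorm_phi//.
by have [] := phi_f_maps hphi (conj (enorm_ge0 v) va).
Qed.

Lemma C1_kpsi d (p : 'cV[R]_d) : p != 0 -> eball b p -> C1_at kpsi dkpsi (dot p p).
Proof.
move=> p0 pb; apply: C1_radial_coef; first exact: dot_gt0.
by rewrite -enormE; apply: C1_ginv => //; exact: enorm_gt0.
Qed.

Variable V : R -> R.
Hypothesis hV : C2_on_positive V.

Definition kV := radial_coef (derive1 V).
Definition dkV := radial_coef_deriv (derive1 V) (derive1n 2 V).

Lemma C1_kV d (x : 'cV[R]_d) : x != 0 -> C1_at kV dkV (dot x x).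
Proof.
move=> x0; apply: C1_radial_coef; first exact: dot_gt0.
rewrite -enormE; have xp := enorm_gt0 x0; split; last by case: (hV xp).
apply: filterS (near_pos_lt xp (ltry _)) => s [s0 _].
have [_ dV' _] := hV s0.
have -> : derive1n 2 V s = 'D_1 (derive1 V) s by rewrite -derive1E.
exact/derivableP.
Qed.

Lemma central_forceE d (x : 'cV[R]_d) : central_force V x = kV (dot x x) *: x.
Proof. by rewrite /central_force /kV /radial_coef -enormE. Qed.

End RadialFunctions.

(** * Uniform strict differentiability *)

Section StrictDifferentiability.
Context {R : realType}.

(* [F eps] is strictly differentiable at [q] with derivative [L], uniformly in
   small [eps], and [F eps q] tends to [F 0 q]. *)
Definition sdiff n (W : normedModType R) (F : R -> 'cV[R]_n -> W) (q : 'cV[R]_n)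
    (L : 'cV[R]_n -> W) :=
  (exists2 C : R, 0 <= C & forall v, `|L v| <= C * `|v|) /\
  forall kap : R, 0 < kap -> exists2 d : R, 0 < d & forall eps, `|eps| < d ->
    `|F eps q - F 0 q| <= kap /\
    forall y y', `|y - q| < d -> `|y' - q| < d ->
      `|F eps y - F eps y' - L (y - y')| <= kap * `|y - y'|.

Lemma sdiff_ext n (W : normedModType R) (F : R -> 'cV[R]_n -> W) q L L' :
  (forall v, L v = L' v) -> sdiff F q L -> sdiff F q L'.
Proof. by move=> /funext ->. Qed.

Lemma sdiff_lip n (W : normedModType R) (F : R -> 'cV[R]_n -> W) q L : sdiff F q L ->
  exists2 C : R, 0 < C & exists2 d : R, 0 < d & forall eps y y', `|eps| < d ->
   `|y - q| < d -> `|y' - q| < d -> `|F eps y - F eps y'| <= C * `|y - y'|.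
Proof.
move=> [[C C0 bL] /(_ 1 ltr01)[d d0 H]]; exists (C + 1); first by rewrite ltr_wpDl.
exists d => // eps y y' /H[_ {}H] yd yd'.
rewrite -[X in `|X|](subrK (L (y - y'))) (le_trans (ler_normD _ _))//.
by rewrite mulrDl addrC lerD// H.
Qed.

Lemma sdiff_near n (W : normedModType R) (F : R -> 'cV[R]_n -> W) q L : sdiff F q L ->
  forall kap : R, 0 < kap -> exists2 d : R, 0 < d & forall eps y, `|eps| < d ->
   `|y - q| < d -> `|F eps y - F 0 q| <= kap.
Proof.
move=> HF kap kap0; have [C C0 [d d0 HC]] := sdiff_lip HF.
have [_ /(_ (kap / 2))[|e e0 He]] := HF; first by rewrite divr_gt0.
exists (Num.min (Num.min d e) (kap / 2 / C)); first by rewrite !lt_min d0 e0 !divr_gt0.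
move=> eps y; rewrite !lt_min => /andP[/andP[ed ee] _] /andP[/andP[yd _] yk].
rewrite -(subrKA (F eps q)) (le_trans (ler_normD _ _))//.
have [H1 _] := He _ ee.
have H2 : `|F eps y - F eps q| <= C * `|y - q| by apply: HC; rewrite ?subrr ?normr0.
have H3 : C * `|y - q| <= kap / 2 by rewrite mulrC -ler_pdivlMr// ltW.
lra.
Qed.

Lemma sdiff_congr n (W : normedModType R) (F F' : R -> 'cV[R]_n -> W) q L (d : R) : 0 < d ->
  (forall eps y, `|eps| < d -> `|y - q| < d -> F eps y = F' eps y) ->
  sdiff F q L -> sdiff F' q L.
Proof.
move=> d0 E [bL H]; split=> // kap /H[e e0 He]; exists (Num.min e d); first by rewrite lt_min e0.
move=> eps; rewrite lt_min => /andP[ee ed]; have [H1 H2] := He _ ee.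
have qq : `|q - q| < d by rewrite subrr normr0.
split; first by rewrite -!E// normr0.
by move=> y y'; rewrite !lt_min => /andP[? ?] /andP[? ?]; rewrite -!E//; exact: H2.
Qed.

Lemma sdiff_cst n (W : normedModType R) (w : W) (q : 'cV[R]_n) :
  sdiff (fun _ _ => w) q (fun=> 0).
Proof.
split; first by exists 0 => // v; rewrite normr0 mul0r.
move=> kap kap0; exists 1 => // eps _; rewrite !subrr normr0 ltW//; split=> // y y' _ _.
by rewrite mulr_ge0// ltW.
Qed.

Lemma sdiffD n (W : normedModType R) (F F' : R -> 'cV[R]_n -> W) q L L' :
  sdiff F q L -> sdiff F' q L' ->
  sdiff (fun e y => F e y + F' e y) q (fun v => L v + L' v).
Proof.
move=> [[C C0 bL] H] [[C' C0' bL'] H']; split.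
  exists (C + C'); first exact: addr_ge0.
  by move=> v; rewrite mulrDl (le_trans (ler_normD _ _))// lerD.
move=> kap kap0; have k2 : 0 < kap / 2 by rewrite divr_gt0.
have [d d0 Hd] := H _ k2; have [d' d0' Hd'] := H' _ k2.
exists (Num.min d d'); first by rewrite lt_min d0.
move=> eps; rewrite lt_min => /andP[/Hd[A1 A2] /Hd'[B1 B2]]; split.
  by rewrite opprD addrACA (le_trans (ler_normD _ _))// [kap]splitr lerD.
move=> y y'; rewrite !lt_min => /andP[y1 y2] /andP[y1' y2'].
have {A2}A2 := A2 _ _ y1 y1'; have {B2}B2 := B2 _ _ y2 y2'.
have -> : F eps y + F' eps y - (F eps y' + F' eps y') - (L (y - y') + L' (y - y')) =
    (F eps y - F eps y' - L (y - y')) + (F' eps y - F' eps y' - L' (y - y')).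
  by rewrite [RHS]addrACA [in RHS](addrACA (F eps y)) -!opprD.
by rewrite (le_trans (ler_normD _ _))// [kap]splitr mulrDl lerD.
Qed.

Lemma sdiff_sum n (W : normedModType R) (I : finType) (F : I -> R -> 'cV[R]_n -> W) q L :
  (forall i, sdiff (F i) q (L i)) ->
  sdiff (fun e y => \sum_i F i e y) q (fun v => \sum_i L i v).
Proof.
move=> H; elim: (index_enum I) => [|i s IH].
  under [F in sdiff F]eq_fun do under eq_fun do rewrite big_nil.
  under [F in sdiff _ _ F]eq_fun do rewrite big_nil.
  exact: sdiff_cst.
under [F in sdiff F]eq_fun do under eq_fun do rewrite big_cons.
under [F in sdiff _ _ F]eq_fun do rewrite big_cons.
exact: sdiffD.
Qed.

Lemma sdiff_post n (W W' : normedModType R) (T : W -> W') C (F : R -> 'cV[R]_n -> W) q L :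
  0 <= C -> (forall u v, T (u - v) = T u - T v) -> (forall u, `|T u| <= C * `|u|) ->
  sdiff F q L -> sdiff (fun e y => T (F e y)) q (fun v => T (L v)).
Proof.
move=> C0 TB bT [[K K0 bL] H]; split.
  exists (C * K); first exact: mulr_ge0.
  by move=> v; rewrite -mulrA (le_trans (bT _))// ler_wpM2l.
move=> kap kap0; have C1 : 0 < C + 1 by rewrite ltr_wpDl.
have [d d0 Hd] := H (kap / (C + 1)) (divr_gt0 kap0 C1).
have Ck : C * (kap / (C + 1)) <= kap.
  by rewrite mulrCA ger_pMr// ler_pdivrMr// mul1r lerDl.
exists d => // eps /Hd[A1 A2]; split.
  by rewrite -TB (le_trans (bT _))// (le_trans (ler_wpM2l C0 A1)).
move=> y y' yd yd'; rewrite -!TB (le_trans (bT _))//.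
by rewrite (le_trans (ler_wpM2l C0 (A2 _ _ yd yd')))// mulrA ler_wpM2r.
Qed.

Lemma sdiff_pre n m (W : normedModType R) (P : 'M[R]_(m, n)) (F : R -> 'cV[R]_m -> W) q L :
  sdiff F (P *m q) L -> sdiff (fun e y => F e (P *m y)) q (fun v => L (P *m v)).
Proof.
move=> [[K K0 bL] H].
have [C C0 bP] : exists2 C : R, 0 < C & forall v : 'cV_n, `|P *m v| <= C * `|v|.
  exists (n%:R * `|P| + 1); first by rewrite ltr_wpDl// mulr_ge0.
  by move=> v; rewrite (le_trans (mulmx_norm _ _))// ler_wpM2r// lerDl.
split.
  exists (K * C); first by rewrite mulr_ge0// ltW.
  by move=> v; rewrite -mulrA (le_trans (bL _))// ler_wpM2l.
move=> kap kap0; have [|d d0 Hd] := H (Num.min kap (kap / C)).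
  by rewrite lt_min kap0 divr_gt0.
exists (Num.min d (d / C)); first by rewrite lt_min d0 divr_gt0.
move=> eps; rewrite lt_min => /andP[/Hd[A1 A2] _].
have Hb y : `|y - q| < Num.min d (d / C) -> `|P *m y - P *m q| < d.
  rewrite lt_min ltr_pdivlMr// mulrC => /andP[_]; rewrite -mulmxBr.
  exact: le_lt_trans (bP _).
split; first by rewrite (le_trans A1)// ge_min lexx.
move=> y y' /Hb yd /Hb yd'; rewrite mulmxBr (le_trans (A2 _ _ yd yd'))//.
apply: (@le_trans _ _ (kap / C * `|P *m y - P *m y'|)).
  by rewrite ler_wpM2r// ge_min lexx orbT.
by rewrite mulrAC ler_pdivrMr// -mulrA ler_wpM2l ?(ltW kap0)// -mulmxBr mulrC.
Qed.

Lemma sdiffZ n (W : normedModType R) (k : R -> 'cV[R]_n -> R) (F : R -> 'cV[R]_n -> W)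
    q Lk L :
  sdiff k q Lk -> sdiff F q L ->
  sdiff (fun e y => k e y *: F e y) q (fun v => k 0 q *: L v + Lk v *: F 0 q).
Proof.
move=> Hk HF; have [[Ck Ck0 bk] Hk'] := Hk; have [[C C0 bL] HF'] := HF.
split.
  exists (`|k 0 q| * C + Ck * `|F 0 q|); first by rewrite addr_ge0// mulr_ge0.
  move=> v; rewrite (le_trans (ler_normD _ _))// !normrZ mulrDl lerD//.
    by rewrite -mulrA ler_wpM2l.
  by rewrite mulrAC ler_wpM2r.
move=> kap kap0.
pose m := `|k 0 q| + `|F 0 q| + C + Ck + 2.
have m0 : 0 < m by rewrite /m ltr_wpDl// !addr_ge0.
(* [m] bounds every factor that multiplies a small error, so each of the four terms of the product
   rule gets at most kap / 4. *)
pose e := Num.min 1 (kap / (4 * m)).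
have e0 : 0 < e by rewrite lt_min ltr01 divr_gt0// mulr_gt0.
have e1 : e <= 1 by rewrite ge_min lexx.
have em : e * m <= kap / 4.
  rewrite (@le_trans _ _ (kap / (4 * m) * m))// ?ler_wpM2r ?(ltW m0)// ?ge_min ?lexx ?orbT//.
  by rewrite invfM mulrA divfK// gt_eqF.
have small (x : R) : x <= m -> x * e <= kap / 4.
  by move=> xm; rewrite (le_trans _ em)// mulrC ler_wpM2l// ltW.
have [d1 d10 N1] := sdiff_near Hk e0; have [d2 d20 N2] := sdiff_near HF e0.
have [d3 d30 S1] := Hk' _ e0; have [d4 d40 S2] := HF' _ e0.
exists (Num.min (Num.min d1 d2) (Num.min d3 d4)); first by rewrite !lt_min d10 d20 d30.
have bf (a c : R) : `|a - c| <= e -> `|a| <= `|c| + 1.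
  move=> H; rewrite -[X in `|X|](subrK c) (le_trans (ler_normD _ _))// addrC lerD2l.
  exact: le_trans e1.
have bF (a c : W) : `|a - c| <= e -> `|a| <= `|c| + 1.
  move=> H; rewrite -[X in `|X|](subrK c) (le_trans (ler_normD _ _))// addrC lerD2l.
  exact: le_trans e1.
move: (normr_ge0 (k 0 q)) (normr_ge0 (F 0 q)) => nk nF.
move=> eps; rewrite !lt_min => /andP[/andP[/N1 {}N1 /N2 {}N2] /andP[/S1[K1 {}S1] /S2[K2 {}S2]]].
split.
  have -> : k eps q *: F eps q - k 0 q *: F 0 q =
     k eps q *: (F eps q - F 0 q) + (k eps q - k 0 q) *: F 0 q.
    by rewrite scalerBr scalerBl subrKA.
  rewrite (le_trans (ler_normD _ _))// !normrZ.
  have A1 := ler_pM (normr_ge0 _) (normr_ge0 _) (bf _ _ K1) K2.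
  have A2 := ler_wpM2r nF K1.
  have B1 : (`|k 0 q| + 1) * e <= kap / 4 by apply: small; rewrite /m; lra.
  have B2 : `|F 0 q| * e <= kap / 4 by apply: small; rewrite /m; lra.
  by move: A2 B2; rewrite mulrC => A2 B2; lra.
move=> y y'; rewrite !lt_min => /andP[/andP[/N1 y1 _] /andP[y3 y4]].
move=> /andP[/andP[_ /N2 y2'] /andP[y3' y4']].
have {S1}S1 := S1 _ _ y3 y3'; have {S2}S2 := S2 _ _ y4 y4'.
set D := y - y' in S1 S2 *.
have -> : k eps y *: F eps y - k eps y' *: F eps y' - (k 0 q *: L D + Lk D *: F 0 q) =
  k eps y *: (F eps y - F eps y' - L D) + (k eps y - k 0 q) *: L D +
  ((k eps y - k eps y' - Lk D) *: F eps y' + Lk D *: (F eps y' - F 0 q)).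
  rewrite !scalerBr !scalerBl.
  move: (k eps y *: _) (k eps y *: _) (k eps y *: _) (k 0 q *: _) (k eps y' *: _)
    (Lk D *: _) (Lk D *: _) => u1 u2 u3 u4 u5 u6 u7.
  by rewrite !subrKA [in RHS](addrAC u3) [in RHS]addrA [in RHS]addrA subrK opprD addrA (addrAC u3).
rewrite (le_trans (ler_normD _ _))//.
have -> : kap * `|D| = (kap / 4 + kap / 4) * `|D| + (kap / 4 + kap / 4) * `|D| by field.
apply: lerD; rewrite (le_trans (ler_normD _ _))// !normrZ mulrDl.
- apply: lerD.
    rewrite (le_trans (ler_pM (normr_ge0 _) (normr_ge0 _) (bf _ _ y1) S2))//.
    by rewrite mulrA ler_wpM2r// small// /m; lra.
  rewrite (le_trans (ler_pM (normr_ge0 _) (normr_ge0 _) y1 (bL _)))//.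
  by rewrite mulrA ler_wpM2r// mulrC small// /m; lra.
- apply: lerD.
    rewrite (le_trans (ler_pM (normr_ge0 _) (normr_ge0 _) S1 (bF _ _ y2')))//.
    by rewrite mulrAC ler_wpM2r// mulrC small// /m; lra.
  rewrite (le_trans (ler_pM (normr_ge0 _) (normr_ge0 _) (bk _) y2'))//.
  by rewrite mulrAC ler_wpM2r// small// /m; lra.
Qed.

Lemma sdiff_comp n (kk kd : R -> R) (F : R -> 'cV[R]_n -> R) q L :
  C1_at kk kd (F 0 q) -> sdiff F q L ->
  sdiff (fun e y => kk (F e y)) q (fun v => kd (F 0 q) * L v).
Proof.
move=> Hk HF; have [[C C0 bL] HF'] := HF; split.
  exists (`|kd (F 0 q)| * C); first exact: mulr_ge0.
  by move=> v; rewrite normrM -mulrA ler_wpM2l.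
move=> kap kap0; have [C1 C10 [d1 d10 Hl]] := sdiff_lip HF.
pose e := kap / 2 / C1; have e0 : 0 < e by rewrite !divr_gt0.
have [dk dk0 Sk] := C1_at_strict Hk e0.
have [d2 d20 N2] := sdiff_near HF (divr_gt0 dk0 (ltr0n R 2)).
have dk2 : dk / 2 < dk by rewrite ltr_pdivrMr// mulr_natr mulr2n ltrDl.
(* The first bound in [e3] controls the linearization error of [F] multiplied by the outer
   derivative, the second the convergence at [q] as eps tends to 0. *)
pose k0 := `|kd (F 0 q)|; pose e3 := Num.min (kap / 2 / (k0 + 1)) (kap / (2 * (k0 + e + 1))).
have k0p : 0 <= k0 := normr_ge0 _.
have k1 : 0 < k0 + 1 by lra.
have ke1 : 0 < k0 + e + 1 by lra.
have e30 : 0 < e3 by rewrite lt_min !divr_gt0// mulr_gt0.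
have [d3 d30 S3] := HF' _ e30.
exists (Num.min (Num.min d1 d2) d3); first by rewrite !lt_min d10 d20.
move=> eps; rewrite !lt_min => /andP[/andP[E1 E2] /S3[K3 {}S3]].
have inD y : `|y - q| < d2 -> `|F eps y - F 0 q| < dk.
  by move=> yd; apply: le_lt_trans dk2; exact: N2.
split.
  have i1 : `|F eps q - F 0 q| < dk by apply: inD; rewrite subrr normr0.
  have i2 : `|F 0 q - F 0 q| < dk by rewrite subrr normr0.
  have H := Sk _ _ i1 i2.
  have {H}H : `|kk (F eps q) - kk (F 0 q)| <= (e + k0) * `|F eps q - F 0 q|.
    rewrite -[X in `|X| <= _](subrK (kd (F 0 q) * (F eps q - F 0 q))).
    by rewrite (le_trans (ler_normD _ _))// mulrDl normrM lerD.
  rewrite (le_trans H)// (@le_trans _ _ ((e + k0) * (kap / (2 * (k0 + e + 1)))))//.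
    by rewrite ler_wpM2l ?addr_ge0 ?(ltW e0)// (le_trans K3)// ge_min lexx orbT.
  have p0 : 0 < 2 * (k0 + e + 1) by rewrite mulr_gt0.
  by rewrite mulrA ler_pdivrMr// mulrC ler_wpM2l ?(ltW kap0)//; lra.
move=> y y'; rewrite !lt_min => /andP[/andP[y1 y2] y3] /andP[/andP[y1' y2'] y3'].
have {S3}S3 := S3 _ _ y3 y3'; have {}Hl := Hl _ _ _ E1 y1 y1'.
have {}Sk := Sk _ _ (inD _ y2) (inD _ y2').
have -> : kk (F eps y) - kk (F eps y') - kd (F 0 q) * L (y - y') =
  (kk (F eps y) - kk (F eps y') - kd (F 0 q) * (F eps y - F eps y')) +
  kd (F 0 q) * (F eps y - F eps y' - L (y - y')) by ring.
rewrite (le_trans (ler_normD _ _))// [kap in leRHS]splitr mulrDl; apply: lerD.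
  rewrite (le_trans Sk)// (le_trans (ler_wpM2l (ltW e0) Hl))// mulrA divfK// gt_eqF//.
rewrite normrM -/k0 (le_trans (ler_wpM2l k0p S3))// mulrA ler_wpM2r//.
rewrite (@le_trans _ _ (k0 * (kap / 2 / (k0 + 1))))//.
  by rewrite ler_wpM2l// ge_min lexx.
by rewrite mulrA ler_pdivrMr// mulrC ler_wpM2l ?divr_ge0 ?(ltW kap0)// lerDl.
Qed.

End StrictDifferentiability.

(** * Families vanishing at eps = 0 *)

Section Families.
Context {R : realType}.

Lemma cv_sum_delta n (v : 'cV[R]_n) : v = \sum_i v i 0 *: delta_mx i 0.
Proof. by rewrite {1}(matrix_sum_delta v); apply: eq_bigr => i _; rewrite big_ord1. Qed.

Lemma is_derive_along (W : normedModType R) n (F : 'cV[R]_n -> W) (c : R -> 'cV[R]_n) (t : R) dc :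
  differentiable F (c t) -> is_derive t 1 c dc ->
  is_derive t 1 (fun s => F (c s)) (\sum_i dc i 0 *: partial i F (c t)).
Proof.
move=> dF [dct dcE].
have dcd : differentiable c t by apply/derivable1_diffP.
have dFc : differentiable (F \o c) t by exact: differentiable_comp.
split; first exact/derivable1_diffP.
have -> : 'D_1 (fun s => F (c s)) t = 'd (F \o c) t 1 by exact: deriveE.
rewrite diff_comp//= -(deriveE _ dcd) dcE {1}(cv_sum_delta dc) linear_sum.
by apply: eq_bigr => i _; rewrite linearZ /partial deriveE.
Qed.

(** The mean value inequality is a property of the target space here, so that [sdiff_base] treats
    the scalar potential U and the vector potential A together. *)
Definition segment_mvt (W : normedModType R) := forall (f df : R -> W) (c : R),
  (forall t : R, 0 <= t <= 1 -> is_derive t 1 f (df t)) ->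
  (forall t, 0 <= t <= 1 -> `|df t| <= c) -> `|f 1 - f 0| <= c.

Lemma segment_mvt_mx m n : segment_mvt 'M[R]_(m, n).
Proof.
move=> f df c Hd bd.
have := @dominated_increment_mx R m n f df (fun t => c *: t) (fun=> c *: 1) 0 1 ler01 Hd.
rewrite scaler0 subr0 /GRing.scale/= mulr1; apply => // t _.
have := is_derive_scalef c (@is_derive_id R R t 1).
by rewrite /GRing.scale/= mulr1.
Qed.

Lemma segment_mvt_real : segment_mvt R.
Proof.
move=> f df c Hd bd.
have := @dominated_increment R f (fun t => c *: t) df (fun=> c *: 1) 0 1 ler01 Hd.
rewrite scaler0 subr0 /GRing.scale/= mulr1; apply => // t _.
have := is_derive_scalef c (@is_derive_id R R t 1).
by rewrite /GRing.scale/= mulr1.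
Qed.

Lemma is_derive_line n (y w : 'cV[R]_n) (t : R) : is_derive t 1 (fun s => y + s *: w) w.
Proof.
apply/is_deriveP => e e0; exists 1 => // h _.
by rewrite scalerDl addrA [_ - (y + _)]addrC addKr subrr normr0 mulr_ge0// ltW.
Qed.

Lemma ball_convex n (q y y' : 'cV[R]_n) (d s : R) : 0 <= s <= 1 ->
  `|y - q| < d -> `|y' - q| < d -> `|y' + s *: (y - y') - q| < d.
Proof.
move=> /andP[s0 s1] yd yd'.
have -> : y' + s *: (y - y') - q = s *: (y - q) + (1 - s) *: (y' - q).
  rewrite scalerBl scale1r !scalerBr opprB addrACA -addrA addrC addrA.
  by rewrite [RHS]addrC; apply/matrixP => i j; rewrite !mxE; ring.
rewrite (le_lt_trans (ler_normD _ _))// !normrZ (ger0_norm s0) ger0_norm ?subr_ge0//.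
have [->|sn] := eqVneq s 0; first by rewrite mul0r add0r subr0 mul1r.
have sp : 0 < s by rewrite lt_def sn.
rewrite (_ : d = s * d + (1 - s) * d); last by ring.
by rewrite ltr_leD// ?ltr_pM2l// ler_wpM2l ?subr_ge0// ltW.
Qed.

Lemma partial_vanishing (W : normedModType R) (F : R -> 'cV[R]_3 -> W) i :
  vanishes_at_0 F -> vanishes_at_0 (fun e => partial i (F e)).
Proof.
move=> F0 x x0; rewrite /partial (@near_eq_derive _ _ _ _ (fun=> 0))//.
  by rewrite derive_cst.
apply/near_normP; exists `|x|; first by rewrite normr_gt0.
move=> y yx; apply: F0; apply: contraTneq yx => ->.
by rewrite sub0r normrN ltxx.
Qed.

Lemma smooth_continuous0 (W : normedModType R) (eps0 : R) (F : R -> 'cV[R]_3 -> W) (q : 'cV[R]_3) : 0 < eps0 ->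
  smooth_in_eps eps0 F -> vanishes_at_0 F -> q != 0 ->
  forall kap : R, 0 < kap -> \forall p \near (0 : R, q), `|F p.1 p.2| <= kap.
Proof.
move=> e0 sF F0 q0 kap kap0; have [|_] := sF 0%N 0 q _ q0; first by rewrite normr0.
move=> /cvgrPdist_le /(_ kap kap0); apply: filterS => p /=.
by rewrite F0// sub0r normrN.
Qed.

(** The partial derivatives vanish at eps = 0 and are jointly continuous in (eps, x), so near (0, q)
    they are uniformly small and the family is Lipschitz there with a small constant; the strict
    derivative is 0. The bound kap / 3 accounts for the three partials. *)
Lemma sdiff_base (W : normedModType R) (eps0 : R) (F : R -> 'cV[R]_3 -> W) (q : 'cV[R]_3) : segment_mvt W ->
  0 < eps0 -> (forall eps x, `|eps| < eps0 -> x != 0 -> differentiable (F eps) x) ->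
  smooth_in_eps eps0 F -> (forall i, smooth_in_eps eps0 (fun e => partial i (F e))) ->
  vanishes_at_0 F -> q != 0 -> sdiff F q (fun=> 0).
Proof.
move=> mvt e0 dF sF sdF F0 q0; split; first by exists 0 => // v; rewrite normr0 mul0r.
move=> kap kap0; have N1 := smooth_continuous0 e0 sF F0 q0 kap0.
have k3 : 0 < kap / 3 by rewrite divr_gt0.
have N2 : \forall p \near (0 : R, q), forall i, `|partial i (F p.1) p.2| <= kap / 3.
  have H i := smooth_continuous0 e0 (sdF i) (partial_vanishing i F0) q0 k3.
  exact: (filter_forall _ H).
have /near_normP[d d0 Hd] : \forall p \near (0 : R, q), `|F p.1 p.2| <= kap /\
    forall i, `|partial i (F p.1) p.2| <= kap / 3.
  by apply: filterS2 N1 N2.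
have {}Hd eps y : `|eps| < d -> `|y - q| < d -> `|F eps y| <= kap /\
    forall i, `|partial i (F eps) y| <= kap / 3.
  move=> ed yd; apply: (Hd (eps, y)).
  by rewrite prod_normE/= subr0 gt_max ed.
exists (Num.min d (Num.min eps0 `|q|)); first by rewrite !lt_min d0 e0 normr_gt0.
move=> eps; rewrite !lt_min => /and3P[ed ee _]; split.
  by rewrite F0// subr0; have [] := Hd eps q ed; rewrite ?subrr ?normr0.
move=> y y'; rewrite !lt_min subr0 => /and3P[y1 _ y2] /and3P[y1' _ y2'].
(* The segment stays within distance [|q|] of [q], hence avoids the origin, where nothing is assumed
   on the family. *)
pose c (s : R) := y' + s *: (y - y').
have D (t : R) : is_derive t 1 c (y - y').
exact: is_derive_line.
have H := mvt (fun s => F eps (c s)) (fun t => \sum_i (y - y') i 0 *: partial i (F eps) (c t))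
  (kap * `|y - y'|).
move: H; rewrite /c scale1r scale0r addr0 subrKC; apply => t t01.
  apply: (@is_derive_along _ _ (F eps) c) => //; apply: dF => //.
  have := ball_convex t01 y2 y2'; rewrite -/(c t); apply: contraTneq => ->.
  by rewrite sub0r normrN ltxx.
have [_ bp] := Hd eps (c t) ed (ball_convex t01 y1 y1').
rewrite (le_trans (ler_norm_sum _ _ _))//.
apply: (@le_trans _ _ (\sum_(i < 3) (kap / 3 * `|y - y'|))).
  by apply: ler_sum => i _; rewrite normrZ mulrC ler_pM// mxnorm_ge.
by rewrite !big_ord_recl big_ord0; lra.
Qed.
End Families.

(** * The perturbed Hamiltonian field *)

Section StrictCalculus.
Context {R : realType}.

Lemma sdiff_coord n m (F : R -> 'cV[R]_n -> 'cV[R]_m) q L i : sdiff F q L ->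
  sdiff (fun e y => F e y i 0) q (fun v => L v i 0).
Proof.
apply: (@sdiff_post _ _ _ _ (fun u : 'cV[R]_m => u i 0) 1) => //.
  by move=> u v; rewrite !mxE.
by move=> u; rewrite mul1r mxnorm_ge.
Qed.

Lemma sdiff_col n m (F : 'I_m -> R -> 'cV[R]_n -> R) q L : (forall i, sdiff (F i) q (L i)) ->
  sdiff (fun e y => \col_i F i e y) q (fun v => \col_i L i v).
Proof.
move=> H.
have E (r : 'I_m -> R) : \col_i r i = \sum_i r i *: (delta_mx i 0 : 'cV[R]_m).
  by rewrite {1}[LHS]cv_sum_delta; apply: eq_bigr => i _; rewrite mxE.
under [F in sdiff F]eq_fun do under eq_fun do rewrite E.
under [F in sdiff _ _ F]eq_fun do rewrite E.
apply: sdiff_sum => i.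
apply: (@sdiff_post _ _ _ _ (fun u : R => u *: (delta_mx i 0 : 'cV[R]_m)) `|delta_mx i 0 : 'cV[R]_m|) => //.
  by move=> u v; rewrite scalerBl.
by move=> u; rewrite normrZ mulrC.
Qed.

Lemma sdiff_dot n m (F F' : R -> 'cV[R]_n -> 'cV[R]_m) q L L' : sdiff F q L -> sdiff F' q L' ->
  sdiff (fun e y => dot (F e y) (F' e y)) q
    (fun v => dot (F 0 q) (L' v) + dot (L v) (F' 0 q)).
Proof.
move=> HF HF'; apply: (@sdiff_ext _ _ _ _ _ (fun v => \sum_i (F 0 q i 0 *: L' v i 0 + L v i 0 *: F' 0 q i 0))).
  by move=> v; rewrite big_split.
by apply: sdiff_sum => i; apply: sdiffZ; exact: sdiff_coord.
Qed.

Lemma sdiff_id n (q : 'cV[R]_n) : sdiff (fun _ y => y) q id.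
Proof.
split; first by exists 1 => // v; rewrite mul1r.
move=> kap kap0; exists 1 => // eps _; rewrite subrr normr0 ltW//; split=> // y y' _ _.
by rewrite subrr normr0 mulr_ge0// ltW.
Qed.

Lemma sdiff_mulmx n m p (P : 'M[R]_(m, n)) (F : R -> 'cV[R]_p -> 'cV[R]_n) q L : sdiff F q L ->
  sdiff (fun e y => P *m F e y) q (fun v => P *m L v).
Proof.
apply: (@sdiff_post _ _ _ _ (fun u => P *m u) (n%:R * `|P|)); first exact: mulr_ge0.
  by move=> u v; rewrite mulmxBr.
by move=> u; exact: mulmx_norm.
Qed.

Lemma sdiffB n (W : normedModType R) (F F' : R -> 'cV[R]_n -> W) q L L' :
  sdiff F q L -> sdiff F' q L' ->
  sdiff (fun e y => F e y - F' e y) q (fun v => L v - L' v).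
Proof.
move=> HF HF'; apply: sdiffD => //.
apply: (@sdiff_post _ _ _ _ (fun u : W => - u) 1) HF' => //.
  by move=> u v; rewrite opprB opprK addrC.
by move=> u; rewrite normrN mul1r.
Qed.

(** Jacobian of p |-> k(<p, p>) p when [kd] is the derivative of [k]. *)
Definition radmx (k kd : R -> R) d (p : 'cV[R]_d) : 'M[R]_d :=
  k (dot p p) *: 1%:M + (2 * kd (dot p p)) *: (p *m p^T).

Lemma radmxE k kd d (p w : 'cV[R]_d) :
  radmx k kd p *m w = k (dot p p) *: w + (2 * kd (dot p p) * dot p w) *: p.
Proof.
rewrite /radmx mulmxDl -!scalemxAl mul1mx -mulmxA; congr (_ + _).
by rewrite [p^T *m w]mx11_scalar -dotE mul_mx_scalar scalerA.
Qed.

Lemma radmx_tr k kd d (p : 'cV[R]_d) : (radmx k kd p)^T = radmx k kd p.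
Proof. by rewrite /radmx linearD/= !linearZ/= trmx1 trmx_mul trmxK. Qed.

Lemma sdiff_radial n d k kd (F : R -> 'cV[R]_n -> 'cV[R]_d) q L :
  C1_at k kd (dot (F 0 q) (F 0 q)) -> sdiff F q L ->
  sdiff (fun e y => k (dot (F e y) (F e y)) *: F e y) q (fun v => radmx k kd (F 0 q) *m L v).
Proof.
move=> Hk HF; have Hs := sdiff_comp Hk (sdiff_dot HF HF).
apply: sdiff_ext (sdiffZ Hs HF) => v; rewrite radmxE; congr (_ + _ *: _).
by rewrite [dot (L v) _]dotC; ring.
Qed.

Lemma usubmxE m1 m2 (z : 'cV[R]_(m1 + m2)) : usubmx z = row_mx 1%:M 0 *m z.
Proof. by rewrite -{2}(vsubmxK z) mul_row_col mul1mx mul0mx addr0. Qed.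

Lemma dsubmxE m1 m2 (z : 'cV[R]_(m1 + m2)) : dsubmx z = row_mx 0 1%:M *m z.
Proof. by rewrite -{2}(vsubmxK z) mul_row_col mul1mx mul0mx add0r. Qed.

Lemma sdiff_col_mx n m1 m2 (F : R -> 'cV[R]_n -> 'cV[R]_m1) (F' : R -> 'cV[R]_n -> 'cV[R]_m2) q L L' :
  sdiff F q L -> sdiff F' q L' ->
  sdiff (fun e y => col_mx (F e y) (F' e y)) q (fun v => col_mx (L v) (L' v)).
Proof.
have E (u : 'cV[R]_m1) (w : 'cV[R]_m2) : col_mx u w = col_mx 1%:M 0 *m u + col_mx 0 1%:M *m w.
  by rewrite !mul_col_mx !mul1mx !mul0mx add_col_mx addr0 add0r.
move=> HF HF'.
under [F in sdiff F]eq_fun do under eq_fun do rewrite E.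
under [F in sdiff _ _ F]eq_fun do rewrite E.
by apply: sdiffD; exact: sdiff_mulmx.
Qed.

Lemma sdiff_usubmx n m (W : normedModType R) (F : R -> 'cV[R]_n -> W) (q : 'cV[R]_(n + m)) L :
  sdiff F (usubmx q) L -> sdiff (fun e y => F e (usubmx y)) q (fun v => L (usubmx v)).
Proof.
rewrite usubmxE => /sdiff_pre.
by under [F in sdiff F]eq_fun do under eq_fun do rewrite -usubmxE;
   under [F in sdiff _ _ F]eq_fun do rewrite -usubmxE.
Qed.

Lemma continuous_enorm n (p : 'cV[R]_n) : {for p, continuous (@enorm R n)}.
Proof.
have -> : @enorm R n = fun v => Num.sqrt (dot v v) by apply/funext => v; rewrite enormE.
apply: (continuous_comp (g := Num.sqrt)); last exact: sqrt_continuous.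
by apply: continuous_dot => //; exact: cvg_id.
Qed.

End StrictCalculus.

Section Fields.
Context {R : realType}.
Variables (a b : \bar R) (f V : R -> R).
Hypotheses (hphi : phi_assumptions a b f) (hV : C2_on_positive V).

(** Zero momentum is excluded because [f] is C^1 only away from 0, so that [psi] need not be
    differentiable there. *)
Definition regular_phase d (z : 'cV[R]_(d + d)) :=
  [/\ usubmx z != 0, dsubmx z != 0 & eball b (dsubmx z)].

Definition central_field d (z : 'cV[R]_(d + d)) : 'cV[R]_(d + d) :=
  col_mx (psi a f (dsubmx z)) (kV V (dot (usubmx z) (usubmx z)) *: usubmx z).

Definition central_jacobian d (z : 'cV[R]_(d + d)) : 'M[R]_(d + d) :=
  block_mx 0 (radmx (kpsi a f) (dkpsi a f) (dsubmx z)) (radmx (kV V) (dkV V) (usubmx z)) 0.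

Lemma central_jacobianE d (z v : 'cV[R]_(d + d)) : central_jacobian z *m v =
  col_mx (radmx (kpsi a f) (dkpsi a f) (dsubmx z) *m dsubmx v)
         (radmx (kV V) (dkV V) (usubmx z) *m usubmx v).
Proof. by rewrite -{1}(vsubmxK v) mul_block_col !mul0mx add0r addr0. Qed.

Lemma is_derive_kinetic d (p : R -> 'cV[R]_d) dp (t : R) : p t != 0 -> eball b (p t) ->
  is_derive t 1 p dp ->
  is_derive t 1 (fun s => G a f (enorm (p s))) (dot (psi a f (p t)) dp).
Proof.
move=> p0 pb Dp; have e0 := enorm_gt0 p0.
have e0' : Num.sqrt (dot (p t) (p t)) != 0 by rewrite -enormE gt_eqF.
have S := is_derive_compf (is_derive1_sqrt (dot_gt0 p0)) (is_derive_dot Dp Dp).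
have DG := is_derive_G hphi e0 pb; rewrite enormE in DG.
have C := @is_derive_compf R R (G a f) (fun s => Num.sqrt (dot (p s) (p s))) t _ _ DG S.
apply: is_derive_ext C => [s|]; first by rewrite enormE.
rewrite /psi dotZl /kpsi /radial_coef [dot dp _]dotC /GRing.scale/=.
by field.
Qed.

Lemma is_derive_potential d (x : R -> 'cV[R]_d) dx (t : R) : x t != 0 ->
  is_derive t 1 x dx ->
  is_derive t 1 (fun s => V (enorm (x s))) (dot (kV V (dot (x t) (x t)) *: x t) dx).
Proof.
move=> x0 Dx; have e0 := enorm_gt0 x0.
have e0' : Num.sqrt (dot (x t) (x t)) != 0 by rewrite -enormE gt_eqF.
have S := is_derive_compf (is_derive1_sqrt (dot_gt0 x0)) (is_derive_dot Dx Dx).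
have DV : is_derive (enorm (x t)) 1 V (derive1 V (enorm (x t))).
  have [dV _ _] := hV e0; rewrite derive1E; exact/derivableP.
rewrite enormE in DV.
have C := @is_derive_compf R R V (fun s => Num.sqrt (dot (x s) (x s))) t _ _ DV S.
apply: is_derive_ext C => [s|]; first by rewrite enormE.
rewrite dotZl /kV /radial_coef [dot dx _]dotC /GRing.scale/=.
by field.
Qed.

Lemma dot_col_mx m1 m2 (u u' : 'cV[R]_m1) (w w' : 'cV[R]_m2) :
  dot (col_mx u w) (col_mx u' w') = dot u u' + dot w w'.
Proof.
rewrite /dot big_split_ord/=; congr (_ + _); apply: eq_bigr => i _.
  by rewrite !col_mxEu.
by rewrite !col_mxEd.
Qed.

Lemma J_col_mx d (u w : 'cV[R]_d) : J d *m col_mx u w = col_mx (- w) u.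
Proof. by rewrite /J mul_block_col !mul0mx mulNmx !mul1mx add0r addr0. Qed.

Lemma is_derive_submx m1 m2 (z : R -> 'cV[R]_(m1 + m2)) dz (t : R) : is_derive t 1 z dz ->
  is_derive t 1 (fun s => usubmx (z s)) (usubmx dz) /\
  is_derive t 1 (fun s => dsubmx (z s)) (dsubmx dz).
Proof.
move=> D; split.
  by rewrite usubmxE; apply: is_derive_ext (is_derive_mulmxl _ D) => // s; rewrite usubmxE.
by rewrite dsubmxE; apply: is_derive_ext (is_derive_mulmxl _ D) => // s; rewrite dsubmxE.
Qed.

Lemma is_derive_H0 d (z : R -> 'cV[R]_(d + d)) dz (t : R) : regular_phase (z t) ->
  is_derive t 1 z dz ->
  is_derive t 1 (fun s => H0 a f V (z s)) (dot (J d *m central_field (z t)) dz).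
Proof.
move=> [x0 p0 pb] /is_derive_submx[Dx Dp].
have := is_derive_subf (is_derive_kinetic p0 pb Dp) (is_derive_potential x0 Dx).
apply: is_derive_ext => //.
by rewrite -[in RHS](vsubmxK dz) J_col_mx dot_col_mx dotNl addrC.
Qed.

Variables (eps0 : R) (U : R -> 'cV[R]_3 -> R) (A : R -> 'cV[R]_3 -> 'cV[R]_3).
Hypotheses (heps0 : 0 < eps0).
Hypotheses (hU : smooth_family_C2 eps0 U) (hA : smooth_family_C2 eps0 A).
Hypotheses (hU0 : vanishes_at_0 U) (hA0 : vanishes_at_0 A).

Definition kinetic_momentum eps (z : 'cV[R]_(3 + 3)) := dsubmx z - A eps (usubmx z).

Definition full_field eps (z : 'cV[R]_(3 + 3)) : 'cV[R]_(3 + 3) :=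
  let v := psi a f (kinetic_momentum eps z) in let x := usubmx z in
  col_mx v (kV V (dot x x) *: x + gradient (U eps) x + \col_i dot v (partial i (A eps) x)).

(** [A 0] and [U 0] vanish only away from x = 0. Taking the central field itself at eps = 0 makes
    the rotation invariance hold at every point, as the reduction requires; the same applies to
    [ham]. *)
Definition field eps z := if eps == 0 then central_field z else full_field eps z.

Definition full_H eps (z : 'cV[R]_(3 + 3)) :=
  G a f (enorm (kinetic_momentum eps z)) - V (enorm (usubmx z)) - U eps (usubmx z).

Definition ham eps z := if eps == 0 then H0 a f V z else full_H eps z.

Lemma full_field0 z : usubmx z != 0 -> full_field 0 z = central_field z.
Proof.
move=> z0; rewrite /full_field /central_field /kinetic_momentum (hA0 z0) subr0.
have -> : gradient (U 0) (usubmx z) = 0.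
  by apply/matrixP => i j; rewrite !mxE (partial_vanishing i hU0).
rewrite addr0; have -> : \col_i dot (psi a f (dsubmx z)) (partial i (A 0) (usubmx z)) = 0.
  by apply/matrixP => i j; rewrite !mxE (partial_vanishing i hA0)// dot0r.
by rewrite addr0.
Qed.

Lemma full_H0 z : usubmx z != 0 -> full_H 0 z = H0 a f V z.
Proof. by move=> z0; rewrite /full_H /kinetic_momentum hA0// hU0// !subr0. Qed.

Lemma fieldE eps z : usubmx z != 0 -> field eps z = full_field eps z.
Proof. by move=> z0; rewrite /field; case: eqP => // ->; rewrite full_field0. Qed.

Lemma hamE eps z : usubmx z != 0 -> ham eps z = full_H eps z.
Proof. by move=> z0; rewrite /ham; case: eqP => // ->; rewrite full_H0. Qed.

Lemma sdiff_A (x : 'cV[R]_3) : x != 0 -> sdiff A x (fun=> 0).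
Proof.
move=> x0; have [dA sA sdA _] := hA.
refine (sdiff_base (@segment_mvt_mx R 3 1) heps0 _ sA sdA hA0 x0).
by move=> e y ee y0; have [dy _] := dA e y ee y0; exact: dy.
Qed.

Lemma sdiff_dA (x : 'cV[R]_3) i : x != 0 -> sdiff (fun e => partial i (A e)) x (fun=> 0).
Proof.
move=> x0; have [dA sA sdA sddA] := hA.
refine (sdiff_base (@segment_mvt_mx R 3 1) heps0 _ (sdA i) (fun j => sddA j i)
  (partial_vanishing i hA0) x0).
by move=> e y ee y0; have [_] := dA e y ee y0; exact.
Qed.

Lemma sdiff_U (x : 'cV[R]_3) : x != 0 -> sdiff U x (fun=> 0).
Proof.
move=> x0; have [dU sU sdU _] := hU.
refine (sdiff_base (@segment_mvt_real R) heps0 _ sU sdU hU0 x0).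
by move=> e y ee y0; have [dy _] := dU e y ee y0; exact: dy.
Qed.

Lemma sdiff_dU (x : 'cV[R]_3) i : x != 0 -> sdiff (fun e => partial i (U e)) x (fun=> 0).
Proof.
move=> x0; have [dU sU sdU sddU] := hU.
refine (sdiff_base (@segment_mvt_real R) heps0 _ (sdU i) (fun j => sddU j i)
  (partial_vanishing i hU0) x0).
by move=> e y ee y0; have [_] := dU e y ee y0; exact.
Qed.

Lemma sdiff_momentum z : usubmx z != 0 -> sdiff kinetic_momentum z (fun v => dsubmx v).
Proof.
move=> z0.
have H1 : sdiff (fun _ (y : 'cV[R]_(3 + 3)) => dsubmx y) z (fun v => dsubmx v).
  under [F in sdiff F]eq_fun do under eq_fun do rewrite dsubmxE.
  under [F in sdiff _ _ F]eq_fun do rewrite dsubmxE.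
  exact: sdiff_mulmx (sdiff_id z).
apply: sdiff_ext (sdiffB H1 (sdiff_usubmx (sdiff_A z0))) => v.
by rewrite subr0.
Qed.

Lemma usubmx_neq0_near m1 m2 (z : 'cV[R]_(m1 + m2)) : usubmx z != 0 ->
  exists2 d : R, 0 < d & forall y, `|y - z| < d -> usubmx y != 0.
Proof.
move=> z0; exists `|usubmx z|; first by rewrite normr_gt0.
move=> y; apply: contraTneq => y0; rewrite -leNgt.
apply: cvnormP => // i; rewrite (le_trans _ (mxnorm_ge (y - z) (lshift m2 i) 0))//.
have : usubmx y i 0 = 0 by rewrite y0 mxE.
by rewrite !mxE => ->; rewrite sub0r normrN.
Qed.

Lemma sdiff_field z : regular_phase z -> sdiff field z (fun v => central_jacobian z *m v).
Proof.
move=> [x0 p0 pb].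
have K0 : kinetic_momentum 0 z = dsubmx z by rewrite /kinetic_momentum hA0// subr0.
have [d d0 Hd] := usubmx_neq0_near x0.
apply: (@sdiff_congr _ _ _ full_field _ _ _ d d0) => [e y _ yd|]; first by rewrite fieldE// Hd.
apply: (@sdiff_ext _ _ _ _ _ (fun v => col_mx
  (radmx (kpsi a f) (dkpsi a f) (dsubmx z) *m dsubmx v)
  (radmx (kV V) (dkV V) (usubmx z) *m usubmx v + 0 + 0))).
  by move=> v; rewrite central_jacobianE !addr0.
have Sv : sdiff (fun e y => psi a f (kinetic_momentum e y)) z
    (fun v => radmx (kpsi a f) (dkpsi a f) (dsubmx z) *m dsubmx v).
  rewrite -K0; apply: sdiff_radial (sdiff_momentum x0).
  by rewrite K0; apply: (C1_kpsi hphi).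
apply: sdiff_col_mx => //; apply: sdiffD; first apply: sdiffD.
- have := @sdiff_radial R _ _ (kV V) (dkV V) _ z _ _ (sdiff_usubmx (sdiff_id (usubmx z))).
  by apply; exact: C1_kV.
- apply: (@sdiff_ext _ _ _ _ _ (fun v => \col_i 0)).
    by move=> v; apply/matrixP => i j; rewrite !mxE.
  by apply: sdiff_col => i; exact: (sdiff_usubmx (sdiff_dU i x0)).
- apply: (@sdiff_ext _ _ _ _ _ (fun v => \col_i (dot (psi a f (kinetic_momentum 0 z)) 0 + 
     dot (radmx (kpsi a f) (dkpsi a f) (dsubmx z) *m dsubmx v) (partial i (A 0) (usubmx z))))).
    move=> v; apply/matrixP => i j; rewrite !mxE (partial_vanishing i hA0)//.
    by rewrite !dot0r addr0.
  apply: sdiff_col => i; exact: (sdiff_dot Sv (sdiff_usubmx (sdiff_dA i x0))).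
Qed.

End Fields.

(** * Uniformity along the orbit of the group *)

Section Uniformity.
Context {R : realType}.

(** Compactness in its near-covering form. The property is required for every smaller [d'], so that
    the finitely many local radii can be replaced by their minimum. *)
Lemma uniform_near (W : normedModType R) (K : set W) (P : R -> W -> Prop) : compact K ->
  (forall q, K q -> exists2 d : R, 0 < d & forall (d' : R) q', 0 < d' < d -> `|q' - q| < d -> P d' q') ->
  exists2 d : R, 0 < d & forall (d' : R) q, 0 < d' < d -> K q -> P d' q.
Proof.
move=> /compact_near_coveringP cK H.
have := cK R (within (fun d : R => 0 < d) (nbhs (0 : R))) P _.
case=> [q /H[d d0 Hd]|d d0 Hd].
  exists ([set q' | `|q' - q| < d], [set d' | 0 < d' < d]).
    split; first by apply/near_normP; exists d.
    have H1 : \forall d' \near (0 : R), 0 < d' -> 0 < d' < d.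
      by apply/near_normP; exists d => // d'; rewrite subr0 => dd d'0; rewrite d'0 (le_lt_trans (ler_norm _) dd).
    exact: H1.
  by move=> [q' d'] /= [q'd d'd]; exact: Hd.
exists d => // d' q /andP[d'0 d'd] Kq.
by apply: (Hd d') => //=; rewrite sub0r normrN gtr0_norm.
Qed.

Lemma compact_cball n (r : R) : compact [set w : 'cV[R]_n | `|w| <= r].
Proof.
have -> : [set w : 'cV[R]_n | `|w| <= r] = (fun v : 'rV[R]_n => v^T) @` [set v | `|v| <= r].
  apply/seteqP; split => [w /= wr|_ [v /= vr <-]]; last by rewrite /= norm_trmx.
  by exists w^T; rewrite ?trmxK//= norm_trmx.
apply: continuous_compact.
  apply: continuous_subspaceT => v; apply: continuous_mxP => i j.
  rewrite (_ : (fun x : 'rV[R]_n => x^T i j) = fun x => x j i); last by apply/funext => x; rewrite mxE.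
  by apply: continuous_coord; exact: cvg_id.
apply: bounded_closed_compact.
  exists r; split; first exact: num_real.
  by move=> x rx v /= vr; exact: le_trans vr (ltW rx).
apply: (@closed_comp _ _ (fun v : 'rV[R]_n => `|v|) [set x | x <= r]); last exact: closed_le.
by move=> v _; exact: norm_continuous.
Qed.

Lemma continuous_mulmx m n (T : topologicalType) (M : T -> 'M[R]_(m, n)) (v : T -> 'cV[R]_n) t :
  {for t, continuous M} -> {for t, continuous v} -> {for t, continuous (fun s => M s *m v s)}.
Proof.
move=> cM cv; apply: continuous_mxP => i j; rewrite ord1.
rewrite (_ : (fun x => _) = fun x => dot (row i (M x))^T (v x)).
  apply: continuous_dot; last exact: cv.
  apply: continuous_mxP => k l.
  rewrite (_ : (fun x => _) = fun x => M x i k); first exact: continuous_coord.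
  by apply/funext => x; rewrite !mxE.
by apply/funext => x; rewrite dotE trmxK -row_mul [RHS]mxE.
Qed.

Variables (N : nat) (Jm : 'M[R]_N) (X : R -> 'cV[R]_N -> 'cV[R]_N) (H : R -> 'cV[R]_N -> R).
Variables (z : R -> 'cV[R]_N) (h : R) (GG : set 'M[R]_N) (Rg : set 'cV[R]_N).
Variables (Ad : 'cV[R]_N -> 'M[R]_N) (Lam : R).
Hypothesis Lam1 : 1 <= Lam.
Hypothesis Rg_open : forall q, Rg q -> exists2 d : R, 0 < d & forall y, `|y - q| < d -> Rg y.
Hypothesis X_sdiff : forall q, Rg q -> sdiff X q (fun v => Ad q *m v).
Hypothesis H_taylor : forall q, Rg q -> exists2 C : R, 0 < C & exists2 d : R, 0 < d &
  forall e y y', `|e| < d -> `|y - q| < d -> `|y' - q| < d ->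
    `|H e y' - H e y - dot (Jm *m X e y) (y' - y)| <= C * `|y' - y| ^+ 2.
Hypothesis H_near : forall q, Rg q -> forall kap : R, 0 < kap -> exists2 d : R, 0 < d &
  forall e y, `|e| < d -> `|y - q| < d -> `|H e y - H 0 y| <= kap.
Hypothesis zC : continuous z.
Hypothesis zp : periodic_with 1 z.
Hypothesis GGc : compact GG.
Hypothesis GG1 : GG 1%:M.
Hypothesis zRg : forall g t, GG g -> Rg (g *m z t).
Hypothesis AdC : continuous (fun t => Ad (z t)).
Hypothesis zH : forall g, GG g -> H 0 (g *m z 0) = h.

(** A closed neighbourhood of the group orbit of [z], parametrized by a compact product; one period
    of times suffices. *)
Definition orbit_tube (rho : R) : set 'cV[R]_N :=
  [set y | exists g t w, [/\ GG g, 0 <= t <= 1, `|w| <= rho & y = g *m z t + w]].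

Lemma orbit_tube_compact rho : compact (orbit_tube rho).
Proof.
have -> : orbit_tube rho = (fun p : 'M[R]_N * (R * 'cV[R]_N) => p.1 *m z p.2.1 + p.2.2) @`
    (GG `*` (`[0, 1] `*` [set w | `|w| <= rho])).
  apply/seteqP; split => [y [g [t [w [Gg t01 wr ->]]]]|_ [[g [t w]] [/= Gg [t01 wr]] <-]].
    by exists (g, (t, w)) => //; split => //; split => //=; rewrite in_itv.
  by exists g, t, w; split => //; move: t01; rewrite /= in_itv.
apply: continuous_compact; last first.
  by apply: compact_setX => //; apply: compact_setX; [exact: segment_compact|exact: compact_cball].
apply: continuous_subspaceT => p; apply: cvgD.
  apply: continuous_mulmx; first exact: cvg_fst.
  apply: (@continuous_comp _ _ _ (fun p : 'M[R]_N * (R * 'cV[R]_N) => p.2.1) z); last exact: zC.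
  apply: (@continuous_comp _ _ _ (fun p : 'M[R]_N * (R * 'cV[R]_N) => p.2) fst); [exact: cvg_snd|exact: cvg_fst].
apply: (@continuous_comp _ _ _ (fun p : 'M[R]_N * (R * 'cV[R]_N) => p.2) snd); exact: cvg_snd.
Qed.

Lemma orbit_tube0 g t : GG g -> orbit_tube 0 (g *m z t).
Proof.
have [s s01 /(_ _ z zp) ->] := periodic_reduce t.
by move=> Gg; exists g, s, 0; rewrite normr0 addr0.
Qed.

Lemma orbit_tubeP rho g t y : GG g -> `|y - g *m z t| <= rho -> orbit_tube rho y.
Proof.
have [s s01 /(_ _ z zp) ->] := periodic_reduce t.
by move=> Gg yr; exists g, s, (y - g *m z s); split => //; rewrite subrKC.
Qed.

Lemma orbit_tube0_regular q : orbit_tube 0 q -> Rg q.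
Proof.
by move=> [g [t [w [Gg _ w0 ->]]]]; move: w0; rewrite normr_le0 => /eqP ->; rewrite addr0; exact: zRg.
Qed.

Lemma orbit_tube_regular : exists2 rho : R, 0 < rho & forall q, orbit_tube rho q -> Rg q.
Proof.
have [|d d0 Hd] := @uniform_near _ _ (fun d q => forall y, `|y - q| < d -> Rg y) (@orbit_tube_compact 0).
  move=> q /orbit_tube0_regular/Rg_open[d d0 Hd]; exists (d / 2); first by rewrite divr_gt0.
  move=> d' q' /andP[_ d'd] q'd y yd'; apply: Hd.
  rewrite -(subrKA q') (le_lt_trans (ler_normD _ _))//; lra.
exists (d / 4); first by rewrite divr_gt0.
move=> _ [g [t [w [Gg t01 wr ->]]]]; apply: (Hd (d / 2) (g *m z t)).
- by rewrite divr_gt0//= ltr_pdivrMr//; lra.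
- exact: orbit_tube0.
- by rewrite addrAC subrr add0r (le_lt_trans wr)//; lra.
Qed.

(** [X eps] and [X 0] are strictly differentiable at [q] with the same derivative, which cancels in
    the difference. *)
Lemma field_lipschitz_uniform kap : 0 < kap -> exists2 d : R, 0 < d & forall eps q y y',
  orbit_tube 0 q -> `|eps| < d -> `|y - q| < d -> `|y' - q| < d ->
  `|X eps y - X 0 y - (X eps y' - X 0 y')| <= kap * `|y - y'|.
Proof.
move=> kap0; have [|d d0 Hd] := @uniform_near _ _ (fun d q => forall eps y y', `|eps| < d ->
  `|y - q| < d -> `|y' - q| < d ->
  `|X eps y - X 0 y - (X eps y' - X 0 y')| <= kap * `|y - y'|) (@orbit_tube_compact 0).
  move=> q /orbit_tube0_regular/X_sdiff[_ /(_ (kap / 2))[|d d0 Hd]]; first by rewrite divr_gt0.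
  exists (d / 2); first by rewrite divr_gt0.
  move=> d' q' /andP[d'0 d'd] q'd eps y y' ed yd y'd.
  have inD x : `|x - q'| < d' -> `|x - q| < d.
    by move=> xd; rewrite -(subrKA q') (le_lt_trans (ler_normD _ _))//; lra.
  have [|_ /(_ _ _ (inD _ yd) (inD _ y'd)) H1] := Hd eps; first lra.
  have [|_ /(_ _ _ (inD _ yd) (inD _ y'd)) H2] := Hd 0; first by rewrite normr0.
  have -> : X eps y - X 0 y - (X eps y' - X 0 y') =
    (X eps y - X eps y' - Ad q *m (y - y')) - (X 0 y - X 0 y' - Ad q *m (y - y')).
    by move: (Ad q *m _) => u; apply/matrixP => i j; rewrite !mxE; ring.
  by rewrite (le_trans (ler_normB _ _))// [kap]splitr mulrDl lerD.
exists (d / 2); first by rewrite divr_gt0.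
move=> eps q y y' Kq ed yd y'd; apply: (Hd (d / 2) q) => //.
by rewrite divr_gt0//=; lra.
Qed.

Lemma field_small_uniform rho del : (forall q, orbit_tube rho q -> Rg q) -> 0 < del ->
  exists2 d : R, 0 < d & forall eps q, orbit_tube rho q -> `|eps| < d ->
    `|X eps q - X 0 q| <= del /\ `|H eps q - H 0 q| <= del.
Proof.
move=> Hrho del0; have [|d d0 Hd] := @uniform_near _ _ (fun d q => forall eps, `|eps| < d ->
  `|X eps q - X 0 q| <= del /\ `|H eps q - H 0 q| <= del) (@orbit_tube_compact rho).
  move=> q /Hrho Rq; have [|d d0 Hd] := sdiff_near (X_sdiff Rq) (kap := del / 2).
    by rewrite divr_gt0.
  have [d1 d10 Hd1] := H_near Rq del0.
  exists (Num.min d d1); first by rewrite lt_min d0.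
  move=> d' q'; rewrite !lt_min => /and3P[d'0 d'd d'd1] /andP[q'd q'd1] eps ed.
  split; last by apply: Hd1 => //; exact: lt_trans ed _.
  rewrite -(subrKA (X 0 q)) (le_trans (ler_normD _ _))// [del]splitr lerD//.
    by apply: Hd => //; exact: lt_trans ed _.
  by rewrite distrC; apply: Hd => //; rewrite normr0.
exists (d / 2); first by rewrite divr_gt0.
move=> eps q Kq ed; apply: (Hd (d / 2) q) => //.
by rewrite divr_gt0//=; lra.
Qed.

Lemma taylor_uniform : exists2 C : R, 0 < C & exists2 d : R, 0 < d & forall e q y y',
  orbit_tube 0 q -> `|e| < d -> `|y - q| < d -> `|y' - q| < d ->
  `|H e y' - H e y - dot (Jm *m X e y) (y' - y)| <= C * `|y' - y| ^+ 2.
Proof.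
(* The single parameter [d] encodes both the radius and the constant: decreasing it shrinks the
   domain and enlarges [d^-1], so the property is inherited by smaller values. *)
have [|d d0 Hd] := @uniform_near _ _ (fun d q => forall e y y', `|e| < d ->
  `|y - q| < d -> `|y' - q| < d ->
  `|H e y' - H e y - dot (Jm *m X e y) (y' - y)| <= d^-1 * `|y' - y| ^+ 2) (@orbit_tube_compact 0).
  move=> q /orbit_tube0_regular/H_taylor[C C0 [d d0 Hd]].
  exists (Num.min (d / 2) C^-1); first by rewrite lt_min divr_gt0// invr_gt0.
  move=> d' q'; rewrite !lt_min => /and3P[d'0 d'd d'C] /andP[q'd _] e y y' ed yd y'd.
  have inD x : `|x - q'| < d' -> `|x - q| < d.
    by move=> xd; rewrite -(subrKA q') (le_lt_trans (ler_normD _ _))//; lra.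
  rewrite (le_trans (Hd _ _ _ _ (inD _ yd) (inD _ y'd)))//; first lra.
  by rewrite ler_wpM2r ?sqr_ge0// -[C]invrK lef_pV2 ?posrE ?invr_gt0// ltW.
exists (d / 2)^-1; first by rewrite invr_gt0 divr_gt0.
exists (d / 2); first by rewrite divr_gt0.
move=> e q y y' Kq ed yd y'd; apply: (Hd (d / 2) q) => //.
by rewrite divr_gt0//=; lra.
Qed.

Lemma jacobian_uniform kap : 0 < kap -> exists2 d : R, 0 < d & forall t w w',
  `|w| < d -> `|w'| < d ->
  `|X 0 (z t + w) - X 0 (z t + w') - Ad (z t) *m (w - w')| <= kap * `|w - w'|.
Proof.
move=> kap0; have k2 : 0 < kap / 2 by rewrite divr_gt0.
have n1 : 0 < N%:R + 1 :> R by rewrite ltr_wpDl.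
have [|d d0 Hd] := @uniform_near R _ (fun d t => forall w w', `|w| < d -> `|w'| < d ->
  `|X 0 (z t + w) - X 0 (z t + w') - Ad (z t) *m (w - w')| <= kap * `|w - w'|) (@segment_compact _ 0 1).
  move=> t _; have Rt : Rg (z t) by have := zRg t GG1; rewrite mul1mx.
  have [_ /(_ _ k2)[d d0 Hd]] := X_sdiff Rt.
  have /cvgrPdist_lt /(_ (d / 2)) := @zC t; rewrite divr_gt0// => /(_ isT) /near_normP[d1 d10 H1].
  have /cvgrPdist_lt /(_ (kap / 2 / (N%:R + 1))) := @AdC t.
  rewrite divr_gt0// => /(_ isT) /near_normP[d2 d20 H2].
  exists (Num.min (d / 2) (Num.min d1 d2)); first by rewrite !lt_min divr_gt0// d10.
  move=> d' t'; rewrite !lt_min => /and4P[d'0 d'd _ _] /and3P[t1 t2 t3] w w' wd w'd.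
  have inD x : `|x| < d' -> `|z t' + x - z t| < d.
    move=> xd; rewrite addrAC (le_lt_trans (ler_normD _ _))// -(distrC (z t)).
    have := H1 _ t2; lra.
  have [|_ /(_ _ _ (inD _ wd) (inD _ w'd))] := Hd 0; first by rewrite normr0.
  have -> : z t' + w - (z t' + w') = w - w' by rewrite opprD addrACA subrr add0r.
  move=> H3.
  rewrite -(subrKA (Ad (z t) *m (w - w'))) (le_trans (ler_normD _ _))// [kap]splitr mulrDl lerD//.
  rewrite -mulmxBl (le_trans (mulmx_norm _ _))// ler_wpM2r//.
  have {}H2 := ltW (H2 _ t3).
  rewrite (le_trans (ler_wpM2l _ H2))// mulrCA ler_piMr//; first exact: ltW.
  by rewrite ler_pdivrMr// mul1r lerDl.
exists (d / 2); first by rewrite divr_gt0.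
move=> t w w' wd w'd; have [s s01 E] := periodic_reduce t; rewrite (E _ z zp).
apply: (Hd (d / 2) s) => //; rewrite divr_gt0//=; lra.
Qed.

(** [CH] comes from the second-order estimate alone and is fixed first; [r] depends on [kap] only,
    and [del] affects only the admissible [eps]. *)
Lemma tubes_exist : exists2 CH : R, 0 < CH & forall kap : R, 0 < kap <= 1 ->
  exists2 r : R, 0 < r & forall del : R, 0 < del <= kap ->
  exists2 e : R, 0 < e & forall eps, `|eps| < e ->
    tube Jm X H z h GG (fun t => Ad (z t)) Lam CH eps kap del r.
Proof.
have Lam0 : 0 < Lam := lt_le_trans ltr01 Lam1.
have [rho rho0 Hrho] := orbit_tube_regular.
have [C C0 [d1 d10 T1]] := taylor_uniform.
exists C => // kap /andP[kap0 kap1].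
have [d2 d20 T2] := field_lipschitz_uniform kap0.
have [d3 d30 T3] := jacobian_uniform kap0.
pose m := Num.min 1 (Num.min (Num.min rho d1) (Num.min d2 d3)).
have m0 : 0 < m by rewrite /m !lt_min ltr01 rho0 d10 d20.
(* The tube uses points at distance up to 2 * Lam * r = m / 2 from the orbit, strictly inside all
   the radii collected in [m]. *)
pose r := m / (4 * Lam).
have r0 : 0 < r by rewrite divr_gt0// mulr_gt0.
have E : 4 * Lam * r = m by rewrite /r mulrC divfK// gt_eqF// mulr_gt0.
have Lr : r <= Lam * r by rewrite ler_peMl// ltW.
have [m1 m2 m3 m4 m5] : [/\ m <= 1, m <= rho, m <= d1, m <= d2 & m <= d3].
  by rewrite /m !ge_min !lexx !orbT.
exists r => // del /andP[del0 delk].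
have [d4 d40 T4] := field_small_uniform Hrho del0.
exists (Num.min d4 (Num.min d1 d2)); first by rewrite !lt_min d40 d10.
move=> eps; rewrite !lt_min => /and3P[e4 e1 e2].
split.
- by split; apply/andP; split => //; [lra|exact: ltW].
- by move=> t w w' wr wr'; apply: T3; lra.
- move=> t g y y' Gg yr y'r; split.
    by apply: (T2 eps (g *m z t)) => //; [exact: orbit_tube0|lra|lra].
  by have [] := T4 eps y _ e4; first by apply: (orbit_tubeP (g := g) (t := t)) => //; lra.
- move=> e t g y y' ee Gg yr y'r; apply: (T1 e (g *m z t)) => //; [exact: orbit_tube0| |lra|lra].
  by case: ee => ->//; rewrite normr0.
- move=> g Gg; rewrite -(zH Gg).
  by have [] := T4 eps (g *m z 0) _ e4; first by apply: (orbit_tubeP (g := g) (t := 0)) => //; rewrite subrr normr0 ltW.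
Qed.

End Uniformity.

(** * Taylor expansion of the perturbed Hamiltonian *)

Section PerturbedHamiltonian.
Context {R : realType}.

Lemma dot_suml n (I : finType) (u : I -> 'cV[R]_n) v : dot (\sum_i u i) v = \sum_i dot (u i) v.
Proof. by elim/big_ind2: _ => [|w x w' x' <- <-|//]; rewrite ?dot0l ?dotDl. Qed.

Variables (a b : \bar R) (f V : R -> R).
Hypotheses (hphi : phi_assumptions a b f) (hV : C2_on_positive V).
Variables (eps0 : R) (U : R -> 'cV[R]_3 -> R) (A : R -> 'cV[R]_3 -> 'cV[R]_3).
Hypotheses (heps0 : 0 < eps0).
Hypotheses (hU : smooth_family_C2 eps0 U) (hA : smooth_family_C2 eps0 A).
Hypotheses (hU0 : vanishes_at_0 U) (hA0 : vanishes_at_0 A).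

Notation momentum := (kinetic_momentum A).
Notation X := (field a f V U A).
Notation Xf := (full_field a f V U A).
Notation H := (ham a f V U A).
Notation Hf := (full_H a f V U A).

Definition regular_at eps (z : 'cV[R]_(3 + 3)) :=
  [/\ `|eps| < eps0, usubmx z != 0, momentum eps z != 0 & eball b (momentum eps z)].

Lemma eball_near n (p : 'cV[R]_n) : p != 0 -> eball b p -> exists2 d : R, 0 < d &
  forall q, `|q - p| < d -> q != 0 /\ eball b q.
Proof.
move=> p0 pb.
have /near_normP[d d0 Hd] := continuous_enorm (near_pos_lt (enorm_gt0 p0) pb).
exists d => // q /Hd[q0 qb]; split=> //; apply: contraTneq q0 => ->.
by rewrite enormE dot0l sqrtr0 ltxx.
Qed.

Lemma momentum0 (z : 'cV[R]_(3 + 3)) : usubmx z != 0 -> momentum 0 z = dsubmx z.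
Proof. by move=> z0; rewrite /kinetic_momentum hA0// subr0. Qed.

Lemma regular_at_near (z : 'cV[R]_(3 + 3)) : regular_phase b z -> exists2 d : R, 0 < d &
  forall eps y, `|eps| < d -> `|y - z| < d -> regular_at eps y.
Proof.
move=> [x0 p0 pb]; have [d1 d10 H1] := usubmx_neq0_near x0.
have [d2 d20 H2] := eball_near p0 pb.
have [|d3 d30 H3] := sdiff_near (sdiff_momentum heps0 hA hA0 x0) (kap := d2 / 2).
  by rewrite divr_gt0.
exists (Num.min eps0 (Num.min d1 d3)); first by rewrite !lt_min heps0 d10.
move=> eps y; rewrite !lt_min => /and3P[e0 e1 e3] /and3P[_ y1 y3].
have [|? ?] := H2 (momentum eps y); last by split => //; exact: H1.
by rewrite -(momentum0 x0) (le_lt_trans (H3 _ _ e3 y3))// ltr_pdivrMr//; lra.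
Qed.

Lemma is_derive_full_H eps (z : R -> 'cV[R]_(3 + 3)) dz (t : R) : regular_at eps (z t) ->
  is_derive t 1 z dz ->
  is_derive t 1 (fun s => Hf eps (z s)) (dot (J 3 *m Xf eps (z t)) dz).
Proof.
move=> [e0 x0 p0 pb] /is_derive_submx[Dx Dp].
have dA : differentiable (A eps) (usubmx (z t)) by have [/(_ _ _ e0 x0)[]] := hA.
have dU : differentiable (U eps) (usubmx (z t)) by have [/(_ _ _ e0 x0)[]] := hU.
have DA := is_derive_along (F := A eps) (c := fun s => usubmx (z s)) dA Dx.
have DU := is_derive_along (F := U eps) (c := fun s => usubmx (z s)) dU Dx.
have DK := is_derive_kinetic hphi p0 pb (is_derive_subf Dp DA).
have DV := is_derive_potential hV x0 Dx.
apply: is_derive_ext (is_derive_subf (is_derive_subf DK DV) DU) => //.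
rewrite /full_field; set v := psi _ _ _.
rewrite J_col_mx -[in RHS](vsubmxK dz) dot_col_mx.
move: (usubmx dz) (dsubmx dz) (usubmx (z t)) => u w x.
rewrite dotNl !dotDl dotBr.
have -> : dot v (\sum_i u i 0 *: partial i (A eps) x) =
    dot (\col_i dot v (partial i (A eps) x)) u.
  rewrite dotC dot_suml; apply: eq_bigr => i _.
  by rewrite dotZl dotC mxE mulrC.
have -> : \sum_i u i 0 *: partial i (U eps) x = dot (gradient (U eps) x) u.
  by apply: eq_bigr => i _; rewrite mxE mulrC.
ring.
Qed.

Lemma is_derive_ham eps (z : R -> 'cV[R]_(3 + 3)) dz (t : R) : regular_at eps (z t) ->
  is_derive t 1 z dz ->
  is_derive t 1 (fun s => H eps (z s)) (dot (J 3 *m X eps (z t)) dz).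
Proof.
move=> Rz Dz; have [_ x0 _ _] := Rz; rewrite fieldE//.
apply: near_eq_is_derive (is_derive_full_H Rz Dz).
have [d d0 Hd] := usubmx_neq0_near x0.
have /cvgrPdist_lt /(_ d d0) := is_derive_continuous Dz.
by apply: filterS => s; rewrite distrC => /Hd s0; rewrite hamE.
Qed.

(** The gradient of [H e] is J [X e], which is Lipschitz uniformly in [e]; integrating its increment
    along the segment gives the quadratic remainder. *)
Lemma ham_taylor (q : 'cV[R]_(3 + 3)) : regular_phase b q -> exists2 C : R, 0 < C & exists2 d : R, 0 < d &
  forall e y y', `|e| < d -> `|y - q| < d -> `|y' - q| < d ->
    `|H e y' - H e y - dot (J 3 *m X e y) (y' - y)| <= C * `|y' - y| ^+ 2.
Proof.
move=> Rq; have [d1 d10 H1] := regular_at_near Rq.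
have [C C0 [d2 d20 H2]] := sdiff_lip (sdiff_field hphi hV heps0 hU hA hU0 hA0 Rq).
(* One factor 6 comes from the scalar product and one from the product with [J 3], both estimated by
   the max norm in dimension 6. *)
pose K := 6 * (6 * (`|J 3 : 'M[R]_(3 + 3)| + 1) * C).
have K0 : 0 < K by rewrite !mulr_gt0// ltr_wpDl.
exists K => //; exists (Num.min d1 d2); first by rewrite lt_min d10.
move=> e y y'; rewrite !lt_min => /andP[e1 e2] /andP[y1 y2] /andP[y1' y2'].
pose w := y' - y; pose c (s : R) := y + s *: w.
have Dc (t : R) : is_derive t 1 c w := is_derive_line y w t.
have := @segment_mvt_real R (fun s => H e (c s) - s *: dot (J 3 *m X e y) w)
  (fun s => dot (J 3 *m X e (c s)) w - dot (J 3 *m X e y) w) (K * `|w| ^+ 2).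
rewrite /c scale0r addr0 !scale1r scale0r subr0 /w subrKC -/w addrAC; apply => t t01.
  apply: is_derive_subf; first by apply: is_derive_ham => //; apply: H1 => //; exact: ball_convex.
  have := is_derive_line (0 : 'cV[R]_1) (const_mx (dot (J 3 *m X e y) w)) t.
  move=> /is_derive_mxP /(_ 0 0); rewrite mxE; apply: is_derive_ext => // s.
  by rewrite !mxE add0r.
rewrite -dotBl -mulmxBr (le_trans (dot_bound _ _))//.
have L : `|X e (y + t *: w) - X e y| <= C * `|w|.
  apply: (le_trans (H2 _ _ _ e2 _ y2)); first exact: ball_convex.
  rewrite addrAC subrr add0r normrZ; case/andP: t01 => t0 t1.
  by rewrite ger0_norm// ler_wpM2l ?(ltW C0)// ler_piMl.
rewrite /K expr2 mulrA ler_wpM2r// -!mulrA ler_wpM2l//.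
rewrite (le_trans (mulmx_norm _ _))// -mulrA ler_wpM2l//.
apply: ler_pM => //; first by rewrite lerDl.
Qed.

Lemma C1_kinetic d (p : 'cV[R]_d) : p != 0 -> eball b p ->
  C1_at (fun s => G a f (Num.sqrt s)) (fun s => kpsi a f s / 2) (dot p p).
Proof.
move=> p0 pb; have C := C1_kpsi hphi p0 pb; split; last first.
  apply: cvgM; last exact: cvg_cst.
  by have [N _] := C; exact: is_derive_continuous (nbhs_singleton N).
have pp := dot_gt0 p0.
have N0 := near_pos_lt (enorm_gt0 p0) pb; rewrite enormE in N0.
have N1 := @sqrt_continuous R (dot p p) _ N0.
apply: filterS2 (near_pos_lt pp (ltry _)) N1 => s [s0 _] [r0 rb].
have D := is_derive_compf (is_derive_G hphi r0 rb) (is_derive1_sqrt s0).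
apply: is_derive_ext D => //.
have rn0 : Num.sqrt s != 0 by rewrite gt_eqF.
by rewrite /kpsi /radial_coef /GRing.scale/=; field.
Qed.

Lemma ham_near (q : 'cV[R]_(3 + 3)) : regular_phase b q -> forall kap : R, 0 < kap -> exists2 d : R, 0 < d &
  forall e y, `|e| < d -> `|y - q| < d -> `|H e y - H 0 y| <= kap.
Proof.
move=> [x0 p0 pb] kap kap0.
(* The term V(|x|) does not depend on eps and cancels in the difference, so only this part has to be
   strictly differentiable. *)
pose S e y := G a f (Num.sqrt (dot (momentum e y) (momentum e y))) - U e (usubmx y).
have HE e y : usubmx y != 0 -> H e y = S e y - V (enorm (usubmx y)).
  by move=> y0; rewrite hamE// /full_H /S -enormE addrAC.
have SM := sdiff_momentum heps0 hA hA0 x0.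
have Ck : C1_at (fun s => G a f (Num.sqrt s)) (fun s => kpsi a f s / 2)
    (dot (momentum 0 q) (momentum 0 q)).
  by rewrite momentum0//; exact: C1_kinetic.
have SS := sdiffB (sdiff_comp Ck (sdiff_dot SM SM)) (sdiff_usubmx (sdiff_U heps0 hU hU0 x0)).
have [d1 d10 H1] := sdiff_near SS (divr_gt0 kap0 (ltr0n R 2)).
have [d2 d20 H2] := usubmx_neq0_near x0.
exists (Num.min d1 d2); first by rewrite lt_min d10.
move=> e y; rewrite !lt_min => /andP[e1 _] /andP[y1 y2].
rewrite !HE; try exact: H2.
rewrite opprB addrA subrK -(subrKA (S 0 q)) (le_trans (ler_normD _ _))// [kap]splitr lerD//.
  exact: H1.
by rewrite distrC; apply: H1 => //; rewrite normr0.
Qed.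

End PerturbedHamiltonian.

(** * The orthogonal group *)

Section OrthogonalGroup.
Context {R : realType}.

Lemma orthogonal_entry n (M : 'M[R]_n) i j : orthogonal M -> `|M i j| <= 1.
Proof.
move=> /matrixP /(_ j j); rewrite !mxE eqxx mulr1n => E.
rewrite -(@ler_pXn2r _ 2)// ?nnegrE// expr1n real_normK ?num_real// -E (bigD1 i)//= mxE -expr2.
by rewrite lerDl sumr_ge0// => k _; rewrite mxE -expr2 sqr_ge0.
Qed.

Lemma orthogonal_norm n (M : 'M[R]_n) : orthogonal M -> `|M| <= 1.
Proof. by move=> oM; apply: mxnormP => // i j; exact: orthogonal_entry. Qed.

Lemma orthogonal_compact n : compact [set M : 'M[R]_n | orthogonal M].
Proof.
have vC : continuous (@vec_mx R n n).
  move=> v; apply: continuous_mxP => i j.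
  rewrite (_ : (fun x => _) = fun x : 'rV[R]_(n * n) => x 0 (mxvec_index i j)); last first.
    by apply/funext => x; rewrite mxE.
  by apply: continuous_coord; exact: cvg_id.
have -> : [set M : 'M[R]_n | orthogonal M] = @vec_mx R n n @` [set v | orthogonal (vec_mx v)].
  apply/seteqP; split => [M oM|_ [v ov <-]//].
  by exists (mxvec M); rewrite /= mxvecK.
apply: continuous_compact; first exact: continuous_subspaceT.
apply: bounded_closed_compact.
  exists 1; split; first exact: num_real.
  move=> x x1 v /= ov; rewrite -(vec_mxK v).
  apply: mxnormP; first by lra.
  move=> i j; rewrite ord1; case/mxvec_indexP: j => k l; rewrite mxvecE.
  by rewrite (le_trans (orthogonal_entry _ _ ov))// ltW.
have C1 : continuous (fun v : 'rV[R]_(n * n) => (vec_mx v)^T *m vec_mx v).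
  move=> v; apply: continuous_mxP => i j.
  rewrite (_ : (fun x => _) = fun x : 'rV[R]_(n * n) => dot (col i (vec_mx x)) (col j (vec_mx x))).
    have cC k : {for v, continuous (fun x : 'rV[R]_(n * n) => col k (vec_mx x))}.
      apply: continuous_mxP => l m.
      rewrite (_ : (fun x => _) = fun x : 'rV[R]_(n * n) => vec_mx x l k).
        by apply: continuous_coord; exact: vC.
      by apply/funext => x; rewrite mxE.
    exact: continuous_dot.
  by apply/funext => x; rewrite mxE; apply: eq_bigr => k _; rewrite !mxE.
have -> : [set v : 'rV[R]_(n * n) | orthogonal (vec_mx v)] =
  (fun v : 'rV[R]_(n * n) => (vec_mx v)^T *m vec_mx v) @^-1` [set 1%:M] by [].
apply: closed_comp => [v _|]; first exact: C1.
exact/accessible_closed_set1/hausdorff_accessible/norm_hausdorff.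
Qed.

Lemma orthogonal1 n : orthogonal (1%:M : 'M[R]_n).
Proof. by rewrite /orthogonal trmx1 mul1mx. Qed.

Lemma orthogonalM n (M N : 'M[R]_n) : orthogonal M -> orthogonal N -> orthogonal (M *m N).
Proof. by move=> oM oN; rewrite /orthogonal trmx_mul mulmxA -(mulmxA N^T) oM mulmx1. Qed.

Lemma dot_orthogonal n (M : 'M[R]_n) u v : orthogonal M -> dot (M *m u) (M *m v) = dot u v.
Proof. by move=> oM; rewrite dot_mulmxl mulmxA oM mul1mx. Qed.

(** For orthogonal [M] this is the cotangent lift to phase space, because the inverse transpose of
    [M] is [M] itself. *)
Definition diag_action n (M : 'M[R]_n) : 'M[R]_(n + n) := block_mx M 0 0 M.

Lemma diag_actionE n (M : 'M[R]_n) (z : 'cV[R]_(n + n)) :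
  diag_action M *m z = col_mx (M *m usubmx z) (M *m dsubmx z).
Proof. by rewrite -{1}(vsubmxK z) mul_block_col !mul0mx addr0 add0r. Qed.

Lemma diag_actionM n (M N : 'M[R]_n) : diag_action M *m diag_action N = diag_action (M *m N).
Proof. by rewrite /diag_action mulmx_block !mulmx0 !mul0mx !addr0 add0r. Qed.

Lemma diag_action_tr n (M : 'M[R]_n) : (diag_action M)^T = diag_action M^T.
Proof. by rewrite /diag_action tr_block_mx trmx0. Qed.

Lemma diag_action1 n : diag_action (1%:M : 'M[R]_n) = 1%:M.
Proof. by rewrite /diag_action -scalar_mx_block. Qed.

Lemma diag_action_norm n (M : 'M[R]_n) : `|diag_action M| <= `|M|.
Proof.
apply: mxnormP => // i j; rewrite /diag_action.
rewrite /block_mx mxE; case: (fintype.split i) => i'; rewrite mxE; case: (fintype.split j) => j'.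
all: by rewrite ?mxE ?normr0// mxnorm_ge.
Qed.

Lemma diag_actionD n (M N : 'M[R]_n) : diag_action (M + N) = diag_action M + diag_action N.
Proof. by rewrite /diag_action add_block_mx !addr0. Qed.

Lemma diag_actionZ n c (M : 'M[R]_n) : diag_action (c *: M) = c *: diag_action M.
Proof. by rewrite /diag_action scale_block_mx !scaler0. Qed.

Lemma J_diag_action n (M : 'M[R]_n) : J n *m diag_action M = diag_action M *m J n.
Proof.
by rewrite /J /diag_action !mulmx_block !mul0mx !mulmx0 !add0r !addr0 mulNmx mulmxN !mul1mx !mulmx1.
Qed.

Definition phase_rotations n : set 'M[R]_(n + n) := @diag_action n @` [set M | orthogonal M].

Lemma diag_action_continuous n (M : 'M[R]_n) : {for M, continuous (@diag_action n)}.
Proof.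
apply: continuous_mxP => i j; rewrite /diag_action.
rewrite (_ : (fun x => _) = fun x : 'M[R]_n =>
  match fintype.split i, fintype.split j with inl i', inl j' | inr i', inr j' => x i' j' | _, _ => 0 end).
  case: (fintype.split i) => i'; case: (fintype.split j) => j'; try exact: cst_continuous.
    by apply: continuous_coord; exact: cvg_id.
  by apply: continuous_coord; exact: cvg_id.
apply/funext => x; rewrite /block_mx mxE.
by case: (fintype.split i) => i'; rewrite mxE; case: (fintype.split j) => j'; rewrite ?mxE.
Qed.

Lemma phase_rotations_compact n : compact (@phase_rotations n).
Proof.
apply: continuous_compact; last exact: orthogonal_compact.
apply: continuous_subspaceT => M; exact: diag_action_continuous.
Qed.

Lemma phase_rotations1 n : @phase_rotations n 1%:M.
Proof. by exists 1%:M; [exact: orthogonal1|exact: diag_action1]. Qed.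

Lemma phase_rotations_orthogonal n (g : 'M[R]_(n + n)) : phase_rotations g -> g^T *m g = 1%:M.
Proof.
by move=> [M oM <-]; rewrite diag_action_tr diag_actionM oM diag_action1.
Qed.

Lemma phase_rotations_bound n g (v : 'cV[R]_(n + n)) : phase_rotations g ->
  `|g *m v| <= (n + n)%:R * `|v| /\ `|g^T *m v| <= (n + n)%:R * `|v|.
Proof.
move=> [M oM <-]; split; rewrite (le_trans (mulmx_norm _ _))//; rewrite ler_wpM2r// ler_piMr//.
  exact: le_trans (diag_action_norm _) (orthogonal_norm oM).
by rewrite norm_trmx (le_trans (diag_action_norm _))// orthogonal_norm.
Qed.

Lemma is_derive_mulr (s t : R) : is_derive t 1 (fun t : R => t * s) s.
Proof.
have := is_derive_mulf (@is_derive_id R R t 1) (@is_derive_cst _ R R s t 1).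
by rewrite mul1r mulr0 addr0.
Qed.

Lemma sin_le (s : R) : `|sin s| <= `|s|.
Proof.
have := @segment_mvt_real R (fun t => sin (t * s)) (fun t => s *: cos (t * s)) `|s|.
rewrite mul1r mul0r sin0 subr0; apply => [t _|t _].
  exact: (@is_derive_compf R R sin (fun t : R => t * s) t _ _ (is_derive_sin (t * s)) (is_derive_mulr s t)).
by rewrite normrZ ler_piMr// ler_norml cos_geN1 cos_le1.
Qed.

Lemma cos_le (s : R) : `|cos s - 1| <= s ^+ 2.
Proof.
have := @segment_mvt_real R (fun t => cos (t * s)) (fun t => s *: (- sin (t * s))) (s ^+ 2).
rewrite mul1r mul0r cos0; apply => [t _|t /andP[t0 t1]].
  exact: (@is_derive_compf R R cos (fun t : R => t * s) t _ _ (is_derive_cos (t * s)) (is_derive_mulr s t)).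
rewrite normrZ normrN -real_normK ?num_real// expr2 ler_wpM2l// (le_trans (sin_le _))//.
by rewrite normrM ger0_norm// ler_piMl.
Qed.

Lemma sin_sub_le (s : R) : `|s| <= 1 -> `|sin s - s| <= s ^+ 2.
Proof.
move=> s1; have := @segment_mvt_real R (fun t => sin (t * s) - t * s) (fun t => s *: cos (t * s) - s) (s ^+ 2).
rewrite !mul1r !mul0r sin0 !subr0; apply => [t _|t /andP[t0 t1]].
  apply: is_derive_subf; last exact: is_derive_mulr.
  exact: (@is_derive_compf R R sin (fun t : R => t * s) t _ _ (is_derive_sin (t * s)) (is_derive_mulr s t)).
rewrite (_ : s *: cos (t * s) - s = s * (cos (t * s) - 1)); last by rewrite mulrBr mulr1.
rewrite normrM -[leRHS]real_normK ?num_real// expr2 ler_wpM2l//.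
rewrite (le_trans (cos_le _))// -real_normK ?num_real// normrM (ger0_norm t0) expr2.
have n0 := normr_ge0 s.
have ts : t * `|s| <= 1 by rewrite mulr_ile1.
have ts' : t * `|s| <= `|s| by rewrite ler_piMl.
by rewrite (le_trans (ler_piMl _ ts))// mulr_ge0.
Qed.

Definition plane_generator n (i j : 'I_n) : 'M[R]_n := delta_mx j i - delta_mx i j.

Lemma plane_generator_tr n (i j : 'I_n) : (plane_generator i j)^T = - plane_generator i j.
Proof. by rewrite /plane_generator linearB/= !trmx_delta opprB. Qed.

Lemma plane_generator3 n (i j : 'I_n) : i != j ->
  plane_generator i j *m plane_generator i j *m plane_generator i j = - plane_generator i j.
Proof.
move=> ij; have ji : j != i by rewrite eq_sym.
rewrite /plane_generator !(mulmxBl, mulmxBr) !mul_delta_mx_cond !eqxx (negbTE ij) (negbTE ji).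
rewrite !mulr0n !mulr1n !mul0mx !mul_delta_mx_cond !eqxx (negbTE ij) (negbTE ji) !mulr0n !mulr1n.
by rewrite !(subr0, sub0r, mul0mx, oppr0, opprB, opprK, addr0, add0r) addrC.
Qed.

(* Rodrigues' formula. *)
Definition plane_rotation n (i j : 'I_n) (s : R) : 'M[R]_n :=
  let E := plane_generator i j in 1%:M + sin s *: E + (1 - cos s) *: (E *m E).

Lemma plane_rotation_orthogonal n (i j : 'I_n) s : i != j -> orthogonal (plane_rotation i j s).
Proof.
move=> ij; rewrite /orthogonal /plane_rotation /=.
have E3 := plane_generator3 ij; have ET := plane_generator_tr i j.
move: (plane_generator i j) E3 ET => E E3 ET.
have FT : (E *m E)^T = E *m E by rewrite trmx_mul ET mulNmx mulmxN opprK.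
have EF : E *m (E *m E) = - E by rewrite mulmxA.
have FF : (E *m E) *m (E *m E) = - (E *m E) by rewrite -mulmxA EF mulmxN.
have EE : E *m E = E *m E by [].
(* With [F] the square of [E], the relations E F = -E and F F = -F reduce the claim to entries,
   where the coefficient of [F] is 1 - (cos^2 + sin^2). *)
move: {2 3 4 5 6 7 8 9}(E *m E) EE E3 FT EF FF => F EE E3 FT EF FF; rewrite EE.
have -> : (1%:M + sin s *: E + (1 - cos s) *: F)^T = 1%:M - sin s *: E + (1 - cos s) *: F.
  apply/matrixP => k l; rewrite !mxE eq_sym.
  have := congr1 (fun Q : 'M[R]_n => Q k l) ET; rewrite !mxE => ->.
  have -> : F l k = F k l by rewrite -[in RHS]FT mxE.
  by rewrite mulrN.
rewrite !(mulmxDl, mulmxDr) -!scalemxAl -!scalemxAr !mul1mx !mulmx1 !mulNmx -!scalemxAl EE E3 EF FF.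
have := cos2Dsin2 s.
move: (sin s) (cos s) => x y xy.
apply/matrixP => k l; rewrite !mxE; move: (E k l) (F k l) (_ *+ _) => e f1 d.
by transitivity (d + f1 * (1 - (y ^+ 2 + x ^+ 2))); [ring|rewrite xy subrr mulr0 addr0].
Qed.

Lemma plane_rotation_generator n (i j : 'I_n) : i != j ->
  generator (@phase_rotations n) (diag_action (plane_generator i j))
    (fun s => diag_action (plane_rotation i j s))
    (`|plane_generator i j| + `|plane_generator i j *m plane_generator i j|).
Proof.
move=> ij; split; first exact: addr_ge0.
  move=> _ s [M oM <-]; exists (M *m plane_rotation i j s); last by rewrite diag_actionM.
  exact: orthogonalM oM (plane_rotation_orthogonal s ij).
move=> s s1; rewrite /plane_rotation; move: (plane_generator i j) => E /=.
have -> : diag_action (1%:M + sin s *: E + (1 - cos s) *: (E *m E)) - 1%:M - s *: diag_action E =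
    diag_action ((sin s - s) *: E + (1 - cos s) *: (E *m E)).
  rewrite !diag_actionD !diag_actionZ diag_action1.
  by move: (diag_action _) (diag_action _) => u w; apply/matrixP => k l; rewrite !mxE; ring.
rewrite (le_trans (diag_action_norm _))// (le_trans (ler_normD _ _))// !normrZ mulrDl.
by rewrite lerD// mulrC ler_wpM2l//; [exact: sin_sub_le|rewrite distrC; exact: cos_le].
Qed.

End OrthogonalGroup.

(** * Linearization of the central problem *)

Section CentralField.
Context {R : realType}.

Lemma sdiff_is_derive n m (F : R -> 'cV[R]_n -> 'cV[R]_m) (M : 'M[R]_(m, n)) (c : R -> 'cV[R]_n)
    dc (t : R) :
  sdiff F (c t) (fun v => M *m v) -> is_derive t 1 c dc ->
  is_derive t 1 (fun s => F 0 (c s)) (M *m dc).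
Proof.
move=> [[C C0 bM] HF] Dc; apply/is_deriveP => e e0.
pose e1 := Num.min 1 (e / 2 / (C + 1)); pose kap := e / 2 / (`|dc| + 1).
have C1 : 0 < C + 1 by rewrite ltr_wpDl.
have dc1 : 0 < `|dc| + 1 by rewrite ltr_wpDl.
have e10 : 0 < e1 by rewrite lt_min ltr01 !divr_gt0.
have kap0 : 0 < kap by rewrite !divr_gt0.
have [d1 d10 H1] := HF _ kap0; have {}H1 := (H1 0 (etrans (congr1 (fun x => x < d1) (normr0 _)) d10)).2.
have [d2 d20 H2] := (is_deriveP c t dc).1 Dc _ e10.
have /cvgrPdist_lt /(_ d1 d10) /near_normP[d3 d30 H3] := is_derive_continuous Dc.
exists (Num.min d2 d3); first by rewrite lt_min d20.
move=> h; rewrite lt_min => /andP[/H2 {}H2 h3].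
have i1 : `|c (t + h) - c t| < d1 by rewrite distrC; apply: H3; rewrite addrAC subrr add0r.
have i0 : `|c t - c t| < d1 by rewrite subrr normr0.
have {}H1 := H1 _ _ i1 i0.
have b : `|c (t + h) - c t| <= (`|dc| + 1) * `|h|.
  rewrite -(subrK (h *: dc) (c (t + h) - c t)) (le_trans (ler_normD _ _))// addrC mulrDl normrZ mulrC lerD//.
  by rewrite (le_trans H2)// ler_wpM2r// ge_min lexx.
have -> : F 0 (c (t + h)) - F 0 (c t) - h *: (M *m dc) =
   (F 0 (c (t + h)) - F 0 (c t) - M *m (c (t + h) - c t)) + M *m (c (t + h) - c t - h *: dc).
  by rewrite [in RHS](mulmxBr M _ (h *: dc)) scalemxAr [RHS]addrA subrK.
rewrite (le_trans (ler_normD _ _))// [e]splitr mulrDl lerD//.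
  rewrite (le_trans H1)// (le_trans (ler_wpM2l (ltW kap0) b))// mulrA divfK// gt_eqF//.
rewrite (le_trans (bM _))// (le_trans (ler_wpM2l C0 H2))// mulrA ler_wpM2r//.
rewrite (@le_trans _ _ (C * (e / 2 / (C + 1))))// ?ler_wpM2l// ?ge_min ?lexx ?orbT//.
by rewrite mulrA ler_pdivrMr// mulrC ler_wpM2l ?divr_ge0 ?(ltW e0)// lerDl.
Qed.

Lemma derive_line (W : normedModType R) n (F : 'cV[R]_n -> W) (x v : 'cV[R]_n) :
  'D_v F x = 'D_1 (fun s : R => F (x + s *: v)) 0.
Proof.
rewrite /derive; set g := (fun h => _ : W); set g' := (fun h => _ : W).
have -> // : g = g'; apply/funext => h; rewrite /g /g' /=.
by rewrite scale0r !addr0 [h%:A]mulr1 [x + _]addrC.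
Qed.

Variables (a b : \bar R) (f V : R -> R).
Hypotheses (hphi : phi_assumptions a b f) (hV : C2_on_positive V).

Notation X0 := (central_field a f V).
Notation Ad := (central_jacobian a f V).
Notation H := (H0 a f V).

Lemma regular_phase_near d (z : 'cV[R]_(d + d)) : regular_phase b z ->
  exists2 e : R, 0 < e & forall y, `|y - z| < e -> regular_phase b y.
Proof.
move=> [x0 p0 pb]; have [d1 d10 H1] := usubmx_neq0_near x0.
have [d2 d20 H2] := eball_near p0 pb.
exists (Num.min d1 d2); first by rewrite lt_min d10.
move=> y; rewrite lt_min => /andP[/H1 y1 y2].
have [|? ?] := H2 (dsubmx y); last by split.
rewrite (le_lt_trans _ y2)//; apply: cvnormP => // i.
by rewrite (le_trans _ (mxnorm_ge (y - z) (rshift d i) 0))// !mxE.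
Qed.

Lemma sdiff_central d (z : 'cV[R]_(d + d)) : regular_phase b z ->
  sdiff (fun _ => @X0 d) z (fun v => Ad z *m v).
Proof.
move=> [x0 p0 pb].
apply: (@sdiff_ext _ _ _ _ _ (fun v => col_mx
  (radmx (kpsi a f) (dkpsi a f) (dsubmx z) *m dsubmx v)
  (radmx (kV V) (dkV V) (usubmx z) *m usubmx v))).
  by move=> v; rewrite central_jacobianE.
have Sd : sdiff (fun _ (y : 'cV[R]_(d + d)) => dsubmx y) z (fun v => dsubmx v).
  under [F in sdiff F]eq_fun do under eq_fun do rewrite dsubmxE.
  under [F in sdiff _ _ F]eq_fun do rewrite dsubmxE.
  exact: sdiff_mulmx (sdiff_id z).
apply: sdiff_col_mx.
  have := @sdiff_radial R _ _ (kpsi a f) (dkpsi a f) _ z _ _ Sd.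
  by apply; exact: (C1_kpsi hphi).
have := @sdiff_radial R _ _ (kV V) (dkV V) _ z _ _ (sdiff_usubmx (sdiff_id (usubmx z))).
by apply; exact: C1_kV.
Qed.

Lemma is_derive_central d (z : R -> 'cV[R]_(d + d)) dz (t : R) : regular_phase b (z t) ->
  is_derive t 1 z dz -> is_derive t 1 (fun s => X0 (z s)) (Ad (z t) *m dz).
Proof. by move=> /sdiff_central S; exact: (sdiff_is_derive S). Qed.

Lemma gradient_H0 d (z : 'cV[R]_(d + d)) : regular_phase b z ->
  gradient (@H d) z = J d *m X0 z.
Proof.
move=> Rz; apply/matrixP => j k; rewrite !ord1 mxE /partial derive_line.
have D := is_derive_line z (delta_mx j 0) 0.
have E : z + 0 *: delta_mx j 0 = z by rewrite scale0r addr0.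
have [|_ ->] := is_derive_H0 hphi hV (z := fun s => z + s *: delta_mx j 0) _ D; rewrite E//.
by rewrite dot_delta.
Qed.

Lemma J_jacobian_tr d (z : 'cV[R]_(d + d)) : (J d *m Ad z)^T = J d *m Ad z.
Proof.
rewrite /J /central_jacobian mulmx_block !mul0mx !mulmx0 !add0r !addr0 mul1mx mulNmx mul1mx.
by rewrite tr_block_mx !trmx0 radmx_tr linearN/= radmx_tr.
Qed.

Lemma hessian_H0 d (z : 'cV[R]_(d + d)) : regular_phase b z ->
  hessian (@H d) z = J d *m Ad z.
Proof.
move=> Rz; rewrite -J_jacobian_tr; apply/matrixP => i j; rewrite !mxE.
have N : \forall y \near z, partial j (@H d) y = (J d *m X0 y) j 0.
  have [e e0 He] := regular_phase_near Rz; apply/near_normP; exists e => // y /He Ry.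
  by rewrite -gradient_H0// mxE.
rewrite /partial (near_eq_derive _ N) derive_line.
have D := is_derive_line z (delta_mx i 0) 0.
have E : z + 0 *: delta_mx i 0 = z by rewrite scale0r addr0.
have Rc : regular_phase b (z + 0 *: delta_mx i 0) by rewrite E.
have := is_derive_central (z := fun s => z + s *: delta_mx i 0) Rc D.
move=> /(is_derive_mulmxl (J d)) /is_derive_mxP /(_ j 0) [_ ->].
by rewrite E mulmxA -colE !mxE.
Qed.

Lemma psi_orthogonal d (M : 'M[R]_d) (p : 'cV[R]_d) : orthogonal M ->
  psi a f (M *m p) = M *m psi a f p.
Proof. by move=> oM; rewrite /psi dot_orthogonal// -scalemxAr. Qed.

Lemma central_field_rotation d (g : 'M[R]_(d + d)) z : phase_rotations g ->
  X0 (g *m z) = g *m X0 z.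
Proof.
move=> [M oM <-]; rewrite !diag_actionE /central_field !col_mxKu !col_mxKd.
by rewrite psi_orthogonal// dot_orthogonal// scalemxAr.
Qed.

Lemma enorm_orthogonal d (M : 'M[R]_d) (p : 'cV[R]_d) : orthogonal M -> enorm (M *m p) = enorm p.
Proof. by move=> oM; rewrite !enormE dot_orthogonal. Qed.

Lemma H0_rotation d (g : 'M[R]_(d + d)) z : phase_rotations g -> H (g *m z) = H z.
Proof.
by move=> [M oM <-]; rewrite diag_actionE /H0 !col_mxKu !col_mxKd !enorm_orthogonal.
Qed.

Lemma orthogonal_inj d (M : 'M[R]_d) (p : 'cV[R]_d) : orthogonal M -> p != 0 -> M *m p != 0.
Proof. by move=> oM p0; rewrite -enorm_eq0 enorm_orthogonal// enorm_eq0. Qed.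

Lemma regular_phase_rotation d (g : 'M[R]_(d + d)) z : phase_rotations g ->
  regular_phase b z -> regular_phase b (g *m z).
Proof.
move=> [M oM <-] [x0 p0 pb]; rewrite /regular_phase diag_actionE !col_mxKu !col_mxKd.
by split; rewrite ?orthogonal_inj// /eball/= enorm_orthogonal.
Qed.

Lemma dot_skew d (E : 'M[R]_d) (x : 'cV[R]_d) : E^T = - E -> dot x (E *m x) = 0.
Proof.
move=> ET; have : dot x (E *m x) = - dot x (E *m x).
  by rewrite {1}dotC dot_mulmxl ET mulNmx dotNr.
by move=> H1; lra.
Qed.

(** Infinitesimal form of [central_field_rotation]: the rank-one parts of the Jacobian vanish
    because E x is orthogonal to x. Hence rotating a solution infinitesimally gives a solution of
    the linearized equation. *)
Lemma jacobian_rotation d (E : 'M[R]_d) (z : 'cV[R]_(d + d)) : E^T = - E ->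
  Ad z *m (diag_action E *m z) = diag_action E *m X0 z.
Proof.
move=> ET; rewrite !diag_actionE central_jacobianE !col_mxKu !col_mxKd !radmxE !dot_skew//.
by rewrite !mulr0 !scale0r !addr0 /psi !scalemxAr.
Qed.

Lemma dot_J_skew d (u : 'cV[R]_(d + d)) : dot (J d *m u) u = 0.
Proof. by rewrite -(vsubmxK u) J_col_mx dot_col_mx dotNl dotC addrC subrr. Qed.

Lemma J_tr d : (J d)^T = - J d :> 'M[R]_(d + d).
Proof. by rewrite /J tr_block_mx !trmx0 linearN/= !trmx1 opp_block_mx !oppr0 opprK. Qed.

Lemma J_sqr d : J d *m J d = - 1%:M :> 'M[R]_(d + d).
Proof.
rewrite /J mulmx_block !mul0mx !mulmx0 !add0r !addr0 mul1mx mulmx1.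
by rewrite scalar_mx_block opp_block_mx !oppr0.
Qed.

(** Infinitesimal form of [H0_rotation]: rotation directions are tangent to the energy levels. *)
Lemma rotation_tangent d (E : 'M[R]_d) (z : 'cV[R]_(d + d)) : E^T = - E ->
  dot (J d *m X0 z) (diag_action E *m z) = 0.
Proof.
move=> ET; rewrite diag_actionE J_col_mx dot_col_mx dotNl /psi !dotZl !dot_skew//.
by rewrite !mulr0 oppr0 addr0.
Qed.

(** Conservation of the symplectic form, by symmetry of J [Ad]. The inhomogeneous term c X_0 of [v]
    contributes nothing because [eta] is tangent to the energy level. *)
Lemma pairing_constant d (z eta v : R -> 'cV[R]_(d + d)) (T c : R) :
  (forall t : R, is_derive t 1 eta (T *: (Ad (z t) *m eta t))) ->
  (forall t : R, is_derive t 1 v (T *: (Ad (z t) *m v t) + c *: X0 (z t))) ->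
  (forall t, dot (J d *m X0 (z t)) (eta t) = 0) ->
  forall t, dot (J d *m eta t) (v t) = dot (J d *m eta 0) (v 0).
Proof.
move=> De Dv He.
have D (t : R) : is_derive t 1 (fun s => const_mx (dot (J d *m eta s) (v s)) : 'cV[R]_1) 0.
  apply/is_derive_mxP => i j; rewrite mxE.
  apply: is_derive_ext (is_derive_dot (is_derive_mulmxl (J d) (De t)) (Dv t)) => [s|].
    by rewrite mxE.
  rewrite -scalemxAr dotZl dotDr !dotZr mulmxA.
  have -> : dot (J d *m eta t) (X0 (z t)) = 0.
    by rewrite dot_mulmxl J_tr mulNmx dotNr dotC He oppr0.
  rewrite (dot_mulmxl (J d *m Ad (z t))) J_jacobian_tr (dot_mulmxl (J d)) J_tr mulNmx dotNr mulmxA.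
  by rewrite mulrN mulr0 addr0 subrr.
move=> t; have K : forall s u : R, s <= u -> dot (J d *m eta s) (v s) = dot (J d *m eta u) (v u).
  move=> s u su; have := zero_derive_const su (fun r _ => D r).
  by move=> /matrixP /(_ 0 0); rewrite !mxE.
by have [/K|/ltW/K] := leP 0 t.
Qed.

End CentralField.

(** * Restriction of the spatial problem to the plane of the orbit *)

Section PlanarProjection.
Context {R : realType}.

Definition planar_projection (z : 'cV[R]_(3 + 3)) : 'cV[R]_(2 + 2) :=
  col_mx (proj12 (usubmx z)) (proj12 (dsubmx z)).

Definition planar (z : 'cV[R]_(3 + 3)) := usubmx z ord_max 0 = 0 /\ dsubmx z ord_max 0 = 0.

Lemma dot_proj12 (u v : 'cV[R]_3) :
  dot u v = dot (proj12 u) (proj12 v) + u ord_max 0 * v ord_max 0.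
Proof.
rewrite /dot big_ord_recr/=; congr (_ + _); apply: eq_bigr => i _; rewrite !mxE.
by congr (u _ 0 * v _ 0); exact: val_inj.
Qed.

Lemma proj12D (u v : 'cV[R]_3) : proj12 (u + v) = proj12 u + proj12 v.
Proof. by apply/matrixP => i j; rewrite !mxE. Qed.

Lemma proj12Z c (u : 'cV[R]_3) : proj12 (c *: u) = c *: proj12 u.
Proof. by apply/matrixP => i j; rewrite !mxE. Qed.

Lemma proj12_inj (u : 'cV[R]_3) : proj12 u = 0 -> u ord_max 0 = 0 -> u = 0.
Proof.
move=> u0 u2; apply: dot_eq0; rewrite dot_proj12 u0 u2 dot0l mul0r addr0//.
Qed.

Lemma planar_projectionD u v : planar_projection (u + v) = planar_projection u + planar_projection v.
Proof. by rewrite /planar_projection !linearD/= !proj12D add_col_mx. Qed.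

Lemma planar_projectionZ c u : planar_projection (c *: u) = c *: planar_projection u.
Proof. by rewrite /planar_projection !linearZ/= !proj12Z scale_col_mx. Qed.

Lemma is_derive_planar_projection (z : R -> 'cV[R]_(3 + 3)) dz (t : R) : is_derive t 1 z dz ->
  is_derive t 1 (fun s => planar_projection (z s)) (planar_projection dz).
Proof.
move=> /is_derive_submx[/(@is_derive_submx R 2 1)[Dx _] /(@is_derive_submx R 2 1)[Dp _]].
apply/is_derive_mxP => i j; rewrite /planar_projection.
have [/is_derive_mxP Dx' /is_derive_mxP Dp'] := conj Dx Dp.
case: (split_ordP i) => k ->.
  by rewrite col_mxEu; apply: is_derive_ext (Dx' k j) => // s; rewrite col_mxEu.
by rewrite col_mxEd; apply: is_derive_ext (Dp' k j) => // s; rewrite col_mxEd.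
Qed.

Variables (a b : \bar R) (f V : R -> R).

Lemma planar_central (z : 'cV[R]_(3 + 3)) : planar z ->
  planar_projection (central_field a f V z) = central_field a f V (planar_projection z).
Proof.
move=> [x0 p0]; rewrite /planar_projection /central_field /psi !col_mxKu !col_mxKd !proj12Z.
by rewrite !dot_proj12 x0 p0 mul0r !addr0.
Qed.

Lemma planar_central_planar (z : 'cV[R]_(3 + 3)) : planar z -> planar (central_field a f V z).
Proof.
move=> [x0 p0]; rewrite /planar /central_field /psi !col_mxKu !col_mxKd.
by split; rewrite mxE ?x0 ?p0 mulr0.
Qed.

Lemma planar_jacobian (z v : 'cV[R]_(3 + 3)) : planar z ->
  planar_projection (central_jacobian a f V z *m v) =
  central_jacobian a f V (planar_projection z) *m planar_projection v.
Proof.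
move=> [x0 p0]; rewrite !central_jacobianE /planar_projection !col_mxKu !col_mxKd.
rewrite !radmxE !proj12D !proj12Z.
by rewrite !(dot_proj12 (usubmx z)) !(dot_proj12 (dsubmx z)) x0 p0 !mul0r !addr0.
Qed.

Lemma planar_pairing (u v : 'cV[R]_(3 + 3)) : planar u ->
  dot (J 3 *m u) v = dot (J 2 *m planar_projection u) (planar_projection v).
Proof.
move=> [x0 p0]; rewrite -{1}(vsubmxK u) -{1}(vsubmxK v) !J_col_mx !dot_col_mx !dotNl.
by rewrite !(dot_proj12 (usubmx u)) !(dot_proj12 (dsubmx u)) x0 p0 !mul0r !addr0.
Qed.

End PlanarProjection.

(** * The planar orbit *)

Section PlanarOrbit.
Context {R : realType}.

(** Cramer's rule in the basis given by [has_dimension]: a vanishing determinant would contradict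
    the independence of [f1] and [f2] at time 0. *)
Lemma span_two n (S : set (R -> 'cV[R]_n)) (f1 f2 w : R -> 'cV[R]_n) : has_dimension S 2 ->
  S f1 -> S f2 -> S w ->
  (forall c1 c2, c1 *: f1 0 + c2 *: f2 0 = 0 -> c1 = 0 /\ c2 = 0) ->
  exists c1 c2, forall t, w t = c1 *: f1 t + c2 *: f2 t.
Proof.
move=> [e [-> _]] [m1 _ E1] [m2 _ E2] [m _ E] ind.
have l1 : lift ord0 ord0 = 1 :> 'I_2 by exact: val_inj.
have {}E1 t : f1 t = m1 0 *: e 0 t + m1 1 *: e 1 t by rewrite -E1 big_ord_recl big_ord1 l1.
have {}E2 t : f2 t = m2 0 *: e 0 t + m2 1 *: e 1 t by rewrite -E2 big_ord_recl big_ord1 l1.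
have {}E t : w t = m 0 *: e 0 t + m 1 *: e 1 t by rewrite -E big_ord_recl big_ord1 l1.
pose D := m1 0 * m2 1 - m1 1 * m2 0.
have [D0|D0] := eqVneq D 0.
  have [|A1 A2] := ind (m2 1) (- m1 1).
    rewrite E1 E2; apply/matrixP => i j; rewrite !mxE.
    transitivity (D * e 0 0 i j); last by rewrite D0 mul0r.
    by rewrite /D; ring.
  have [|A3 A4] := ind (m2 0) (- m1 0).
    rewrite E1 E2; apply/matrixP => i j; rewrite !mxE.
    transitivity (- D * e 1 0 i j); last by rewrite D0 oppr0 mul0r.
    by rewrite /D; ring.
  have [|] := ind 1 0; last by move/eqP; rewrite oner_eq0.
  move/eqP: A2; rewrite oppr_eq0 => /eqP A2; move/eqP: A4; rewrite oppr_eq0 => /eqP A4.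
  by rewrite E1 A2 A4 !scale0r !addr0 scaler0.
exists ((m 0 * m2 1 - m 1 * m2 0) / D), ((m 1 * m1 0 - m 0 * m1 1) / D) => t.
rewrite E E1 E2; apply/matrixP => i j; rewrite !mxE.
move: D0; rewrite /D => D0; field; exact: D0.
Qed.

Lemma zero_derive_real (g : R -> R) : (forall t : R, is_derive t 1 g 0) -> forall s t, g s = g t.
Proof.
move=> Dg; pose M (t : R) : 'cV[R]_1 := const_mx (g t).
have D (t : R) : is_derive t 1 M 0.
  by apply/is_derive_mxP => i j; rewrite mxE; apply: is_derive_ext (Dg t) => // u; rewrite mxE.
have K (s t : R) : s <= t -> g s = g t.
  by move=> st; have /matrixP /(_ 0 0) := zero_derive_const st (fun r _ => D r); rewrite !mxE.
by move=> s t; have [/K//|/ltW/K ->] := leP s t.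
Qed.

Lemma ord3_ind (P : 'I_3 -> Prop) : P 0 -> P 1 -> P ord_max -> forall k, P k.
Proof.
move=> P0 P1 P2 [[|[|[|//]]] k3].
- by rewrite (_ : Ordinal k3 = 0)//; exact: val_inj.
- by rewrite (_ : Ordinal k3 = 1)//; exact: val_inj.
- by rewrite (_ : Ordinal k3 = ord_max)//; exact: val_inj.
Qed.

Lemma dot3 (u v : 'cV[R]_3) : dot u v = u 0 0 * v 0 0 + u 1 0 * v 1 0 + u ord_max 0 * v ord_max 0.
Proof.
rewrite /dot !big_ord_recl big_ord0 addr0 addrA.
have -> : lift ord0 (ord0 : 'I_2) = 1 :> 'I_3 by exact: val_inj.
by have -> : lift ord0 (lift ord0 (ord0 : 'I_1)) = ord_max :> 'I_3 by exact: val_inj.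
Qed.

Lemma plane_generatorE n (i j k : 'I_n) (x : 'cV[R]_n) :
  (plane_generator i j *m x) k 0 = (k == j)%:R * x i 0 - (k == i)%:R * x j 0.
Proof.
have D (p q : 'I_n) : (delta_mx p q *m x) k 0 = (k == p)%:R * x q 0.
  rewrite mxE (bigD1 q)//= mxE eqxx andbT big1 ?addr0// => l lq.
  by rewrite mxE (negbTE lq) andbF mul0r.
by rewrite /plane_generator mulmxBl mxE [X in _ + X]mxE !D.
Qed.

Lemma is_derive_col_mx m1 m2 (u : R -> 'cV[R]_m1) (w : R -> 'cV[R]_m2) du dw (t : R) :
  is_derive t 1 u du -> is_derive t 1 w dw ->
  is_derive t 1 (fun s => col_mx (u s) (w s)) (col_mx du dw).
Proof.
move=> /is_derive_mxP Du /is_derive_mxP Dw; apply/is_derive_mxP => i j.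
case: (split_ordP i) => k ->.
  by rewrite col_mxEu; apply: is_derive_ext (Du k j) => // s; rewrite col_mxEu.
by rewrite col_mxEd; apply: is_derive_ext (Dw k j) => // s; rewrite col_mxEd.
Qed.

Lemma is_derive_affine (W : normedModType R) (x : R -> W) dx (T t0 t : R) :
  is_derive (T * t + t0) 1 x dx -> is_derive t 1 (fun s => x (T * s + t0)) (T *: dx).
Proof.
move=> D; apply: (@is_derive_compf R W x (fun s => T * s + t0) t _ _ D).
have D1 := is_derive_addf (is_derive_scalef T (@is_derive_id R R t 1)) (@is_derive_cst _ R R t0 t 1).
by apply: is_derive_ext D1 => // ; rewrite addr0 [T *: _]mulr1.
Qed.

Lemma is_derive_shift (W : normedModType R) (x : R -> W) dx (t0 t : R) :
  is_derive (t + t0) 1 x dx -> is_derive t 1 (fun s => x (s + t0)) dx.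
Proof.
move=> D; have D1 : is_derive (1 * t + t0) 1 x dx by rewrite mul1r.
apply: is_derive_ext (is_derive_affine D1) => [s|]; first by rewrite mul1r.
by rewrite scale1r.
Qed.

Lemma derive1_periodic (W : normedModType R) (x : R -> W) T : (forall t, derivable x t 1) ->
  periodic_with T x -> periodic_with T (derive1 x).
Proof.
move=> dx px t.
have D : is_derive (t + T) 1 x (derive1 x (t + T)) by rewrite derive1E; exact/derivableP.
have [_] := is_derive_shift D.
by rewrite (_ : (fun s => _) = x) => [<-|]; [rewrite derive1E|apply/funext => s; rewrite px].
Qed.

Variables (a b : \bar R) (f V : R -> R).
Hypotheses (hphi : phi_assumptions a b f) (hV : C2_on_positive V).
Variables (xs : R -> 'cV[R]_3) (Ts h : R).
Hypothesis hTs : 0 < Ts.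
Hypothesis hxs : is_solution a f (unperturbed_force V (d := 3)) xs.
Hypothesis hper : periodic_with Ts xs.
Hypothesis hplane : forall t, xs t ord_max 0 = 0.
Hypotheses (hcirc : ~ circular xs) (hrect : ~ rectilinear xs).
Hypothesis hnd : nondegenerate_fixed_energy (phase_space b (d := 2))
             (H0 a f V (d := 2)) h (initial_conditions f (M2 xs)) 2 Ts.

Notation X0 := (central_field a f V).
Notation Ad := (central_jacobian a f V).

Definition phase_orbit (t : R) : 'cV[R]_(3 + 3) := col_mx (xs t) (phi f (derive1 xs t)).
Notation zs := phase_orbit.

Lemma is_derive_xs (t : R) : is_derive t 1 xs (derive1 xs t).
Proof. by have [_ d _ _] := hxs t; rewrite derive1E; apply/derivableP. Qed.

Lemma is_derive_zs (t : R) : is_derive t 1 zs (X0 (zs t)).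
Proof.
have [x0 d va Dp] := hxs t; rewrite /central_field col_mxKu col_mxKd (psi_phi hphi)//.
by apply: is_derive_col_mx; exact: is_derive_xs.
Qed.

Lemma zs_planar t : planar (zs t).
Proof.
split; rewrite ?col_mxKu ?col_mxKd//.
have -> : phi f (derive1 xs t) ord_max 0 =
    (if derive1 xs t == 0 then 0 else f (enorm (derive1 xs t)) / enorm (derive1 xs t)) *
    derive1 xs t ord_max 0.
  by rewrite /phi; case: eqP => _; rewrite mxE ?mul0r.
have /is_derive_mxP /(_ ord_max 0) [_] := is_derive_xs t.
rewrite (_ : (fun x => _) = fun=> 0); last by apply/funext => s; rewrite hplane.
by rewrite derive_cst => <-; rewrite mulr0.
Qed.

Lemma zs_periodic : periodic_with Ts zs.
Proof.
move=> t; rewrite /phase_orbit hper (derive1_periodic _ hper)// => s.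
by have [] := hxs s.
Qed.

Notation E01 := (plane_generator (0 : 'I_3) 1 : 'M[R]_3).

Definition angular_momentum (z : 'cV[R]_(3 + 3)) := dot (E01 *m usubmx z) (dsubmx z).

Lemma angular_momentumE z : angular_momentum z =
  usubmx z 0 0 * dsubmx z 1 0 - usubmx z 1 0 * dsubmx z 0 0.
Proof. by rewrite /angular_momentum dot3 !plane_generatorE /=; ring. Qed.

Lemma angular_momentum_constant s t : angular_momentum (zs s) = angular_momentum (zs t).
Proof.
apply: (zero_derive_real (g := fun s => angular_momentum (zs s))) => r.
have [Dx Dp] := is_derive_submx (is_derive_zs r).
apply: is_derive_ext (is_derive_dot (is_derive_mulmxl E01 Dx) Dp) => //.
rewrite /central_field !col_mxKu !col_mxKd /psi -scalemxAr dotZl dotZr.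
rewrite dotC [dot (E01 *m xs r) _]dotC !dot_skew ?plane_generator_tr//.
by rewrite !mulr0 addr0.
Qed.

(** The difference of the two sides is the planar cross product of x and p times x rotated by a
    right angle. *)
Lemma collinear_of_momentum0 z : planar z -> angular_momentum z = 0 ->
  dot (usubmx z) (usubmx z) *: dsubmx z = dot (usubmx z) (dsubmx z) *: usubmx z.
Proof.
rewrite angular_momentumE => -[x2 p2] L0; apply/matrixP => k l; rewrite ord1 mxE [RHS]mxE !dot3 x2 p2.
move: x2 p2 L0; move: (usubmx z) (dsubmx z) => x p x2 p2 L0.
elim/ord3_ind: k; last by rewrite x2 p2; ring.
- apply/eqP; rewrite -subr_eq0; apply/eqP.
  transitivity (- (x 1 0 * (x 0 0 * p 1 0 - x 1 0 * p 0 0))); first ring.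
  by rewrite L0 mulr0 oppr0.
- apply/eqP; rewrite -subr_eq0; apply/eqP.
  transitivity (x 0 0 * (x 0 0 * p 1 0 - x 1 0 * p 0 0)); first ring.
  by rewrite L0 mulr0.
Qed.

Lemma is_derive_enorm n (x : R -> 'cV[R]_n) dx (t : R) : x t != 0 -> is_derive t 1 x dx ->
  is_derive t 1 (fun s => enorm (x s)) (dot (x t) dx / enorm (x t)).
Proof.
move=> x0 Dx.
have S := is_derive_compf (is_derive1_sqrt (dot_gt0 x0)) (is_derive_dot Dx Dx).
have e0' : Num.sqrt (dot (x t) (x t)) != 0 by rewrite -enormE gt_eqF// enorm_gt0.
apply: is_derive_ext S => [s|]; first by rewrite enormE.
rewrite [dot dx _]dotC /GRing.scale/= enormE.
by field.
Qed.

(** With zero angular momentum the velocity is parallel to the position at all times, so x / |x| has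
    zero derivative and the orbit is rectilinear. *)
Lemma angular_momentum_neq0 t : angular_momentum (zs t) != 0.
Proof.
apply/eqP => L0; apply: hrect.
have L s : angular_momentum (zs s) = 0 by rewrite (angular_momentum_constant s t).
have D (s : R) : is_derive s 1 (fun r => (enorm (xs r))^-1 *: xs r) 0.
  have [x0 _ va _] := hxs s; have e0 : enorm (xs s) != 0 by rewrite enorm_eq0.
  have D1 : is_derive s 1 (fun r => (enorm (xs r))^-1)
     (- (enorm (xs s)) ^- 2 *: (dot (xs s) (derive1 xs s) / enorm (xs s))).
    by have D2 := is_derive_enorm x0 (is_derive_xs s); exact: is_deriveV.
  have := collinear_of_momentum0 (zs_planar s) (L s).
  rewrite /phase_orbit !col_mxKu !col_mxKd => C.
  have {}C : dot (xs s) (xs s) *: derive1 xs s = dot (xs s) (derive1 xs s) *: xs s.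
    rewrite -(psi_phi hphi va) /psi; move: (kpsi a f _) => k.
    by rewrite dotZr -(scalerA k) -C !scalerA mulrC.
  have S : dot (xs s) (xs s) = enorm (xs s) ^+ 2 by rewrite enormE sqr_sqrtr// dot_ge0.
  rewrite S in C.
  apply/is_derive_mxP => i j; rewrite mxE.
  have Di : is_derive s 1 (fun r => xs r i j) (derive1 xs s i j).
    by have /is_derive_mxP := is_derive_xs s.
  apply: is_derive_ext (is_derive_mulf D1 Di) => [r|]; first by rewrite mxE.
  have := congr1 (fun Q : 'cV[R]_3 => Q i j) C; rewrite !mxE => Cij.
  rewrite /GRing.scale/=.
  transitivity (enorm (xs s) ^- 3 * (enorm (xs s) ^+ 2 * derive1 xs s i j -
     dot (xs s) (derive1 xs s) * xs s i j)); first by field.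
  by rewrite Cij subrr mulr0.
exists ((enorm (xs 0))^-1 *: xs 0) => s.
by have [s0|/ltW s0] := leP 0 s; [symmetry|]; exact: (zero_derive_const s0 (fun r _ => D r)).
Qed.

(** A zero of the momentum would annihilate the angular momentum; thus the orbit never meets the
    points where the field may fail to be differentiable. *)
Lemma zs_regular t : regular_phase b (zs t).
Proof.
have [x0 _ va _] := hxs t; split; rewrite /phase_orbit ?col_mxKu ?col_mxKd//; last exact: (phi_ball hphi).
apply: contraNneq (angular_momentum_neq0 t) => p0.
by rewrite /angular_momentum /phase_orbit col_mxKu col_mxKd p0 dot0r.
Qed.

Lemma radial_motion : exists t0, dot (xs t0) (derive1 xs t0) != 0.
Proof.
apply: contrapT => N; apply: hcirc; exists (enorm (xs 0)).
  by have [x0 _ _ _] := hxs 0; exact: enorm_gt0.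
move=> t; apply: (zero_derive_real (g := fun s => enorm (xs s))) => s.
have [x0 _ _ _] := hxs s.
apply: is_derive_ext (is_derive_enorm x0 (is_derive_xs s)) => //.
have [->|n0] := eqVneq (dot (xs s) (derive1 xs s)) 0; first by rewrite mul0r.
by exfalso; apply: N; exists s.
Qed.

Lemma proj12_phi (v : 'cV[R]_3) : v ord_max 0 = 0 -> phi f (proj12 v) = proj12 (phi f v).
Proof.
move=> v2; have E : enorm (proj12 v) = enorm v by rewrite !enormE dot_proj12 v2 mul0r addr0.
rewrite /phi -!enorm_eq0 E; case: eqP => _; last by rewrite proj12Z.
by apply/matrixP => i j; rewrite !mxE.
Qed.

Lemma planar_regular (z : 'cV[R]_(3 + 3)) : planar z -> regular_phase b z ->
  regular_phase b (planar_projection z).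
Proof.
move=> [x2 p2] [x0 p0 pb]; rewrite /regular_phase /planar_projection !col_mxKu !col_mxKd; split.
- by apply: contra_neq x0 => /proj12_inj; exact.
- by apply: contra_neq p0 => /proj12_inj; exact.
- by move: pb; rewrite /eball/= !enormE dot_proj12 p2 mul0r addr0.
Qed.

Section Shifted.
Variable t0 : R.
Hypothesis t0P : dot (xs t0) (derive1 xs t0) != 0.

Definition planar_orbit (t : R) := planar_projection (zs (t + t0)).
Notation zp := planar_orbit.

Lemma planar_orbit_regular t : regular_phase b (zp t).
Proof. exact: planar_regular (zs_planar _) (zs_regular _). Qed.

Lemma is_derive_planar_orbit (t : R) : is_derive t 1 zp (X0 (zp t)).
Proof.
rewrite /planar_orbit -planar_central; last exact: zs_planar.
exact: is_derive_planar_projection (is_derive_shift (is_derive_zs (t + t0))).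
Qed.

Lemma planar_orbit_ham : ham_solution (phase_space b (d := 2)) (H0 a f V (d := 2)) zp.
Proof.
move=> t; have Rz := planar_orbit_regular t; have [x0 p0 pb] := Rz.
have [d dE] := is_derive_planar_orbit t.
by split => //; rewrite derive1E dE (gradient_H0 hphi hV).
Qed.

Lemma planar_orbit_initial : initial_conditions f (M2 xs) (zp 0).
Proof.
have R0 : rotation 0 = 1%:M :> 'M[R]_2.
  by rewrite /rotation cos0 sin0 oppr0 (raddf0 (@scalar_mx R 1)) -scalar_mx_block.
exists (fun t => rotation 0 *m proj12 (xs (t - (- t0)))); first by exists 0, (- t0).
have E : (fun t => rotation 0 *m proj12 (xs (t - (- t0)))) = fun t => proj12 (xs (t + t0)).
  by apply/funext => t; rewrite R0 mul1mx opprK.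
rewrite E /planar_orbit /planar_projection /phase_orbit col_mxKu col_mxKd add0r; congr col_mx; first by rewrite R0 mul1mx opprK add0r.
have D : is_derive (0 + t0) 1 xs (derive1 xs t0) by rewrite add0r; exact: is_derive_xs.
have [_ E1] := (@is_derive_submx R 2 1 _ _ _ (is_derive_shift D)).1.
rewrite derive1E E1 add0r; apply: proj12_phi.
have /is_derive_mxP /(_ ord_max 0) [_ <-] := is_derive_xs t0.
rewrite (_ : (fun x => _) = fun=> 0); last by apply/funext => s; rewrite hplane.
by rewrite derive_cst.
Qed.

Lemma linearized_mem (w : R -> 'cV[R]_(2 + 2)) (c : R) : periodic_with Ts w ->
  (forall t : R, is_derive t 1 w (Ad (zp t) *m w t + c *: X0 (zp t))) ->
  (forall t, dot (J 2 *m X0 (zp t)) (w t) = 0) ->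
  linearized_solutions (H0 a f V (d := 2)) Ts zp w.
Proof.
move=> pw Dw tw; split=> //; exists c => t; have Rz := planar_orbit_regular t.
have [d dE] := Dw t; split => //.
  by rewrite derive1E dE (hessian_H0 hphi hV)// (gradient_H0 hphi hV)// mulmxDr mulmxA scalemxAr.
apply/matrixP => i j; rewrite !ord1 (gradient_H0 hphi hV)// -dotE tw mxE//.
Qed.

Notation E2 := (plane_generator (0 : 'I_2) 1 : 'M[R]_2).

Lemma planar_rotation_mem :
  linearized_solutions (H0 a f V (d := 2)) Ts zp (fun t => diag_action E2 *m zp t).
Proof.
apply: (@linearized_mem _ 0) => [t|t|t].
- by rewrite /planar_orbit addrAC zs_periodic.
- rewrite scale0r addr0 jacobian_rotation ?plane_generator_tr//.
  exact: is_derive_mulmxl (is_derive_planar_orbit t).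
- by rewrite rotation_tangent ?plane_generator_tr.
Qed.

Lemma planar_velocity_mem :
  linearized_solutions (H0 a f V (d := 2)) Ts zp (fun t => X0 (zp t)).
Proof.
apply: (@linearized_mem _ 0) => [t|t|t].
- by rewrite /planar_orbit addrAC zs_periodic.
- rewrite scale0r addr0.
  exact: (is_derive_central hphi hV (planar_orbit_regular t) (is_derive_planar_orbit t)).
- by rewrite dot_J_skew.
Qed.

Lemma planar_projection_rotation (z : 'cV[R]_(3 + 3)) :
  planar_projection (diag_action E01 *m z) = diag_action E2 *m planar_projection z.
Proof.
have P (x : 'cV[R]_3) : proj12 (E01 *m x) = E2 *m proj12 x.
  apply/matrixP => i j; rewrite ord1 plane_generatorE.
  have -> : proj12 (E01 *m x) i 0 = (E01 *m x) (lshift 1 i) 0 by rewrite mxE.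
  rewrite plane_generatorE ![proj12 x _ 0]mxE; congr (_%:R * x _ 0 - _%:R * x _ 0);
    by [exact: val_inj|].
by rewrite /planar_projection !diag_actionE !col_mxKu !col_mxKd !P.
Qed.

(** The scalar product of the position component with x kills the rotation, leaving c2 <x, x'> = 0,
    which the choice of [t0] forbids unless c2 = 0; the rotation vector itself is non-zero by the
    angular momentum. *)
Lemma planar_tangent_independent c1 c2 :
  c1 *: (diag_action E01 *m zs t0) + c2 *: X0 (zs t0) = 0 -> c1 = 0 /\ c2 = 0.
Proof.
rewrite diag_actionE /central_field /phase_orbit !col_mxKu !col_mxKd.
have [x0 _ va _] := hxs t0; rewrite (psi_phi hphi)// !scale_col_mx add_col_mx => /eqP.
rewrite col_mx_eq0 => /andP[/eqP H1 _].
have c20 : c2 = 0.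
  have := congr1 (dot (xs t0)) H1.
  rewrite dotDr !dotZr dot_skew ?plane_generator_tr// dot0r mulr0 add0r => /eqP.
  by rewrite mulf_eq0 (negbTE t0P) orbF => /eqP.
split=> //; move: H1; rewrite c20 scale0r addr0 => H1.
apply/eqP; apply: contraTT isT => c10.
have E0 : E01 *m xs t0 = 0 by apply/eqP; move/eqP: H1; rewrite scaler_eq0 (negbTE c10).
have := angular_momentum_neq0 t0.
by rewrite /angular_momentum /phase_orbit col_mxKu col_mxKd E0 dot0l eqxx.
Qed.

Lemma planar_independent c1 c2 :
  c1 *: (diag_action E2 *m zp 0) + c2 *: X0 (zp 0) = 0 -> c1 = 0 /\ c2 = 0.
Proof.
rewrite /planar_orbit add0r -planar_projection_rotation -planar_central; last exact: zs_planar.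
rewrite -!planar_projectionZ -planar_projectionD => H1; apply: planar_tangent_independent.
set w := _ + _ in H1 *.
have [w1 w2] : planar w.
  have [x2 p2] := zs_planar t0; have [v1 v2] := planar_central_planar a f V (zs_planar t0).
  split; rewrite /w ?linearD/= ?linearZ/= mxE [X in X + _]mxE [X in _ + X]mxE ?v1 ?v2 mulr0 addr0;
  by rewrite diag_actionE ?col_mxKu ?col_mxKd plane_generatorE /= !mul0r subr0 mulr0.
move: H1; rewrite /planar_projection => /eqP; rewrite col_mx_eq0 => /andP[/eqP h1 /eqP h2].
by rewrite -(vsubmxK w) (proj12_inj h1 w1) (proj12_inj h2 w2) col_mx0.
Qed.

(** Nondegeneracy bounds the solution space by dimension 2, and the rotation and velocity variations
    already span it. *)
Lemma planar_kernel (w : R -> 'cV[R]_(2 + 2)) (c : R) : periodic_with Ts w ->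
  (forall t : R, is_derive t 1 w (Ad (zp t) *m w t + c *: X0 (zp t))) ->
  (forall t, dot (J 2 *m X0 (zp t)) (w t) = 0) ->
  exists c1 c2, forall t, w t = c1 *: (diag_action E2 *m zp t) + c2 *: X0 (zp t).
Proof.
move=> pw Dw tw; have [_ _ _ N] := hnd.
have [_ _ dim] := N _ planar_orbit_ham planar_orbit_initial.
exact: span_two dim planar_rotation_mem planar_velocity_mem (linearized_mem pw Dw tw) planar_independent.
Qed.

End Shifted.
End PlanarOrbit.

(** * The kernel of the linearized problem *)

Section Kernel.
Context {R : realType}.

Lemma radmx_continuous n (k kd : R -> R) (p : R -> 'cV[R]_n) (t : R) : {for t, continuous p} ->
  {for dot (p t) (p t), continuous k} -> {for dot (p t) (p t), continuous kd} ->
  {for t, continuous (fun s => radmx k kd (p s))}.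
Proof.
move=> cp ck ckd; apply: continuous_mxP => i j.
have cd : {for t, continuous (fun s => dot (p s) (p s))} by exact: continuous_dot.
have c1 : {for t, continuous (fun s => k (dot (p s) (p s)))} by exact: (continuous_comp cd ck).
have c2 : {for t, continuous (fun s => kd (dot (p s) (p s)))} by exact: (continuous_comp cd ckd).
have cc l : {for t, continuous (fun s => p s l 0)} by exact: continuous_coord.
have E : (fun s => radmx k kd (p s) i j) = fun s => k (dot (p s) (p s)) * (1%:M : 'M[R]_n) i j +
    2 * kd (dot (p s) (p s)) * (p s i 0 * p s j 0).
  by apply/funext => s; rewrite /radmx !mxE big_ord1 !mxE.
rewrite E; apply: cvgD; apply: cvgM => //.
- exact: cvg_cst.
- by apply: cvgM => //; exact: cvg_cst.
- by apply: cvgM; exact: cc.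
Qed.

Lemma continuous_submx m1 m2 (z : R -> 'cV[R]_(m1 + m2)) (t : R) : {for t, continuous z} ->
  {for t, continuous (fun s => usubmx (z s))} /\ {for t, continuous (fun s => dsubmx (z s))}.
Proof.
move=> cz; split; apply: continuous_mxP => i j.
  rewrite (_ : (fun x => _) = fun s => z s (lshift m2 i) j); first exact: continuous_coord.
  by apply/funext => s; rewrite mxE.
rewrite (_ : (fun x => _) = fun s => z s (rshift m1 i) j); first exact: continuous_coord.
by apply/funext => s; rewrite mxE.
Qed.

Variables (a b : \bar R) (f V : R -> R).
Hypotheses (hphi : phi_assumptions a b f) (hV : C2_on_positive V).

Lemma C1_at_continuous (k kd : R -> R) s : C1_at k kd s ->
  {for s, continuous k} /\ {for s, continuous kd}.
Proof. by move=> [N c]; split => //; exact: is_derive_continuous (nbhs_singleton N). Qed.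

Lemma jacobian_continuous d (z : R -> 'cV[R]_(d + d)) (t : R) : regular_phase b (z t) ->
  {for t, continuous z} -> {for t, continuous (fun s => central_jacobian a f V (z s))}.
Proof.
move=> [x0 p0 pb] /continuous_submx[cx cp].
have [k1 k2] := C1_at_continuous (C1_kpsi hphi p0 pb).
have [k3 k4] := C1_at_continuous (C1_kV hV x0).
have cP := radmx_continuous cp k1 k2; have cX := radmx_continuous cx k3 k4.
have Z : {for t, continuous (fun _ : R => 0 : R)} by apply: cvg_cst.
apply: continuous_mxP => i j; rewrite /central_jacobian.
case: (split_ordP i) => k ->; case: (split_ordP j) => l ->.
- rewrite (_ : (fun x => _) = (fun _ : R => 0 : R)); first exact: Z.
  by apply/funext => s; rewrite block_mxEul mxE.
- rewrite (_ : (fun x => _) = fun s => radmx (kpsi a f) (dkpsi a f) (dsubmx (z s)) k l).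
    exact: (@continuous_coord R d d R _ t k l cP).
  by apply/funext => s; rewrite block_mxEur.
- rewrite (_ : (fun x => _) = fun s => radmx (kV V) (dkV V) (usubmx (z s)) k l).
    exact: (@continuous_coord R d d R _ t k l cX).
  by apply/funext => s; rewrite block_mxEdl.
- rewrite (_ : (fun x => _) = (fun _ : R => 0 : R)); first exact: Z.
  by apply/funext => s; rewrite block_mxEdr mxE.
Qed.

Variables (xs : R -> 'cV[R]_3) (Ts h : R).
Hypothesis hTs : 0 < Ts.
Hypothesis hxs : is_solution a f (unperturbed_force V (d := 3)) xs.
Hypothesis hper : periodic_with Ts xs.
Hypothesis hplane : forall t, xs t ord_max 0 = 0.
Hypotheses (hcirc : ~ circular xs) (hrect : ~ rectilinear xs).
Hypothesis hnd : nondegenerate_fixed_energy (phase_space b (d := 2))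
             (H0 a f V (d := 2)) h (initial_conditions f (M2 xs)) 2 Ts.
Variable t0 : R.
Hypothesis t0P : dot (xs t0) (derive1 xs t0) != 0.

Notation X0 := (central_field a f V).
Notation Ad := (central_jacobian a f V).
Notation zs := (phase_orbit f xs).
Notation PG := (@plane_generator R 3).

Definition unit_orbit (t : R) := zs (Ts * t + t0).
Notation zeta := unit_orbit.

Lemma is_derive_zeta (t : R) : is_derive t 1 zeta (Ts *: X0 (zeta t)).
Proof. exact: is_derive_affine (is_derive_zs hphi hxs _). Qed.

Lemma zeta_continuous : continuous zeta.
Proof. by move=> t; exact: is_derive_continuous (is_derive_zeta t). Qed.

Lemma zeta_periodic : periodic_with 1 zeta.
Proof. by move=> t; rewrite /zeta mulrDr mulr1 addrAC (zs_periodic hxs hper). Qed.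

Lemma zeta0 : zeta 0 = zs t0.
Proof. by rewrite /zeta mulr0 add0r. Qed.

Lemma zeta_regular t : regular_phase b (zeta t).
Proof. exact: (zs_regular hphi hxs hplane hrect). Qed.

Lemma zeta_planar t : planar (zeta t).
Proof. exact: (zs_planar hxs hplane). Qed.

Lemma zeta_jacobian_continuous : continuous (fun t => Ad (zeta t)).
Proof. by move=> t; apply: jacobian_continuous; [exact: zeta_regular|exact: zeta_continuous]. Qed.

(* Tangent vectors at [zeta 0] of the orbit under rotations and time translations. *)
Definition tangent_vector (j : 'I_4) : 'cV[R]_(3 + 3) :=
  match val j with
  | 0%N => diag_action (PG 0 ord_max) *m zeta 0
  | 1%N => diag_action (PG 1 ord_max) *m zeta 0
  | 2%N => diag_action (PG 0 1) *m zeta 0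
  | _ => X0 (zeta 0)
  end.

Definition tangent_matrix : 'M[R]_(3 + 3, 4) := \matrix_(i, j) tangent_vector j i 0.
Notation B := tangent_matrix.

Lemma col_tangent_matrix j : col j B = tangent_vector j.
Proof. by apply/matrixP => i k; rewrite !mxE ord1. Qed.

Lemma tangent_matrix_trE v j : (B^T *m v) j 0 = dot (tangent_vector j) v.
Proof. by rewrite mxE; apply: eq_bigr => i _; rewrite !mxE. Qed.

Lemma tangent_matrixE (c : 'cV[R]_4) : B *m c = \sum_j c j 0 *: tangent_vector j.
Proof.
apply/matrixP => i k; rewrite !ord1 mxE summxE; apply: eq_bigr => j _.
by rewrite !mxE mulrC.
Qed.

Lemma tangent_vector_case (P : 'cV[R]_(3 + 3) -> Prop) :
  (forall i j : 'I_3, P (diag_action (PG i j) *m zeta 0)) -> P (X0 (zeta 0)) ->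
  forall j, P (tangent_vector j).
Proof. by move=> PE PX [[|[|[|[|//]]]] j4]; rewrite /tangent_vector /=. Qed.

Notation j0 := (@Ordinal 4 0 isT).
Notation j1 := (@Ordinal 4 1 isT).
Notation j2 := (@Ordinal 4 2 isT).
Notation j3 := (@Ordinal 4 3 isT).

Lemma tangent_vectorE : [/\ tangent_vector j0 = diag_action (PG 0 ord_max) *m zeta 0,
  tangent_vector j1 = diag_action (PG 1 ord_max) *m zeta 0,
  tangent_vector j2 = diag_action (PG 0 1) *m zeta 0 & tangent_vector j3 = X0 (zeta 0)].
Proof. by []. Qed.

Lemma sum_ord4 (W : zmodType) (F : 'I_4 -> W) : \sum_j F j = F j0 + F j1 + F j2 + F j3.
Proof.
rewrite !big_ord_recl big_ord0 addr0 !addrA.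
by congr (F _ + F _ + F _ + F _); exact: val_inj.
Qed.

Lemma out_of_plane i (z : 'cV[R]_(3 + 3)) : planar z -> i != ord_max ->
  diag_action (PG i ord_max) *m z =
  col_mx (usubmx z i 0 *: delta_mx ord_max 0) (dsubmx z i 0 *: delta_mx ord_max 0).
Proof.
move=> [x2 p2] i2; rewrite diag_actionE; congr col_mx; apply/matrixP => k l;
by rewrite ord1 plane_generatorE ?x2 ?p2 mulr0 subr0 !mxE andbT mulrC.
Qed.

Lemma planar_rotation_planar (z : 'cV[R]_(3 + 3)) : planar (diag_action (PG 0 1) *m z).
Proof. by rewrite diag_actionE /planar col_mxKu col_mxKd !plane_generatorE /= !mul0r subr0. Qed.

Lemma momentum_zeta0 : usubmx (zeta 0) 0 0 * dsubmx (zeta 0) 1 0 -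
  usubmx (zeta 0) 1 0 * dsubmx (zeta 0) 0 0 != 0.
Proof.
rewrite -angular_momentumE.
exact: (angular_momentum_neq0 hphi hxs hplane hrect).
Qed.

(** Third components see only the two rotations that leave the plane; they give a 2 by 2 system
    whose determinant is the angular momentum. The planar lemma settles the remaining two
    coefficients. *)
Lemma tangent_independent (c : 'cV[R]_4) : B *m c = 0 -> c = 0.
Proof.
rewrite tangent_matrixE sum_ord4; have [-> -> -> ->] := tangent_vectorE => E.
have Zp := zeta_planar 0; have [x2 p2] := Zp.
have [v1 v2] := planar_central_planar a f V Zp.
rewrite (out_of_plane Zp (i := 0) isT) (out_of_plane Zp (i := 1) isT) in E.
have [u1 u2] := planar_rotation_planar (zeta 0).
have eZ (r : R) : (r *: delta_mx ord_max 0 : 'cV[R]_3) ord_max 0 = r by rewrite !mxE !eqxx mulr1.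
have Eu : c j0 0 * usubmx (zeta 0) 0 0 + c j1 0 * usubmx (zeta 0) 1 0 = 0.
  have uD (u v : 'cV[R]_(3 + 3)) : usubmx (u + v) ord_max 0 = usubmx u ord_max 0 + usubmx v ord_max 0.
    by rewrite !mxE.
  have uZ k (u : 'cV[R]_(3 + 3)) : usubmx (k *: u) ord_max 0 = k * usubmx u ord_max 0 by rewrite !mxE.
  have u0 : usubmx (0 : 'cV[R]_(3 + 3)) ord_max 0 = 0 by rewrite !mxE.
  have := congr1 (fun w => usubmx w ord_max 0) E.
  by rewrite u0 !uD !uZ u1 v1 !mulr0 !addr0 !col_mxKu !eZ.
have Ed : c j0 0 * dsubmx (zeta 0) 0 0 + c j1 0 * dsubmx (zeta 0) 1 0 = 0.
  have uD (u v : 'cV[R]_(3 + 3)) : dsubmx (u + v) ord_max 0 = dsubmx u ord_max 0 + dsubmx v ord_max 0.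
    by rewrite !mxE.
  have uZ k (u : 'cV[R]_(3 + 3)) : dsubmx (k *: u) ord_max 0 = k * dsubmx u ord_max 0 by rewrite !mxE.
  have u0 : dsubmx (0 : 'cV[R]_(3 + 3)) ord_max 0 = 0 by rewrite !mxE.
  have := congr1 (fun w => dsubmx w ord_max 0) E.
  by rewrite u0 !uD !uZ u2 v2 !mulr0 !addr0 !col_mxKd !eZ.
have L := momentum_zeta0.
have c0 : c j0 0 = 0.
  apply/eqP; rewrite -(mulIr_eq0 _ (mulIf L)); apply/eqP.
  transitivity (dsubmx (zeta 0) 1 0 * (c j0 0 * usubmx (zeta 0) 0 0 + c j1 0 * usubmx (zeta 0) 1 0) -
     usubmx (zeta 0) 1 0 * (c j0 0 * dsubmx (zeta 0) 0 0 + c j1 0 * dsubmx (zeta 0) 1 0)); first ring.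
  by rewrite Eu Ed !mulr0 subrr.
have c1 : c j1 0 = 0.
  apply/eqP; rewrite -(mulIr_eq0 _ (mulIf L)); apply/eqP.
  transitivity (usubmx (zeta 0) 0 0 * (c j0 0 * dsubmx (zeta 0) 0 0 + c j1 0 * dsubmx (zeta 0) 1 0) -
     dsubmx (zeta 0) 0 0 * (c j0 0 * usubmx (zeta 0) 0 0 + c j1 0 * usubmx (zeta 0) 1 0)); first ring.
  by rewrite Eu Ed !mulr0 subrr.
have [c2 c3] : c j2 0 = 0 /\ c j3 0 = 0.
  apply: (planar_tangent_independent hphi hxs hplane hrect t0P).
  by rewrite -zeta0 -E c0 c1 !scale0r !add0r.
apply/matrixP => j k; rewrite ord1 mxE.
case: j => [[|[|[|[|//]]]] j4]; [rewrite -c0|rewrite -c1|rewrite -c2|rewrite -c3];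
  by congr (c _ _); exact: val_inj.
Qed.

Lemma gram_unit : B^T *m B \in unitmx.
Proof.
rewrite -unitmx_tr -row_free_unit; apply: inj_row_free => v Hv.
have E : B^T *m B *m v^T = 0 by rewrite -[LHS]trmxK trmx_mul trmxK Hv trmx0.
have : B *m v^T = 0 by apply: dot_eq0; rewrite dot_mulmxl mulmxA E dot0r.
by move=> /tangent_independent; move=> H1; rewrite -[v]trmxK H1 trmx0.
Qed.

Section KernelElement.
Variables (v : R -> 'cV[R]_(3 + 3)) (c : R).
Hypothesis Dv : forall t : R, is_derive t 1 v (Ts *: (Ad (zeta t) *m v t) + c *: X0 (zeta t)).
Hypothesis v01 : v 1 - v 0 = J 3 *m B *m B^T *m v 0.
Hypothesis v0t : dot (J 3 *m X0 (zeta 0)) (v 0) = 0.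

(** The symplectic pairing with [eta] is constant and [eta] closes up, so the jump of [v] pairs to
    zero with it. *)
Lemma kernel_pairing (eta : R -> 'cV[R]_(3 + 3)) :
  (forall t : R, is_derive t 1 eta (Ts *: (Ad (zeta t) *m eta t))) ->
  (forall t, dot (J 3 *m X0 (zeta t)) (eta t) = 0) -> eta 1 = eta 0 ->
  dot (J 3 *m eta 0) (v 1 - v 0) = 0.
Proof.
move=> De He e1; have := pairing_constant De Dv He 1.
by rewrite e1 dotBr => ->; rewrite subrr.
Qed.

Lemma velocity_variation (t : R) :
  is_derive t 1 (fun s => X0 (zeta s)) (Ts *: (Ad (zeta t) *m X0 (zeta t))).
Proof.
rewrite scalemxAr.
exact: (is_derive_central hphi hV (zeta_regular t) (is_derive_zeta t)).
Qed.

Lemma rotation_variation (i j : 'I_3) (t : R) :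
  is_derive t 1 (fun s => diag_action (PG i j) *m zeta s)
    (Ts *: (Ad (zeta t) *m (diag_action (PG i j) *m zeta t))).
Proof.
rewrite jacobian_rotation ?plane_generator_tr// scalemxAr.
exact: is_derive_mulmxl (is_derive_zeta t).
Qed.

Lemma zeta1 : zeta 1 = zeta 0.
Proof. by rewrite -[X in zeta X](add0r 1) zeta_periodic. Qed.

(** Pairing the jump J B q, with q = B^T v(0), against J times each tangent vector gives B^T B q =
    0, and the Gram matrix is invertible. Besides closing [v], this makes v(0) orthogonal to all
    tangent vectors. *)
Lemma kernel_orthogonal : B^T *m v 0 = 0.
Proof.
have P j : dot (J 3 *m tangent_vector j) (v 1 - v 0) = 0.
  apply: (tangent_vector_case (P := fun u => dot (J 3 *m u) (v 1 - v 0) = 0)) => [i k|].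
    apply: (kernel_pairing (eta := fun t => diag_action (PG i k) *m zeta t)) => [t|t|].
    - exact: rotation_variation.
    - by rewrite rotation_tangent// plane_generator_tr.
    - by rewrite zeta1.
  apply: (kernel_pairing (eta := fun t => X0 (zeta t))) => [t|t|].
  - exact: velocity_variation.
  - exact: dot_J_skew.
  - by rewrite zeta1.
have E : B^T *m B *m (B^T *m v 0) = 0.
  apply/matrixP => j k; rewrite ord1 -mulmxA tangent_matrix_trE mxE.
  have JJ (u u' : 'cV[R]_(3 + 3)) : dot (J 3 *m u) (J 3 *m u') = dot u u'.
    by rewrite dot_mulmxl mulmxA J_tr mulNmx J_sqr opprK mul1mx.
  by have := P j; rewrite v01 -!mulmxA JJ.
by rewrite -[LHS](mulKmx gram_unit) E mulmx0.
Qed.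

Lemma kernel_closed : v 1 = v 0.
Proof.
by apply/eqP; rewrite -subr_eq0 v01 -mulmxA kernel_orthogonal mulmx0.
Qed.

Lemma kernel_periodic : periodic_with 1 v.
Proof.
have [C C0 bC] := periodic_bounded zeta_jacobian_continuous
  (fun t => congr1 (fun y => Ad y) (zeta_periodic t)).
move=> t.
have K0 : 0 < Ts * (6 * C) by rewrite !mulr_gt0.
apply: (ode_uniqueness (g := fun t x => Ts *: (Ad (zeta t) *m x) + c *: X0 (zeta t)) K0
  (v := fun s => v (s + 1)) (w := v)) => [s x y|s|].
- rewrite opprD addrACA subrr addr0 -scalerBr -mulmxBr normrZ (gtr0_norm hTs) -!mulrA ler_pM2l//.
  by rewrite (le_trans (mulmx_norm _ _))// mulrA ler_wpM2r// ler_wpM2l.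
- by rewrite -(zeta_periodic s); apply: is_derive_shift; exact: Dv.
- by rewrite add0r kernel_closed.
Qed.

(** Time is rescaled back to the period [Ts] in which nondegeneracy is stated; the summand 0 matches
    the shape of [is_derive_affine]. *)
Definition planar_variation (t : R) := planar_projection (v (Ts^-1 * t + 0)).
Notation w := planar_variation.

Lemma zeta_rescaled t : zeta (Ts^-1 * t + 0) = zs (t + t0).
Proof. by rewrite /zeta addr0 mulrA mulfV ?mul1r// gt_eqF. Qed.

Lemma is_derive_planar_variation (t : R) :
  is_derive t 1 w (Ad (planar_orbit f xs t0 t) *m w t + (Ts^-1 * c) *: X0 (planar_orbit f xs t0 t)).
Proof.
have Zp := zs_planar hxs hplane (t + t0).
rewrite /planar_variation /planar_orbit -planar_central// -planar_jacobian//.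
rewrite -planar_projectionZ -planar_projectionD.
apply: is_derive_planar_projection; rewrite -zeta_rescaled.
apply: is_derive_ext (is_derive_affine (Dv (Ts^-1 * t + 0))) => //.
by rewrite scalerDr !scalerA mulVf ?scale1r// gt_eqF.
Qed.

Lemma planar_variation_periodic : periodic_with Ts w.
Proof.
move=> t; rewrite /planar_variation mulrDr mulVf ?gt_eqF// addrAC.
by rewrite kernel_periodic.
Qed.

(** The pairing with the velocity variation is constant in time and vanishes at 0 by the linearized
    energy condition [v0t]. *)
Lemma planar_variation_tangent t : dot (J 2 *m X0 (planar_orbit f xs t0 t)) (w t) = 0.
Proof.
have Zp := zs_planar hxs hplane (t + t0).
rewrite /planar_variation /planar_orbit -planar_central// -planar_pairing; last first.
  exact: planar_central_planar.
rewrite -zeta_rescaled (pairing_constant (eta := fun t => X0 (zeta t)) velocity_variation Dv)//.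
by move=> s; exact: dot_J_skew.
Qed.

Lemma dot_planar (u u' : 'cV[R]_(3 + 3)) : planar u ->
  dot u u' = dot (planar_projection u) (planar_projection u').
Proof.
move=> [u1 u2]; rewrite -{1}(vsubmxK u) -{1}(vsubmxK u') !dot_col_mx !dot_proj12 u1 u2.
by rewrite !mul0r !addr0.
Qed.

(** By nondegeneracy the planar part is a combination of the rotation and velocity variations; at
    time 0 it is also orthogonal to both, hence zero, and independence annihilates the
    coefficients. *)
Lemma planar_variation_eq0 t : w t = 0.
Proof.
have [c1 [c2 E]] := planar_kernel hphi hV hxs hper hplane hrect hnd t0P
  planar_variation_periodic is_derive_planar_variation planar_variation_tangent.
have Zp := zeta_planar 0; have ZE : planar_orbit f xs t0 0 = planar_projection (zeta 0).
  by rewrite /planar_orbit add0r zeta0.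
have O j := congr1 (fun Q : 'cV[R]_4 => Q j 0) kernel_orthogonal.
have [_ _ T2 T3] := tangent_vectorE.
have w0 : w 0 = planar_projection (v 0) by rewrite /planar_variation mulr0 addr0.
have O2 : dot (diag_action (PG 0 1) *m zeta 0) (v 0) = 0.
  by have := O j2; rewrite /= tangent_matrix_trE T2 mxE.
have O3 : dot (X0 (zeta 0)) (v 0) = 0.
  by have := O j3; rewrite /= tangent_matrix_trE T3 mxE.
have P01 := planar_rotation_planar (zeta 0).
have E0 : w 0 = c1 *: planar_projection (diag_action (PG 0 1) *m zeta 0) +
    c2 *: planar_projection (X0 (zeta 0)).
  by rewrite E ZE planar_projection_rotation (planar_central a f V Zp).
have d1 : dot (planar_projection (diag_action (PG 0 1) *m zeta 0)) (w 0) = 0.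
  rewrite w0; exact: etrans (esym (dot_planar _ P01)) O2.
have d2 : dot (planar_projection (X0 (zeta 0))) (w 0) = 0.
  rewrite w0; exact: etrans (esym (dot_planar _ (planar_central_planar a f V Zp))) O3.
have W0 : w 0 = 0 by apply: dot_eq0; rewrite {1}E0 dotDl !dotZl d1 d2 !mulr0 addr0.
have [c10 c20] := planar_independent hphi hxs hplane hrect t0P (etrans (esym (E 0)) W0).
by rewrite E c10 c20 !scale0r addr0.
Qed.

(** The planar part has just been shown to vanish. Orthogonality to the two rotations leaving the
    plane is a 2 by 2 system for the vertical components of position and momentum, again with the
    angular momentum as determinant. *)
Lemma kernel_initial : v 0 = 0.
Proof.
have Zp := zeta_planar 0.
have := planar_variation_eq0 0; rewrite /planar_variation mulr0 addr0 /planar_projection => /eqP.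
rewrite col_mx_eq0 => /andP[/eqP h1 /eqP h2].
have O j := congr1 (fun Q : 'cV[R]_4 => Q j 0) kernel_orthogonal.
have [T0 T1 _ _] := tangent_vectorE.
have dotd (u : 'cV[R]_3) : dot (delta_mx ord_max 0) u = u ord_max 0 by rewrite dotC dot_delta.
have O0 : usubmx (zeta 0) 0 0 * usubmx (v 0) ord_max 0 + dsubmx (zeta 0) 0 0 * dsubmx (v 0) ord_max 0 = 0.
  have := O j0; rewrite /= tangent_matrix_trE T0 [RHS]mxE out_of_plane//.
  by rewrite -{1}(vsubmxK (v 0)) dot_col_mx !dotZl !dotd.
have O1 : usubmx (zeta 0) 1 0 * usubmx (v 0) ord_max 0 + dsubmx (zeta 0) 1 0 * dsubmx (v 0) ord_max 0 = 0.
  have := O j1; rewrite /= tangent_matrix_trE T1 [RHS]mxE out_of_plane//.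
  by rewrite -{1}(vsubmxK (v 0)) dot_col_mx !dotZl !dotd.
have L := momentum_zeta0.
have a0 : usubmx (v 0) ord_max 0 = 0.
  apply/eqP; rewrite -(mulIr_eq0 _ (mulIf L)); apply/eqP.
  move: O0 O1; move: (usubmx (zeta 0)) (dsubmx (zeta 0)) (usubmx (v 0) _ _) (dsubmx (v 0) _ _) => x p al be O0 O1.
  transitivity (p 1 0 * (x 0 0 * al + p 0 0 * be) - p 0 0 * (x 1 0 * al + p 1 0 * be)); first ring.
  by rewrite O0 O1 !mulr0 subrr.
have b0 : dsubmx (v 0) ord_max 0 = 0.
  apply/eqP; rewrite -(mulIr_eq0 _ (mulIf L)); apply/eqP.
  move: O0 O1; move: (usubmx (zeta 0)) (dsubmx (zeta 0)) (usubmx (v 0) _ _) (dsubmx (v 0) _ _) => x p al be O0 O1.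
  transitivity (x 0 0 * (x 1 0 * al + p 1 0 * be) - x 1 0 * (x 0 0 * al + p 0 0 * be)); first ring.
  by rewrite O0 O1 !mulr0 subrr.
by rewrite -(vsubmxK (v 0)) (proj12_inj h1 a0) (proj12_inj h2 b0) col_mx0.
Qed.

(** With the planar variation identically zero, its equation reduces to c X_0 = 0, and X_0 is
    non-zero by independence. *)
Lemma kernel_parameter : c = 0.
Proof.
have [_ D] := is_derive_planar_variation 0.
have w0 : w = fun=> 0 by apply/funext => t; exact: planar_variation_eq0.
move: D; rewrite w0 derive_cst mulmx0 add0r => /esym D.
have [|_ c0] := planar_independent hphi hxs hplane hrect t0P (c1 := 0) (c2 := Ts^-1 * c).
  by rewrite scale0r add0r.
by apply/eqP; move/eqP: c0; rewrite mulf_eq0 invr_eq0 gt_eqF.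
Qed.

End KernelElement.
End Kernel.

(** * Back to the second order equation *)

Section NewtonEquation.
Context {R : realType}.

Lemma partial_coord n m (A : 'cV[R]_n -> 'cV[R]_m) (x : 'cV[R]_n) i j : differentiable A x ->
  partial i A x j 0 = partial i (fun y => A y j 0) x.
Proof.
move=> dA; rewrite /partial [in RHS]derive_line.
have D := is_derive_line x (delta_mx i 0) 0.
have dA' : differentiable A (x + 0 *: delta_mx i 0) by rewrite scale0r addr0.
have := is_derive_along (F := A) (c := fun s => x + s *: delta_mx i 0) dA' D.
case=> D1 _.
have D2 : is_derive (0 : R) 1 (fun s : R => A (x + s *: delta_mx i 0)) (partial i A x).
  by split => //; rewrite /partial [in RHS]derive_line.
by have /is_derive_mxP /(_ j 0) [_ ->] := D2.
Qed.

Lemma sum_ord3 (W : zmodType) (F : 'I_3 -> W) : \sum_j F j = F 0 + F 1 + F ord_max.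
Proof.
rewrite !big_ord_recl big_ord0 addr0 !addrA.
by congr (F _ + F _ + F _); exact: val_inj.
Qed.

(* Turns the canonical equations into the Lorentz force. *)
Lemma cross_curl (A : 'cV[R]_3 -> 'cV[R]_3) (x v : 'cV[R]_3) : differentiable A x ->
  \col_i dot v (partial i A x) - \sum_i v i 0 *: partial i A x = cross v (curl A x).
Proof.
move=> dA; pose P (i j : 'I_3) := partial i A x j 0.
have curlE k : curl A x k 0 = P (k + 1) (k + 2) - P (k + 2) (k + 1).
  by rewrite mxE /P !partial_coord.
have i3 : [/\ 0 + 1 = 1 :> 'I_3, 0 + 2 = ord_max :> 'I_3, 1 + 1 = ord_max :> 'I_3,
   1 + 2 = 0 :> 'I_3 & (ord_max + 1 = 0 :> 'I_3) /\ (ord_max + 2 = 1 :> 'I_3)].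
  by split; [..|split]; exact: val_inj.
have [a1 a2 a3 a4 [a5 a6]] := i3.
have S k : (\sum_i v i 0 *: partial i A x) k 0 = v 0 0 * P 0 k + v 1 0 * P 1 k + v ord_max 0 * P ord_max k.
  rewrite sum_ord3 /P; move: (partial 0 A x) (partial 1 A x) (partial ord_max A x) => p q r.
  by rewrite !mxE.
have T k : (\col_i dot v (partial i A x)) k 0 =
    v 0 0 * P k 0 + v 1 0 * P k 1 + v ord_max 0 * P k ord_max by rewrite mxE dot3.
have C k : cross v (curl A x) k 0 = v (k + 1) 0 * (P (k + 2 + 1) (k + 2 + 2) - P (k + 2 + 2) (k + 2 + 1)) -
    v (k + 2) 0 * (P (k + 1 + 1) (k + 1 + 2) - P (k + 1 + 2) (k + 1 + 1)) by rewrite mxE !curlE.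
have E k : (\col_i dot v (partial i A x) - \sum_i v i 0 *: partial i A x) k 0 =
    (\col_i dot v (partial i A x)) k 0 - (\sum_i v i 0 *: partial i A x) k 0.
  by move: (\col_i _) (\sum_i _) => p q; rewrite !mxE.
apply/matrixP => k l; rewrite ord1 E T S C; clearbody P; clear -a1 a2 a3 a4 a5 a6.
elim/ord3_ind: k; rewrite ?(a1, a2, a3, a4, a5, a6); ring.
Qed.

Variables (a b : \bar R) (f V : R -> R).
Hypotheses (hphi : phi_assumptions a b f).
Variables (eps0 : R) (U : R -> 'cV[R]_3 -> R) (A : R -> 'cV[R]_3 -> 'cV[R]_3).
Hypotheses (hA : smooth_family_C2 eps0 A) (hU0 : vanishes_at_0 U) (hA0 : vanishes_at_0 A).

(** phi(x') is the kinetic momentum P - A(x). Differentiating it along the orbit adds a term in the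
    derivative of A, which combines with the one in the canonical equation for P into the magnetic
    force. *)
Lemma newton_of_hamilton (eps h : R) (z : R -> 'cV[R]_(3 + 3)) :
  (forall t, regular_at b eps0 A eps (z t)) ->
  (forall t : R, is_derive t 1 z (field a f V U A eps (z t))) ->
  (forall t, ham a f V U A eps (z t) = h) ->
  is_solution a f (perturbed_force V (U eps) (A eps)) (fun t => usubmx (z t)) /\
  forall t, energy a f V (U eps) (usubmx (z t)) (derive1 (fun t => usubmx (z t)) t) = h.
Proof.
move=> Rz Dz Hz.
have Dx (t : R) : is_derive t 1 (fun t => usubmx (z t)) (psi a f (kinetic_momentum A eps (z t))).
  have [_ x0 _ _] := Rz t; have [D _] := is_derive_submx (Dz t).
  by move: D; rewrite fieldE// /full_field col_mxKu.
have dE t : derive1 (fun t => usubmx (z t)) t = psi a f (kinetic_momentum A eps (z t)).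
  by rewrite derive1E; have [_ ->] := Dx t.
have pE t : phi f (derive1 (fun t => usubmx (z t)) t) = kinetic_momentum A eps (z t).
  by rewrite dE (phi_psi hphi)//; have [] := Rz t.
split=> t; have [e0 x0 p0 pb] := Rz t; last first.
  by rewrite /energy pE -(Hz t) hamE.
split; [by []|by have [] := Dx t|by rewrite dE; exact: (psi_ball hphi)|].
rewrite (_ : (fun s => phi f _) = fun s => kinetic_momentum A eps (z s)); last first.
  by apply/funext => s; rewrite pE.
have dA : differentiable (A eps) (usubmx (z t)) by have [/(_ _ _ e0 x0)[]] := hA.
have [_ Dp] := is_derive_submx (Dz t).
have DA := is_derive_along (F := A eps) (c := fun s => usubmx (z s)) dA (Dx t).
apply: is_derive_ext (is_derive_subf Dp DA) => //.
rewrite fieldE// /full_field col_mxKd dE /perturbed_force central_forceE -cross_curl//.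
by rewrite addrA.
Qed.

End NewtonEquation.

(** * Assembly: from the abstract persistence theorem to solutions of the equation *)

Lemma sum_bounds (R : realType) (u1 u2 u3 u4 u5 : R) :
  0 <= u1 -> 0 <= u2 -> 0 <= u3 -> 0 <= u4 -> 0 <= u5 ->
  let L := 6 + u1 + u2 + u3 + u4 + u5 in
  [/\ [/\ 1 <= L, 6 <= L & u1 <= L], u2 <= L, u3 <= L, u4 <= L & u5 <= L].
Proof. by move=> h1 h2 h3 h4 h5 L; rewrite /L; split; [split|..]; lra. Qed.

Lemma time_shift_bound (R : realType) (t T T' c s : R) : 0 < T -> 0 < T' -> 0 <= t -> t <= T ->
  `|T - T'| <= s -> `|(T^-1 * t + c) - (T'^-1 * t + c)| <= s / T'.
Proof.
move=> T0 T0' t0 tT Ts.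
have -> : (T^-1 * t + c) - (T'^-1 * t + c) = (t / T) * ((T' - T) / T').
  by field; rewrite !gt_eqF.
rewrite normrM (ger0_norm (divr_ge0 t0 (ltW T0))) normrM distrC.
have -> : `|T'^-1| = T'^-1 by apply: gtr0_norm; rewrite invr_gt0.
apply: (@le_trans _ _ (`|T - T'| / T')); last by rewrite ler_wpM2r// invr_ge0 ltW.
by rewrite ler_piMl ?divr_ge0 ?(ltW T0')// ler_pdivrMr// mul1r.
Qed.

Lemma lipschitz_shift (R : realType) (T K x y s : R) : 0 < T -> 0 <= K ->
  x <= T * K * y -> y <= s / T -> x <= K * s.
Proof.
move=> T0 K0 xy ys; apply: (le_trans xy).
have TK : 0 <= T * K by rewrite mulr_ge0// ltW.
apply: (le_trans (ler_wpM2l TK ys)).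
by rewrite (_ : T * K * (s / T) = K * s)//; field; rewrite gt_eqF.
Qed.

(** [K * s] is the drift of the reference orbit caused by the change of period, 6 the max-norm bound
    of a phase rotation, and 3 + 1 the constant of [enorm_mxnorm] in dimension 3. *)
Lemma closeness_bound (R : realType) (x y s K sigma : R) : 0 < K -> x <= y ->
  y < s + 6 * (K * s) -> s <= sigma / (4 * (1 + 6 * K)) -> (3%:R + 1) * x < sigma.
Proof.
move=> K0 xy ys sS.
have C0 : 0 < 4 * (1 + 6 * K) by lra.
move: sS; rewrite ler_pdivlMr// => sS.
apply: (@lt_le_trans _ _ (s * (4 * (1 + 6 * K)))) => //.
rewrite (_ : s * (4 * (1 + 6 * K)) = 4 * (s + 6 * (K * s))); last by ring.
by rewrite (_ : 3%:R + 1 = 4 :> R) ?ltr_pM2l//; [exact: le_lt_trans ys|ring].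
Qed.

Lemma usubmx_dist (R : realType) m1 m2 (u w : 'cV[R]_(m1 + m2)) :
  `|usubmx u - usubmx w| <= `|u - w|.
Proof.
apply: cvnormP => // i.
by rewrite (le_trans _ (mxnorm_ge (u - w) (lshift m2 i) 0))// !mxE.
Qed.

Section Continuation.
Context {R : realType}.
Variables (a b : \bar R) (f V : R -> R).
Hypotheses (hphi : phi_assumptions a b f) (hV : C2_on_positive V).
Variables (eps0 : R) (U : R -> 'cV[R]_3 -> R) (A : R -> 'cV[R]_3 -> 'cV[R]_3).
Hypotheses (heps0 : 0 < eps0).
Hypotheses (hU : smooth_family_C2 eps0 U) (hA : smooth_family_C2 eps0 A).
Hypotheses (hU0 : vanishes_at_0 U) (hA0 : vanishes_at_0 A).
Variables (xs : R -> 'cV[R]_3) (Ts h : R).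
Hypothesis hTs : 0 < Ts.
Hypothesis hxs : is_solution a f (unperturbed_force V (d := 3)) xs.
Hypothesis hper : periodic_with Ts xs.
Hypothesis hplane : forall t, xs t ord_max 0 = 0.
Hypotheses (hcirc : ~ circular xs) (hrect : ~ rectilinear xs).
Hypothesis hh : forall t, energy a f V (fun=> 0) (xs t) (derive1 xs t) = h.
Hypothesis hnd : nondegenerate_fixed_energy (phase_space b (d := 2))
             (H0 a f V (d := 2)) h (initial_conditions f (M2 xs)) 2 Ts.
Variable t0 : R.
Hypothesis t0P : dot (xs t0) (derive1 xs t0) != 0.

Notation X := (field a f V U A).
Notation H := (ham a f V U A).
Notation zeta := (unit_orbit f xs Ts t0).
Notation Ad := (central_jacobian a f V).
Notation GG := (@phase_rotations R 3).

Lemma X0E : X 0 = @central_field R a f V 3.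
Proof. by apply/funext => z; rewrite /field eqxx. Qed.

Lemma H0E : H 0 = H0 a f V (d := 3).
Proof. by apply/funext => z; rewrite /ham eqxx. Qed.

Lemma energy_zeta t : H 0 (zeta t) = h.
Proof.
rewrite H0E -(hh (Ts * t + t0)) /energy /H0 /unit_orbit /phase_orbit col_mxKu col_mxKd.
by rewrite subr0.
Qed.

Lemma zeta_group_regular g t : GG g -> regular_phase b (g *m zeta t).
Proof. by move=> Gg; apply: regular_phase_rotation => //; exact: (zeta_regular hphi Ts hxs hplane hrect). Qed.

Lemma field_continuous_zeta : continuous (fun t => X 0 (zeta t)).
Proof.
move=> t; rewrite X0E.
exact: is_derive_continuous (is_derive_central hphi hV (zeta_regular hphi Ts hxs hplane hrect t0 t)
  (is_derive_zeta hphi Ts hxs t0 t)).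
Qed.

Lemma perturbed_orbits : exists2 K : R, 0 < K &
  (forall t : R, `|X 0 (zeta t)| <= K) /\
  forall sigma : R, 0 < sigma -> exists2 e : R, 0 < e & forall eps, `|eps| < e ->
  exists T y g, [/\ GG g, `|T - Ts| < sigma, periodic_with 1 y & forall t : R,
    [/\ is_derive t 1 y (T *: X eps (y t)), H eps (y t) = h & `|y t - g *m zeta t| < sigma]].
Proof.
have zC := zeta_continuous hphi hxs (Ts := Ts) (t0 := t0).
have zP := zeta_periodic hxs hper t0.
have zD := is_derive_zeta hphi Ts hxs t0.
have AC := zeta_jacobian_continuous hphi hV hxs hplane hrect (Ts := Ts) (t0 := t0).
have [CA CA0 bA] := periodic_bounded AC (fun t => congr1 (fun y => Ad y) (zP t)).
have [CX CX0 bX] := periodic_bounded field_continuous_zeta (fun t => congr1 (X 0) (zP t)).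
have [Cz Cz0 bz] := periodic_bounded zC zP.
exists CX => //; split => //.
pose nJ : R := 6 * `|J 3 : 'M[R]_(3 + 3)|.
have nJ0 : 0 <= nJ by rewrite mulr_ge0.
have CA6 : 0 <= 6 * CA by rewrite mulr_ge0// ltW.
(* The leading 6 is the dimension of phase space; it gives Lam >= 1 and bounds the rotations, whose
   entries are at most 1 in absolute value. *)
pose Lam : R := 6 + Ts + 6 * CA + CX + Cz + nJ.
have [[L1 L6 LT] LA LX Lz LJ] := sum_bounds (ltW hTs) CA6 (ltW CX0) (ltW Cz0) nJ0.
rewrite -/Lam in L1 L6 LT LA LX Lz LJ; clearbody Lam.
have [CH CH0 tubes] := @tubes_exist R (3 + 3) (J 3) X H zeta h GG (regular_phase b (d := 3))
  (fun z => Ad z) Lam L1 (fun q Rq => regular_phase_near Rq)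
  (sdiff_field hphi hV heps0 hU hA hU0 hA0)
  (ham_taylor hphi hV heps0 hU hA hU0 hA0)
  (ham_near V hphi heps0 hU hA hU0 hA0) zC zP (@phase_rotations_compact R 3)
  (@phase_rotations1 R 3) zeta_group_regular AC
  (fun g Gg => etrans (etrans (congr1 (fun F => F (g *m zeta 0)) H0E)
    (etrans (H0_rotation a f V (zeta 0) Gg) (esym (congr1 (fun F => F (zeta 0)) H0E)))) (energy_zeta 0)).
have zD' (t : R) : is_derive t 1 zeta (Ts *: X 0 (zeta t)) by rewrite X0E; exact: zD.
have N6 : (3 + 3)%:R <= Lam := L6.
have bA' t (v : 'cV[R]_(3 + 3)) : `|Ad (zeta t) *m v| <= Lam * `|v|.
  apply: le_trans (mulmx_norm _ _) _; apply: ler_wpM2r; first exact: normr_ge0.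
  by apply: le_trans LA; exact: (ler_wpM2l (ler0n R 6) (bA t)).
have bX' t : `|X 0 (zeta t)| <= Lam := le_trans (bX t) LX.
have bz' t : `|zeta t| <= Lam := le_trans (bz t) Lz.
have bJ' (v : 'cV[R]_(3 + 3)) : `|J 3 *m v| <= Lam * `|v|.
  by apply: le_trans (mulmx_norm _ _) _; apply: ler_wpM2r; [exact: normr_ge0|exact: LJ].
have bg g (v : 'cV[R]_(3 + 3)) : GG g -> `|g *m v| <= Lam * `|v|.
  move=> Gg; have [b1 _] := phase_rotations_bound v Gg.
  by apply: (le_trans b1); apply: ler_wpM2r; [exact: normr_ge0|exact: L6].
have bgT g (v : 'cV[R]_(3 + 3)) : GG g -> `|g^T *m v| <= Lam * `|v|.
  move=> Gg; have [_ b1] := phase_rotations_bound v Gg.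
  by apply: (le_trans b1); apply: ler_wpM2r; [exact: normr_ge0|exact: L6].
have gJ (g : 'M[R]_(3 + 3)) : GG g -> J 3 *m g = g *m J 3.
  by move=> [M oM <-]; exact: J_diag_action.
have gX g v : GG g -> X 0 (g *m v) = g *m X 0 v.
  by move=> Gg; rewrite X0E; exact: central_field_rotation.
have gH g v : GG g -> H 0 (g *m v) = H 0 v.
  by move=> Gg; rewrite H0E; exact: H0_rotation.
have nd (v : R -> 'cV[R]_(3 + 3)) c :
  (forall t : R, is_derive t 1 v (Ts *: (Ad (zeta t) *m v t) + c *: X 0 (zeta t))) ->
  v 1 - v 0 = J 3 *m tangent_matrix a f V xs Ts t0 *m (tangent_matrix a f V xs Ts t0)^T *m v 0 ->
  dot (J 3 *m X 0 (zeta 0)) (v 0) = 0 -> v 0 = 0 /\ c = 0.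
  rewrite X0E => Dv v01 v0t; split.
    exact: (kernel_initial hphi hV hTs hxs hper hplane hrect hnd t0P Dv v01 v0t).
  exact: (kernel_parameter hphi hV hTs hxs hper hplane hrect hnd t0P Dv v01 v0t).
have BU := gram_unit hphi Ts hxs hplane hrect t0P.
have cB j : col j (tangent_matrix a f V xs Ts t0) = X 0 (zeta 0) \/
    exists Xi Rc Ce, generator GG Xi Rc Ce /\ col j (tangent_matrix a f V xs Ts t0) = Xi *m zeta 0.
  rewrite col_tangent_matrix X0E; have G i k := @plane_rotation_generator R 3 i k.
  case: j => [[|[|[|[|//]]]] j4]; last by left.
  - by right; eexists _, _, _; split; [exact: (G 0 ord_max isT)|reflexivity].
  - by right; eexists _, _, _; split; [exact: (G 1 ord_max isT)|reflexivity].
  - by right; eexists _, _, _; split; [exact: (G 0 1 isT)|reflexivity].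
move=> sigma s0.
exact: (persistence L1 hTs LT N6 CH0 (@J_tr R 3) (@J_sqr R 3) zD' zP AC bA' bX' bz' bJ'
  (@phase_rotations_orthogonal R 3) bg bgT gJ gX gH nd (@phase_rotations_compact R 3)
  (@phase_rotations1 R 3) BU cB tubes s0).
Qed.

(** The passage back to the second-order equation divides by nothing singular only where x and the
    kinetic momentum are non-zero; compactness gives one radius for the whole group orbit. *)
Lemma regular_tube : exists2 d : R, 0 < d & forall eps g t y, GG g -> `|eps| < d ->
  `|y - g *m zeta t| < d -> regular_at b eps0 A eps y.
Proof.
have zC := zeta_continuous hphi hxs (Ts := Ts) (t0 := t0).
have zP := zeta_periodic hxs hper t0.
have cK : compact (orbit_tube zeta GG 0).
  exact: (@orbit_tube_compact _ _ zeta GG zC (@phase_rotations_compact R 3)).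
have [|d d0 Hd] := @uniform_near _ _ _ (fun d q => forall eps y, `|eps| < d -> `|y - q| < d ->
    regular_at b eps0 A eps y) cK.
  move=> q /(orbit_tube0_regular zeta_group_regular) /(regular_at_near heps0 hA hA0)[d d0 Hd].
  exists (d / 2); first by rewrite divr_gt0.
  move=> d' q' /andP[d'0 d'd] q'd eps y ed yd; apply: Hd; first lra.
  by rewrite -(subrKA q') (le_lt_trans (ler_normD _ _))//; lra.
exists (d / 2); first by rewrite divr_gt0.
move=> eps g t y Gg ed yd; apply: (Hd (d / 2) (g *m zeta t)) => //.
  by rewrite divr_gt0//=; lra.
exact: (orbit_tube0 zP).
Qed.

Lemma zeta_lipschitz K s s' : 0 <= K -> (forall t, `|X 0 (zeta t)| <= K) ->
  `|zeta s - zeta s'| <= Ts * K * `|s - s'|.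
Proof.
move=> K0 bX.
have := @segment_mvt_mx R _ _ (fun t => zeta ((s - s') * t + s'))
  (fun t => (s - s') *: (Ts *: X 0 (zeta ((s - s') * t + s')))) (Ts * K * `|s - s'|).
rewrite mulr1 mulr0 add0r subrK; apply => t _.
  by rewrite X0E; exact: (@is_derive_affine R _ zeta _ (s - s') s' t (is_derive_zeta hphi Ts hxs t0 _)).
by rewrite !normrZ (gtr0_norm hTs) mulrC ler_wpM2r// ler_pM2l.
Qed.

Lemma continuation : forall sigma : R, 0 < sigma ->
  exists2 eps_star : R, 0 < eps_star <= eps0 &
  forall eps : R, - eps_star < eps < eps_star ->
  exists (x : R -> 'cV[R]_3) (T : R) (M : 'M[R]_3),
    [/\ fixed_energy_periodic_solution a f V (U eps) (A eps) h x T,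
        orthogonal M,
        `|T - Ts| < sigma &
        forall t, 0 <= t <= T -> enorm (x t - M *m xs t) < sigma].
Proof.
move=> sigma s0; have [K K0 [bX PO]] := perturbed_orbits.
have [d d0 Rd] := regular_tube.
pose C := 4 * (1 + 6 * K); have C0 : 0 < C by rewrite /C; lra.
(* The bounds serve, in order, the required closeness of the period, the positivity of T, the
   regularity of the orbit, and the closeness of the positions after the losses collected in [C]. *)
pose s1 := Num.min (Num.min sigma Ts) (Num.min d (sigma / C)).
have s10 : 0 < s1 by rewrite /s1 !lt_min s0 hTs d0 divr_gt0.
have [s1s s1T s1d s1C] : [/\ s1 <= sigma, s1 <= Ts, s1 <= d & s1 <= sigma / C].
  by rewrite /s1 !ge_min !lexx !orbT.
clearbody s1; have [e e0 He] := PO _ s10.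
exists (Num.min eps0 (Num.min e d)); first by rewrite !lt_min heps0 e0 d0 /= ge_min lexx.
move=> eps /andP[ea eb].
have : `|eps| < Num.min eps0 (Num.min e d) by rewrite ltr_norml ea.
rewrite !lt_min => /and3P[e1 e2 e3].
have [T [y [g [Gg TT yp Hy]]]] := He _ e2.
have T0 : 0 < T by move: TT; rewrite ltr_norml => /andP[? ?]; lra.
have Tn : T != 0 by rewrite gt_eqF.
have Tsn : Ts != 0 by rewrite gt_eqF.
(* Undoes the shift of the starting time, so that [zeta] at Ts^-1 * t + c is the phase point of [xs]
   at time t. *)
pose c := - t0 / Ts.
pose z (t : R) := y (T^-1 * t + c).
have Dz (t : R) : is_derive t 1 z (X eps (z t)).
  have [D _ _] := Hy (T^-1 * t + c).
  by have := is_derive_affine D; rewrite scalerA mulVf// scale1r.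
have Rz t : regular_at b eps0 A eps (z t).
  by apply: (Rd eps g (T^-1 * t + c)) => //; have [_ _ yt] := Hy (T^-1 * t + c); exact: lt_le_trans yt _.
have Hz t : H eps (z t) = h by have [] := Hy (T^-1 * t + c).
have [M oM gM] := Gg.
have [sol en] := newton_of_hamilton hphi hA hU0 hA0 Rz Dz Hz.
exists (fun t => usubmx (z t)), T, M; split => //; last 2 first.
- exact: lt_le_trans TT s1s.
- move=> t /andP[t00 tT].
  have zsE : zeta (Ts^-1 * t + c) = phase_orbit f xs t.
    rewrite /unit_orbit; congr (phase_orbit f xs _).
    by rewrite /c; field.
  have xsE : M *m xs t = usubmx (g *m zeta (Ts^-1 * t + c)).
    by rewrite zsE -gM diag_actionE col_mxKu /phase_orbit col_mxKu.
  have dst : `|(T^-1 * t + c) - (Ts^-1 * t + c)| <= s1 / Ts.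
    exact: time_shift_bound T0 hTs t00 tT (ltW TT).
  have n1 : `|z t - g *m zeta (T^-1 * t + c)| < s1 by have [] := Hy (T^-1 * t + c).
  have g6 (u : 'cV[R]_(3 + 3)) : `|g *m u| <= 6 * `|u| := (phase_rotations_bound u Gg).1.
  (* The perturbed orbit is close to the reference one at the phase measured with T, while the claim
     uses the phase measured with Ts; over one period the two differ by at most s1 / Ts. *)
  have n2 : `|zeta (T^-1 * t + c) - zeta (Ts^-1 * t + c)| <= K * s1.
    exact: lipschitz_shift hTs (ltW K0) (zeta_lipschitz _ _ (ltW K0) bX) dst.
  have n3 : `|z t - g *m zeta (Ts^-1 * t + c)| < s1 + 6 * (K * s1).
    rewrite -(subrKA (g *m zeta (T^-1 * t + c))) -mulmxBr.
    apply: le_lt_trans (ler_normD _ _) _; apply: ltr_leD n1 _.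
    exact: le_trans (g6 _) (ler_wpM2l (ler0n R 6) n2).
  have n4 : `|usubmx (z t) - M *m xs t| <= `|z t - g *m zeta (Ts^-1 * t + c)|.
    rewrite xsE; exact: usubmx_dist.
  exact: le_lt_trans (enorm_mxnorm _) (closeness_bound K0 n4 n3 s1C).
- split => // t.
  by rewrite /z mulrDr mulVf// addrAC yp.
Qed.

End Continuation.

Theorem theorem5p9 (R : realType) (a b : \bar R) (f V : R -> R)
    (hphi : phi_assumptions a b f) (hV : C2_on_positive V)
    (eps0 : R) (heps0 : 0 < eps0)
    (U : R -> 'cV[R]_3 -> R) (A : R -> 'cV[R]_3 -> 'cV[R]_3)
    (hU : smooth_family_C2 eps0 U) (hA : smooth_family_C2 eps0 A)
    (hU0 : vanishes_at_0 U) (hA0 : vanishes_at_0 A)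
    (xs : R -> 'cV[R]_3) (Ts h : R) (hTs : 0 < Ts)
    (hxs : is_solution a f (unperturbed_force V (d := 3)) xs)
    (hper : periodic_with Ts xs)
    (hplane : forall t, xs t ord_max 0 = 0)
    (hcirc : ~ circular xs) (hrect : ~ rectilinear xs)
    (hh : forall t, energy a f V (fun=> 0) (xs t) (derive1 xs t) = h)
    (hnd : nondegenerate_fixed_energy (phase_space b (d := 2))
             (H0 a f V (d := 2)) h (initial_conditions f (M2 xs)) 2 Ts) :
  forall sigma : R, 0 < sigma ->
  exists2 eps_star : R, 0 < eps_star <= eps0 &
  forall eps : R, - eps_star < eps < eps_star ->
  exists (x : R -> 'cV[R]_3) (T : R) (M : 'M[R]_3),
    [/\ fixed_energy_periodic_solution a f V (U eps) (A eps) h x T,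
        orthogonal M,
        `|T - Ts| < sigma &
        forall t, 0 <= t <= T -> enorm (x t - M *m xs t) < sigma].
Proof.
have [t0 t0P] := radial_motion hxs hcirc.
exact: (continuation hphi hV heps0 hU hA hU0 hA0 hTs hxs hper hplane hrect hh hnd t0P).
Qed.
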